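(* For each $n$, let $g_n:(0,\infty)\to(0,\infty)$ be strictly increasing (possibly depending on $n$), let the edges $e$ of the complete graph $K_n$ on $[n]$ carry i.i.d. weights $Y_e^{(K_n)}=g_n(E_e^{(K_n)})$ with $(E_e^{(K_n)})_e$ i.i.d. exponential with mean $1$, and set $f_n(x)=g_n(x/n)$, $x>0$. Suppose that $\lim_{n\to\infty}f_n(x+\delta)/f_n(x)=\infty$ for all $x,\delta>0$. Then, for each $n$, the smallest-weight tree $(\mathrm{SWT}^{(1)}_t)_{t\ge0}$ on $K_n$ from vertex $1$ can be coupled to invasion percolation $(\mathrm{IP}^{(1)}(k))_{k\ge0}$ on one copy of the Poisson-weighted infinite tree $\mathcal{T}^{(1)}$, equipped with marks $(M_v)_{v\in\mathcal{T}^{(1)}}$, such that for every fixed $m\in\mathbb{N}$, $$\mathbb{P}\bigl(\mathrm{SWT}^{(1)}_{\tau_k}=\pi_M(\mathrm{IP}^{(1)}(k))\ \text{for all }k\le m\bigr)=1-o(1)\qquad\text{as }n\to\infty,$$ where $\tau_k=\inf\{t\ge0:\ |E(\mathrm{SWT}^{(1)}_t)|=k\}$ is the time when the $k$-th edge is added to $\mathrm{SWT}^{(1)}$.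
   Context: First passage distance on $K_n$: $d(i,j)=\min_{\pi:i\to j}\sum_{e\in\pi}Y_e^{(K_n)}$, with (a.s. unique) optimal path $\pi_{i,j}$. The smallest-weight tree $\mathrm{SWT}^{(1)}_t$ is the subgraph of $K_n$ with vertex set $\{i\in[n]:d(1,i)\le t\}$ and edge set $\{e: e\in\pi_{1,i}\text{ for some }i\text{ with }d(1,i)\le t\}$. Poisson-weighted infinite tree (PWIT): the infinite rooted tree $\mathcal{T}^{(1)}$ with root $\emptyset_1$ in which each vertex $v$ has children $v1,v2,\dots$; the weight $X_{vk}$ of the edge between $v$ and its $k$-th child is such that, for each $v$, $(X_{v1},X_{v2},\dots)$ are the ordered points of a rate-1 Poisson point process on $(0,\infty)$, independently over $v$. Invasion percolation: $\mathrm{IP}^{(1)}(0)=\{\emptyset_1\}$, and $\mathrm{IP}^{(1)}(k)$ is obtained from $\mathrm{IP}^{(1)}(k-1)$ by adding the vertex $v\notin\mathrm{IP}^{(1)}(k-1)$ with parent in $\mathrm{IP}^{(1)}(k-1)$ having minimal edge weight $X_v$. Marks: $M_{\emptyset_1}=1$, and the marks $M_v$, $v\ne\emptyset_1$, are i.i.d. uniform on $[n]$, independent of the weights $(X_v)$. For $\tau\subset\mathcal{T}^{(1)}$, $\pi_M(\tau)$ is the subgraph of $K_n$ with vertex set $\{M_v:v\in\tau\}$ and an edge between $M_v$ and $M_{p(v)}$ whenever $v$ and its parent $p(v)$ both lie in $\tau$. A coupling means a realization of all these objects on one probability space, each with its prescribed law. *)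

(* Defs.v *)
From HB Require Import structures.
From mathcomp Require Import all_boot all_order all_algebra.
From mathcomp Require Import all_classical all_reals all_analysis.

Set Implicit Arguments.
Unset Strict Implicit.
Unset Printing Implicit Defensive.

Import Order.TTheory GRing.Theory Num.Theory.
Import numFieldNormedType.Exports.

Local Open Scope classical_set_scope.
Local Open Scope ring_scope.

(* Subgraphs of the complete graph on V. The edge {i, j} is the two-element
   finite set [set i; j]%SET; edge weights are functions on {set V}, of which
   only the values at two-element sets matter. *)
Definition Kedges (V : finType) : set {set V} :=
  [set e : {set V} | #|e| = 2%N].
Arguments Kedges : clear implicits.

Record subgraph (V : finType) := Subgraph {
  vertices : set V;
  edges : set {set V} }.

(** First passage percolation on the complete graph *)

Section FirstPassage.
Variables (R : realType) (V : finType).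
Implicit Types (Y : {set V} -> R) (i j : V) (p : seq V) (t : \bar R).

(* Self-avoiding paths from i to j; p is the list of vertices after i. *)
Definition paths i j : set (seq V) :=
  [set p | uniq (i :: p) /\ last i p = j].

Definition path_edges i p : seq {set V} :=
  pairmap (fun a b => [set a; b]%SET) i p.

Definition path_weight Y i p : R := \sum_(e <- path_edges i p) Y e.

(* There are finitely many self-avoiding paths, so this inf is a min. *)
Definition fp_dist Y i j : R := inf [set path_weight Y i p | p in paths i j].

Definition optimal_path Y i j p : Prop :=
  paths i j p /\ path_weight Y i p = fp_dist Y i j.

(* Optimal paths are a.s. unique; on the null event where they are not, the
   edges of all of them are kept. Times range over the extended reals, so that
   SWT at +oo is the union of all optimal paths from o. *)
Definition SWT Y (o : V) t : subgraph V := {|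
  vertices := [set i | ((fp_dist Y o i)%:E <= t)%E];
  edges := [set e | exists i p, [/\ ((fp_dist Y o i)%:E <= t)%E,
                      optimal_path Y o i p & e \in path_edges o p]] |}.

(* The infimum is +oo if no such time exists. *)
Definition SWT_time Y (o : V) (k : nat) : \bar R :=
  ereal_inf [set t%:E | t in [set t : R |
    0 <= t /\ (edges (SWT Y o t%:E) #= `I_k)%card]].

End FirstPassage.

(** The infinite tree. A vertex is the word of child indices (numbered from 0)
    leading to it from the root [::], last index first: k :: v is a child of v,
    and the parent of v <> [::] is behead v. *)

Notation vertex := (seq nat).

Definition children (v : vertex) : set vertex := [set k :: v | k in [set: nat]].

Definition nonroot : set vertex := [set v | v <> [::]].

(* X v is the weight of the edge between v <> [::] and its parent. *)
Definition IP_boundary (S : set vertex) : set vertex :=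
  [set v | [/\ nonroot v, ~ S v & S (behead v)]].

(* The minimizer is a.s. unique; on the null event where it is not, all (or
   none, if there is none) are added. *)
Fixpoint IP (R : realType) (X : vertex -> R) (k : nat) : set vertex :=
  match k with
  | 0 => [set [::]]
  | k'.+1 => IP X k' `|` [set v | IP_boundary (IP X k') v /\
               forall u, IP_boundary (IP X k') u -> X v <= X u]
  end.

(* Being a subgraph of the complete graph, the image has no loop: an edge of
   the tree whose ends carry the same mark contributes no edge. *)
Definition mark_image (V : finType) (M : vertex -> V) (tau : set vertex)
  : subgraph V := {|
  vertices := M @` tau;
  edges := [set [set M v; M (behead v)]%SET | v in
              [set v | [/\ nonroot v, tau v & tau (behead v)]]] `&` Kedges V |}.

(** Laws *)

Section Laws.
Variables (R : realType) (d : measure_display) (T : measurableType d).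
Variable P : probability T R.

Definition independent (I : eqType) (D : set I) (F : I -> set (set T)) : Prop :=
  forall (s : seq I) (A : I -> set T), uniq s ->
    (forall i, i \in s -> D i /\ F i (A i)) ->
    P (\bigcap_(i in [set` s]) A i) = (\prod_(i <- s) P (A i))%E.

(* The sigma-algebra generated by the X i, i in D, where the codomain is
   equipped with the sigma-algebra G. *)
Definition sigma_of (U I : Type) (G : set (set U)) (D : set I)
    (X : I -> T -> U) : set (set T) :=
  <<s \bigcup_(i in D) preimage_set_system setT (X i) G >>.

Definition iid_exp1_edges (V : finType) (E : {set V} -> {RV P >-> R}) : Prop :=
  independent (Kedges V) (fun e => sigma_of measurable [set e] E) /\
  forall e, Kedges V e -> forall B, measurable B ->
    distribution P (E e) B = exponential_prob 1 B.

(* The numbers of points in disjoint Borel sets of finite Lebesgue measure are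
   independent Poisson variables with means the measures of the sets. The
   second argument of poisson_prob is a dummy. *)
Definition ordered_PPP1 (X : nat -> {RV P >-> R}) : Prop :=
  {ae P, forall w, 0 < X 0%N w /\ forall k, X k w < X k.+1 w} /\
  forall (r : nat) (B : 'I_r -> set R) (c : 'I_r -> nat),
    (forall i, [/\ measurable (B i), B i `<=` [set x | 0 < x]
                 & (lebesgue_measure (B i) < +oo)%E]) ->
    trivIset setT B ->
    P (\bigcap_(i in [set: 'I_r]) 
      [set w | ([set k | B i (X k w)] #= `I_(c i))%card])
    = (\prod_(i < r)
         poisson_prob (fine (lebesgue_measure (B i))) 0 [set c i])%E.

Definition PWIT_weights (X : vertex -> {RV P >-> R}) : Prop :=
  (forall v, ordered_PPP1 (fun k => X (k :: v))) /\
  independent setT (fun v => sigma_of measurable (children v) X).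

(* All subsets of the finite set V are measurable. *)
Definition iid_uniform_marks (V : finType) (o : V) (M : vertex -> T -> V)
  : Prop :=
  [/\ forall w, M [::] w = o,
      forall v (i : V), measurable (M v @^-1` [set i]),
      forall v, nonroot v ->
        forall i : V, P (M v @^-1` [set i]) = ((#|V|%:R)^-1)%:E
    & independent nonroot (fun v => sigma_of setT [set v] M)].

Definition marks_indep_weights (V : finType) (X : vertex -> {RV P >-> R})
    (M : vertex -> T -> V) : Prop :=
  forall A B, sigma_of measurable nonroot X A -> sigma_of setT nonroot M B ->
    P (A `&` B) = (P A * P B)%E.

End Laws.

(* The joint law of the edge weights E with the marked tree (X, M) is left
   free. *)
Record coupling (R : realType) (V : finType) (o : V) := Coupling {
  cdisp : measure_display;
  cspace : measurableType cdisp;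
  cprob : probability cspace R;
  cE : {set V} -> {RV cprob >-> R};
  cX : vertex -> {RV cprob >-> R};
  cM : vertex -> cspace -> V;
  cE_law : iid_exp1_edges cE;
  cX_law : PWIT_weights cX;
  cM_law : iid_uniform_marks cprob o cM;
  cM_indep : marks_indep_weights cX cM }.
Arguments cE {R V o} c _.
Arguments cX {R V o} c _.
Arguments cM {R V o} c _ _.

Definition rescaled (R : realType) (g : nat -> R -> R) (n : nat) (x : R) : R :=
  g n (x / n%:R).

(* The edge e has weight Y_e = h (E_e). *)
Definition SWT_eq_IP_upto (R : realType) (V : finType) (o : V)
    (C : coupling R o) (h : R -> R) (m : nat) : set (cspace C) :=
  [set w | forall k, (k <= m)%N ->
    let Y := fun e => h (cE C e w) in
    SWT Y o (SWT_time Y o k) =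
    mark_image (fun v => cM C v w) (IP (fun v => cX C v w) k)].
Arguments SWT_eq_IP_upto {R V o} C h m _.

(* Main.v *)
Require Import Defs.
From HB Require Import structures.
From mathcomp Require Import all_boot all_order all_algebra.
From mathcomp Require Import all_classical all_reals all_analysis.
From mathcomp Require Import measurable_realfun.
From mathcomp Require Import ring lra.

(* Put x_e = n E_e, so that the passage times are f_n(x_e), and fix m.

   On K_n, suppose that Prim's algorithm for the lengths x accepts its first m
   edges with lengths at most K, each beating the rejected competitors by delta.
   Since f_n(x + delta) >= (m + 1) f_n(x) for x <= K and n large, a path made of
   accepted edges is shorter than any single rejected edge, so the smallest-weight
   tree grows exactly along Prim's tree.

   On the PWIT, say that invasion percolation makes a run if its first m edges
   have weights at most K and beat the other boundary edges by delta. As the rows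
   increase and no two weights agree, the probability of a run of some shape tends
   to 1 as K tends to infinity and delta to 0.

   Fix the shape of the tree and distinct labels for its nodes v_0, ..., v_m. The
   least weights of the edges from v_s to a child with mark j, for j not among the
   labels of v_0, ..., v_s, are by thinning independent exponential variables of
   rate 1/n, exactly like the lengths of the edges between the s-th label and j.
   A run with this shape and these marks forces the former, hence the
   corresponding Prim event for the latter, so the run is at most as likely as the
   Prim event. A joint law of (E_e) and of the marked PWIT can therefore be chosen
   under which every run occurs together with the matching Prim event. The marks
   of a run are distinct with probability tending to 1 as n tends to infinity, and
   a diagonal choice over m concludes.

   The PWIT is constructed on [0, 1] with Lebesgue measure: binary digits give
   independent uniform variables, and a row consists of a Poisson(1) number of
   uniform points in each interval [l, l + 1]. *)

Set Implicit Arguments.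
Unset Strict Implicit.
Unset Printing Implicit Defensive.

Import Order.TTheory GRing.Theory Num.Theory.
Import numFieldNormedType.Exports.

Local Open Scope classical_set_scope.
Local Open Scope ring_scope.

(** * Independence *)

(** Repeated marks are the obstacle to an identity in law. A run must also beat the children whose
    mark is already a label of the tree, and no edge leaving the tree in K_n corresponds to these;
    so the run only implies that the minimal weights copy Prim's event, and what survives is an
    inequality of probabilities. It suffices: for different shapes and labels the run events are
    disjoint, and so are the Prim events, hence the whole mass of each run event can be placed on
    its own Prim event.

    The gap [delta] and the bound [K] are there because the hypothesis on f_n is pointwise; with
    both fixed, monotonicity makes it uniform over ]0, K].

    One computation serves twice: the expectation of the product of [phi = 1 - \sum_i c_i 1_{B_i}]
    over the points of a row. If [phi] is the probability that the mark of a point violates nothing,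
    it gives the joint tails of the minimal weights. If [c_i = 1 - z_i] with disjoint [B_i], it is
    the joint generating function of the counts, from which their Poisson law follows. *)

Section independence.
Context {R : realType} {d : measure_display} {T : measurableType d}.

(** Dynkin's pi-lambda theorem: the sets of equal measure form a Dynkin system, closed under
    complements because the common total mass is finite. *)
Lemma measure_unique_pi (m1 m2 : {measure set T -> \bar R}) (G : set (set T)) :
  G `<=` measurable -> setI_closed G ->
  (m1 setT < +oo)%E -> m1 setT = m2 setT ->
  (forall A, G A -> m1 A = m2 A) -> forall A, <<s G >> A -> m1 A = m2 A.
Proof.
move=> mG GI m1oo mT m12.
have m2oo : (m2 setT < +oo)%E by rewrite -mT.
rewrite -setI_closed_g_dynkin_g_sigma_algebra//.
suff /(_ _ _)/= H : <<d G >> `<=` [set A | measurable A /\ m1 A = m2 A].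
  by move=> A /H[].
apply: smallest_sub; last by move=> A GA; split; [exact: mG|exact: m12].
split => //= [A [mA e]|F tF mF].
  split; first exact: measurableC.
  have fin (m : {measure set T -> \bar R}) : (m setT < +oo)%E -> m A \is a fin_num.
    move=> h; rewrite ge0_fin_numE//; apply: le_lt_trans h.
    by apply: le_measure; rewrite ?inE.
  by rewrite -!setTD !measureD//= ?setTI ?e ?mT.
split; first by apply: bigcup_measurable => k _; have [] := mF k.
rewrite !measure_semi_bigcup//; last 4 first.
- by move=> k; have [] := mF k.
- by apply: bigcup_measurable => k _; have [] := mF k.
- by move=> k; have [] := mF k.
- by apply: bigcup_measurable => k _; have [] := mF k.
by apply: eq_eseriesr => k _; have [] := mF k.
Qed.

Context {P : probability T R}.

Lemma prob_fin A : measurable A -> P A \is a fin_num.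
Proof. by move=> mA; rewrite fin_num_measure. Qed.

Lemma bigcap_cons_seq (I : eqType) (i : I) (s : seq I) (A : I -> set T) :
  \bigcap_(j in [set` i :: s]) A j = A i `&` \bigcap_(j in [set` s]) A j.
Proof.
apply/seteqP; split => w.
  move=> h; split; first by apply: h => /=; rewrite inE eqxx.
  by move=> j /= js; apply: h => /=; rewrite inE js orbT.
by move=> [h1 h2] j /=; rewrite inE => /orP[/eqP->//|js]; exact: h2.
Qed.

Lemma bigcap_nil_seq (I : eqType) (A : I -> set T) :
  \bigcap_(j in [set` (@nil I)]) A j = setT.
Proof. by apply/seteqP; split. Qed.

Lemma measurable_capl (I : eqType) (s : seq I) (A : I -> set T) :
  (forall i, i \in s -> measurable (A i)) -> measurable (\bigcap_(i in [set` s]) A i).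
Proof.
elim: s => [|i s IH] mA; first by rewrite bigcap_nil_seq.
rewrite bigcap_cons_seq; apply: measurableI; first by apply: mA; rewrite mem_head.
by apply: IH => j js; apply: mA; rewrite inE js orbT.
Qed.

Lemma independent_sub (I : eqType) (D D' : set I) (F F' : I -> set (set T)) :
  D' `<=` D -> (forall i, D' i -> F' i `<=` F i) ->
  independent P D F -> independent P D' F'.
Proof.
move=> DD FF ind s A us H; apply: ind => // i /H[Di Fi].
by split; [exact: DD|exact: FF Fi].
Qed.

(** With [B] fixed, both sides are finite measures in [A]: the restriction of [P] to [B], and [P]
    scaled by [P B]. *)
Lemma independent_indep2 (A B : set T) (C : set (set T)) :
  C `<=` measurable -> setI_closed C -> measurable B ->
  (forall A, C A -> P (A `&` B) = (P A * P B)%E) ->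
  <<s C >> A -> P (A `&` B) = (P A * P B)%E.
Proof.
move=> mC CI mB ind sA.
have pB0 : 0 <= fine (P B) by rewrite fine_ge0.
pose m1 := mrestr P mB; pose m2 := mscale (NngNum pB0) P.
have PB : P B = (fine (P B))%:E by rewrite fineK ?prob_fin.
have m2E X : m2 X = (P X * P B)%E by rewrite /m2/= /mscale/= muleC -PB.
rewrite -m2E; apply: (@measure_unique_pi m1 m2 C mC CI _ _ _ A sA).
- by rewrite /m1/= /mrestr setTI PB ltry.
- by rewrite [RHS]m2E /m1/= /mrestr setTI probability_setT mul1e.
- by move=> X CX; rewrite [RHS]m2E; exact: ind.
Qed.

Lemma independent_salgebra (I : eqType) (D : set I) (C : I -> set (set T)) :
  (forall i, D i -> C i `<=` measurable) -> (forall i, D i -> setI_closed (C i)) ->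
  independent P D C -> independent P D (fun i => <<s C i >>).
Proof.
move=> mC CI ind s A us H.
have mS i X : D i -> <<s C i >> X -> measurable X.
  move=> Di; apply: smallest_sub; last exact: mC.
  exact: sigma_algebra_measurable.
(* Events are upgraded from generators to sigma-algebras one at a time: [s2] lists the indices whose
   events are still generators, and the induction moves the head of [s] there. *)
suff: forall s2, uniq (s ++ s2) -> (forall i, i \in s2 -> D i /\ C i (A i)) ->
   P (\bigcap_(i in [set` s ++ s2]) A i) = (\prod_(i <- s ++ s2) P (A i))%E.
  by move=> /(_ [::]); rewrite cats0; exact.
elim: s A us H => [|i s IH] A us H s2 us2 H2.
  by rewrite ind.
have [Di sAi] : D i /\ <<s C i >> (A i) by apply: H; rewrite inE eqxx.
have Hs j : j \in s -> D j /\ <<s C j >> (A j).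
  by move=> js; apply: H; rewrite inE js orbT.
have us' : uniq s by case/andP: us.
rewrite cat_cons bigcap_cons_seq big_cons -IH//; last by case/andP: us2.
set B := \bigcap_(_ in _) _.
have mA j : j \in s ++ s2 -> measurable (A j).
  rewrite mem_cat => /orP[/Hs[Dj]|/H2[Dj]]; first exact: mS.
  exact: mC.
apply: independent_indep2 sAi; [exact: mC|exact: CI|exact: measurable_capl|].
move=> X CX; pose A' j := if j == i then X else A j.
have us3 : uniq (s ++ i :: s2).
  rewrite -(@perm_uniq _ (i :: s ++ s2))//.
  by rewrite -cat1s perm_catCA.
have A'E j : j \in s ++ s2 -> A' j = A j.
  by rewrite /A'; case: eqP => // -> h; move: us2; rewrite /= h.
have H3 : P (\bigcap_(j in [set` s ++ i :: s2]) A' j) =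
    (\prod_(j <- s ++ i :: s2) P (A' j))%E.
  apply: IH => // [j js|j].
    by rewrite A'E; [exact: Hs|rewrite mem_cat js].
  rewrite inE => /orP[/eqP->|js]; first by rewrite /A' eqxx.
  by rewrite A'E; [exact: H2|rewrite mem_cat js orbT].
rewrite (@perm_big _ _ _ _ _ (i :: s ++ s2)) in H3; last first.
  by rewrite perm_sym -cat1s perm_catCA.
have -> : X `&` B = \bigcap_(j in [set` s ++ i :: s2]) A' j.
  transitivity (\bigcap_(j in [set` i :: s ++ s2]) A' j).
    rewrite bigcap_cons_seq {1}/A' eqxx; congr (_ `&` _).
    by apply: eq_bigcapr => j /= js; rewrite A'E.
  by apply: eq_bigcapl; split => j; rewrite /= !(inE, mem_cat) orbCA.
rewrite H3 big_cons {1}/A' eqxx; congr (_ * _)%E.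
rewrite {}/B IH//; last by case/andP: us2.
by apply: eq_big_seq => j js; rewrite A'E.
Qed.

(** Finite intersections of events of one block form a pi-system [C j] whose sigma-algebra contains
    that of the block. As the blocks are disjoint, independence of the family gives independence of
    these pi-systems. *)
Lemma independent_groups (I J : eqType) (F : I -> set (set T)) (D : J -> set I)
    (DF : set I) :
  (forall i, DF i -> [/\ F i `<=` measurable, setI_closed (F i) & F i setT]) ->
  (forall j, D j `<=` DF) -> (forall i j j', D j i -> D j' i -> j = j') ->
  independent P DF F ->
  independent P setT (fun j => <<s \bigcup_(i in D j) F i >>).
Proof.
move=> hF DDF tD ind.
pose C j := [set B | exists (s : seq I) (A : I -> set T),
  [/\ uniq s, (forall i, i \in s -> D j i /\ F i (A i)) &
   B = \bigcap_(i in [set` s]) A i]].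
have CI j : setI_closed (C j).
  move=> _ _ [s1 [A1 [u1 h1 ->]]] [s2 [A2 [u2 h2 ->]]].
  (* Padding with [setT] puts both intersections over the same index list. *)
  pose A1' i := if i \in s1 then A1 i else setT.
  pose A2' i := if i \in s2 then A2 i else setT.
  exists (undup (s1 ++ s2)), (fun i => A1' i `&` A2' i); split.
  - exact: undup_uniq.
  - move=> i; rewrite mem_undup mem_cat => h.
    have Dji : D j i by case/orP: h => [/h1[]|/h2[]].
    split=> //; have [_ FI FT] := hF i (DDF _ _ Dji).
    by apply: FI; rewrite ?/A1' ?/A2'; case: ifP => // H; [have [] := h1 _ H|have [] := h2 _ H].
  - apply/seteqP; split => w.
      move=> [w1 w2] i /=; rewrite mem_undup mem_cat /A1' /A2' => _.
      split; case: ifP => // h; [exact: w1|exact: w2].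
    move=> h; split => i /= is1; have := h i; rewrite /= mem_undup mem_cat is1 ?orbT.
      by move=> /(_ isT)[]; rewrite /A1' is1.
    by move=> /(_ isT)[_]; rewrite /A2' is1.
have mC j : C j `<=` measurable.
  move=> _ [s [A [us h ->]]]; apply: measurable_capl => i /h[Di Fi].
  by have [+ _ _] := hF i (DDF _ _ Di); exact.
suff indC : independent P setT C.
  apply: (@independent_sub _ setT _ (fun j => <<s C j >>)) => //; last first.
    exact: independent_salgebra.
  move=> j _; apply: smallest_sub; first exact: smallest_sigma_algebra.
  move=> A [i Di Fi]; apply: sub_sigma_algebra.
  exists [:: i], (fun=> A); split => //.
    by move=> i'; rewrite inE => /eqP->.
  by rewrite bigcap_cons_seq; rewrite bigcap_nil_seq setIT.
move=> js B ujs HB.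
(* Block events are expanded into their members one block at a time; [s] accumulates the members
   already expanded. *)
suff: forall (s : seq I) (A : I -> set T), uniq s ->
   (forall i, i \in s -> DF i /\ F i (A i)) ->
   (forall i j, i \in s -> j \in js -> ~ D j i) ->
   P (\bigcap_(i in [set` s]) A i `&` \bigcap_(j in [set` js]) B j) =
   (\prod_(i <- s) P (A i) * \prod_(j <- js) P (B j))%E.
  move=> /(_ [::] (fun=> setT))/=; rewrite big_nil mul1e => <-//.
  by rewrite bigcap_nil_seq setTI.
elim: js ujs HB => [|j js IH] ujs HB s A us HA disj.
  by rewrite bigcap_nil_seq big_nil setIT mule1; exact: ind.
have [_ [sj [Aj [uj hj Bj]]]] := HB j (mem_head _ _).
pose A' i := if i \in sj then Aj i else A i.
have uj' : uniq (sj ++ s).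
  rewrite cat_uniq uj us andbT /=; apply/hasPn => i si; apply/negP => sji.
  by have [Dji _] := hj _ sji; exact: (disj i j si (mem_head _ _)).
have A's i : i \in s -> A' i = A i.
  rewrite /A'; case: ifP => // sji si.
  by have [Dji _] := hj _ sji; case: (disj i j si (mem_head _ _)).
have A'sj i : i \in sj -> A' i = Aj i by rewrite /A' => ->.
have -> : \bigcap_(i in [set` s]) A i `&` \bigcap_(j0 in [set` j :: js]) B j0 =
  \bigcap_(i in [set` sj ++ s]) A' i `&` \bigcap_(j0 in [set` js]) B j0.
  rewrite bigcap_cons_seq setIA; congr (_ `&` _); rewrite Bj.
  apply/seteqP; split => w.
    move=> [h1 h2] i /=; rewrite mem_cat => /orP[|] h.
      by rewrite A'sj//; exact: h2.
    by rewrite A's//; exact: h1.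
  move=> h; split => i /= hi; have := h i; rewrite /= mem_cat hi ?orbT => /(_ isT).
    by rewrite A's.
  by rewrite A'sj.
rewrite IH//; last 4 first.
- by case/andP: ujs.
- by move=> j' js'; apply: HB; rewrite inE js' orbT.
- move=> i; rewrite mem_cat => /orP[] h.
    by rewrite A'sj//; have [Dji ?] := hj _ h; split => //; exact: DDF Dji.
  by rewrite A's//; exact: HA.
- move=> i j'; rewrite mem_cat => /orP[] h js'.
    move=> Dj'i; have [Dji _] := hj _ h.
    by have e := tD _ _ _ Dji Dj'i; move: ujs; rewrite e /= js'.
  by apply: disj => //; rewrite inE js' orbT.
rewrite big_cat/= big_cons.
have -> : (\prod_(i <- sj) P (A' i) = \prod_(i <- sj) P (Aj i))%E.
  by apply: eq_big_seq => i /A'sj ->.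
have -> : (\prod_(i <- s) P (A' i) = \prod_(i <- s) P (A i))%E.
  by apply: eq_big_seq => i /A's ->.
suff -> : P (B j) = (\prod_(i <- sj) P (Aj i))%E by rewrite muleAC muleC.
rewrite Bj; apply: ind => // i /hj[Dji ?]; split => //; exact: DDF Dji.
Qed.

End independence.

(** * Expectations of products of independent variables *)

Section product_expectation.
Context {R : realType} {d : measure_display} {T : measurableType d}.
Context (P : probability T R).

Definition mkRV {d'} {T' : measurableType d'} (f : T -> T')
    (mf : measurable_fun setT f) : {RV P >-> T'} := mfun_Sub (mem_set mf).

Lemma joint_distribution {d1 d2} {T1 : measurableType d1} {T2 : measurableType d2}
    (X : {RV P >-> T1}) (Y : {RV P >-> T2}) :
  (forall A B, measurable A -> measurable B ->
     P (X @^-1` A `&` Y @^-1` B) = (P (X @^-1` A) * P (Y @^-1` B))%E) ->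
  forall S, measurable S ->
  P [set w | S (X w, Y w)] = (distribution P X \x distribution P Y)%E S.
Proof.
move=> ind S mS.
have mXY : measurable_fun setT (fun w => (X w, Y w)).
  by apply: measurable_fun_pair; exact: measurable_funPT.
pose Z : {RV P >-> (T1 * T2)%type} := mkRV mXY.
rewrite (@product_measure_unique _ _ _ _ _ (distribution P X) (distribution P Y)
  (distribution P Z))//.
Qed.

Lemma expectation_mul_independent (f g : T -> \bar R) :
  measurable_fun setT f -> measurable_fun setT g ->
  (forall w, 0 <= f w)%E -> (forall w, 0 <= g w)%E ->
  (forall A B, measurable A -> measurable B ->
     P (f @^-1` A `&` g @^-1` B) = (P (f @^-1` A) * P (g @^-1` B))%E) ->
  (\int[P]_w (f w * g w) = \int[P]_w f w * \int[P]_w g w)%E.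
Proof.
move=> mf mg f0 g0 ind.
pose X := mkRV mf; pose Y := mkRV mg.
have mXY : measurable_fun setT (fun w => (X w, Y w)).
  by apply: measurable_fun_pair; exact: measurable_funPT.
pose Z : {RV P >-> (\bar R * \bar R)%type} := mkRV mXY.
(* Truncating at 0 makes [h] nonnegative on the whole plane, as Tonelli requires; on the values of
   [f] and [g] it is the plain product. *)
pose h (z : \bar R * \bar R) := ((maxe z.1 0) * (maxe z.2 0))%E.
have mh : measurable_fun setT h.
  by apply: emeasurable_funM; apply: measurable_maxe => //.
have h0 z : (0 <= h z)%E by rewrite mule_ge0// le_max lexx orbT.
have max0 (x : \bar R) : (0 <= x)%E -> maxe x 0%E = x by move=> ?; rewrite max_l.
transitivity (\int[distribution P Z]_z h z)%E.
  rewrite ge0_integral_distribution//; apply: eq_integral => w _ /=.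
  by rewrite /h /= !max0.
transitivity (\int[(distribution P X \x distribution P Y)%E]_z h z)%E.
  apply: eq_measure_integral => S mS _; exact: joint_distribution.
rewrite fubini_tonelli1// /fubini_F /h /=.
under eq_integral.
  move=> x _; rewrite ge0_integralZl//; last 3 first.
    exact: measurable_maxe.
    by move=> ? _; rewrite le_max lexx orbT.
    by rewrite le_max lexx orbT.
  over.
rewrite ge0_integralZr//; last 3 first.
- exact: measurable_maxe.
- by move=> ? _; rewrite le_max lexx orbT.
- by apply: integral_ge0 => ? _; rewrite le_max lexx orbT.
rewrite !ge0_integral_distribution//; last 4 first.
- exact: measurable_maxe.
- by move=> ?; rewrite le_max lexx orbT.
- exact: measurable_maxe.
- by move=> ?; rewrite le_max lexx orbT.
by congr (_ * _)%E; apply: eq_integral => w _ /=; rewrite max0.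
Qed.

Lemma measurable_prod_salgebra (I : eqType) (G : set (set T)) (s : seq I)
    (Y : I -> T -> \bar R) :
  (forall i, i \in s -> forall B, measurable B -> <<s G >> (Y i @^-1` B)) ->
  forall B, measurable B -> <<s G >> ((fun w => \prod_(i <- s) Y i w)%E @^-1` B).
Proof.
move=> mY B mB.
suff mf : measurable_fun setT
    ((fun w => \prod_(i <- s) Y i w)%E : g_sigma_algebraType G -> \bar R).
  by rewrite -[X in <<s _ >> X]setTI; exact: mf.
elim: s mY => [|i s IH] mY.
  by under eq_fun do rewrite big_nil; exact: measurable_cst.
under eq_fun do rewrite big_cons.
apply: emeasurable_funM; last first.
  by apply: IH => j js; apply: mY; rewrite inE js orbT.
by move=> _ A mA; rewrite setTI; apply: mY => //; rewrite mem_head.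
Qed.

Lemma expectation_prod_independent (I : eqType) (D : set I)
    (F : I -> set (set T)) (s : seq I) (Y : I -> T -> \bar R) :
  (forall i, D i -> [/\ F i `<=` measurable, setI_closed (F i) & F i setT]) ->
  independent P D F -> uniq s -> (forall i, i \in s -> D i) ->
  (forall i, i \in s -> forall B, measurable B -> F i (Y i @^-1` B)) ->
  (forall i w, 0 <= Y i w)%E ->
  (\int[P]_w \prod_(i <- s) Y i w = \prod_(i <- s) \int[P]_w Y i w)%E.
Proof.
move=> hF ind us sD hY Y0.
elim: s us sD hY => [|i s IH] us sD hY.
  under eq_integral do rewrite big_nil.
  by rewrite big_nil integral_cst// mul1e; exact: probability_setT.
under eq_integral do rewrite big_cons.
have mYF j : j \in i :: s -> measurable_fun setT (Y j).
  by move=> js _ B mB; rewrite setTI; have [+ _ _] := hF j (sD _ js); apply; exact: hY.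
have sD' j : j \in s -> D j by move=> js; apply: sD; rewrite inE js orbT.
have hY' j : j \in s -> forall B, measurable B -> F j (Y j @^-1` B).
  by move=> js; apply: hY; rewrite inE js orbT.
pose Ds := [set j | j \in s].
(* Two blocks, head and tail, so that blockwise independence separates [Y i] from the product of the
   others. *)
pose J b := if b then [set i] else Ds.
have hG : independent P setT (fun b => <<s \bigcup_(i in J b) F i >>).
  apply: (independent_groups hF _ _ ind).
    by move=> [] j /=; [move=> ->; apply: sD; rewrite mem_head|exact: sD'].
  move=> j [] [] //=; [move=> -> | move=> + ej]; rewrite /Ds /= => h.
    by move: us; rewrite /= h.
  by move: us; rewrite /= -ej h.
have sub b : <<s \bigcup_(i in J b) F i >> `<=` measurable.
  apply: smallest_sub; first exact: sigma_algebra_measurable.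
  move=> A [j Jj FA]; suff Dj : D j by have [+ _ _] := hF j Dj; exact.
  by case: b Jj => /= [->|/sD'//]; apply: sD; rewrite mem_head.
have sYs : forall B, measurable B ->
    <<s \bigcup_(i in J false) F i >> ((fun w => \prod_(j <- s) Y j w)%E @^-1` B).
  apply: measurable_prod_salgebra => j js B mB; apply: sub_sigma_algebra.
  by exists j => //; exact: hY'.
rewrite expectation_mul_independent//.
- by rewrite big_cons IH//; case/andP: us.
- by apply: mYF; rewrite mem_head.
- by move=> _ B mB; rewrite setTI; apply: (sub false); exact: sYs.
- by move=> w; apply: prode_ge0.
- move=> A B mA mB; pose C b := if b then Y i @^-1` A else
    (fun w => \prod_(j <- s) Y j w)%E @^-1` B.
  have := hG [:: true; false] C isT.
  rewrite !bigcap_cons_seq bigcap_nil_seq setIT !big_cons big_nil mule1; apply.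
  move=> [] _; split=> //; last exact: sYs.
  by apply: sub_sigma_algebra; exists i => //; apply: hY => //; rewrite mem_head.
Qed.

End product_expectation.

(** * Independent uniform variables on the unit interval *)

Lemma ray_measure_unique (R : realType) (m1 m2 : probability R R) :
  (forall t : R, m1 `]t, +oo[%classic = m2 `]t, +oo[%classic) ->
  forall A, measurable A -> m1 A = m2 A.
Proof.
move=> e A mA; have {}mA : (@RGenOInfty.G R).-sigma.-measurable A.
  by rewrite -RGenOInfty.measurableE; exact: mA.
apply: (@measure_unique_pi _ _ _ m1 m2 (@RGenOInfty.G R)) => //.
- by move=> _ [x ->]; exact: measurable_itv.
- move=> _ _ [x ->] [y ->]; exists (Num.max x y).
  apply/seteqP; split => z /=; rewrite !in_itv/= !andbT gt_max; last by case/andP.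
  by case=> -> ->.
- by rewrite [X in (X < _)%E](probability_setT m1) ltry.
- by rewrite [LHS](probability_setT m1) [RHS](probability_setT m2).
- by move=> _ [x ->]; exact: e.
Qed.

Lemma prob_lty (R : realType) d (T : measurableType d) (P : probability T R) A :
  measurable A -> (P A < +oo)%E.
Proof. by move=> mA; rewrite (le_lt_trans (probability_le1 P mA))// ltry. Qed.

Lemma prob_setD (R : realType) d (T : measurableType d) (P : probability T R) A B :
  measurable A -> measurable B -> P (A `\` B) = (P A - P (A `&` B))%E.
Proof. by move=> mA mB; rewrite measureD//; exact: prob_lty. Qed.

Lemma prob_le (R : realType) d (T : measurableType d) (P : probability T R) A B :
  measurable A -> measurable B -> A `<=` B -> (P A <= P B)%E.
Proof. by move=> mA mB AB; apply: le_measure; rewrite ?inE. Qed.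

Section unit_interval.
Context {R : realType}.

Lemma measurable_idR : measurable_fun setT (idfun : measurableTypeR R -> R).
Proof. by move=> _ A mA; rewrite setTI. Qed.

(* The library puts two displays on R: the named distributions live on
   [measurableTypeR R], real random variables take values in [R]. *)
Definition toR (m : probability (measurableTypeR R) R) : probability R R :=
  distribution m (mkRV m measurable_idR).

Definition U01 : probability R R := toR (uniform_prob (@ltr01 R)).
Arguments U01 : simpl never.

Lemma U01E (A : set R) : measurable A ->
  U01 A = lebesgue_measure (A `&` `[0, 1]%classic).
Proof.
move=> mA; rewrite /U01/= /distribution/= /pushforward/= /uniform_prob integral_uniform_pdf.
rewrite (eq_integral (cst 1%:E)) ?integral_cst ?mul1e//.
  exact: measurableI.
by move=> x; rewrite inE => -[_]/=; rewrite in_itv/= /uniform_pdf => ->; rewrite subr0 invr1.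
Qed.

Lemma U01_ray (b : bool) (t : R) : 0 <= t <= 1 ->
  U01 [set` Interval (BSide b t) +oo%O] = (1 - t)%:E.
Proof.
move=> /andP[t0 t1]; rewrite U01E//.
rewrite (_ : _ `&` _ = [set` Interval (BSide b t) (BRight 1)]).
  rewrite lebesgue_measure_itv/= lte_fin; case: ltP => [_|t1'].
    by rewrite EFinB.
  by have -> : t = 1; [apply/eqP; rewrite eq_le t1|rewrite subrr].
apply/seteqP; split => z /=; rewrite !in_itv/=.
  by move=> [/andP[-> _] /andP[_ ->]].
by case: b => /= /andP[tz ->]; rewrite tz ?andbT; split => //; rewrite (le_trans t0)// ltW.
Qed.

(** The value at [t = 0] is left to [U01_ray]; callers have [t < 0] and refute the second
    alternative. *)
Lemma U01_ray0 (b : bool) (t : R) : t <= 0 -> 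
  U01 [set` Interval (BSide b t) +oo%O] = 1%E \/ t = 0.
Proof.
rewrite le_eqVlt => /orP[/eqP->|t0]; [by right|left].
rewrite U01E// (_ : _ `&` _ = `[0, 1]%classic).
  by rewrite lebesgue_measure_itv/= lte01 oppr0 adde0.
apply/seteqP; split => z /=; rewrite !in_itv/= ?andbT; first by case.
move=> /andP[z0 ->]; rewrite z0; split=> //.
by case: (b) => /=; rewrite ?ltW// (lt_le_trans t0).
Qed.

Lemma U01_ray1 (b : bool) (t : R) : 1 <= t ->
  U01 [set` Interval (BSide b t) +oo%O] = 0%E.
Proof.
move=> t1; apply/eqP; rewrite -measure_le0.
have <- : U01 `[1 : R, +oo[%classic = 0%E by rewrite U01_ray ?ler01 ?lexx// subrr.
apply: le_measure; rewrite ?inE//.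
by move=> x /=; rewrite !in_itv/= !andbT; case: b => /=; [|move/ltW]; exact: le_trans.
Qed.

Lemma U01_itv01 : U01 `]0 : R, 1[%classic = 1%E.
Proof.
rewrite U01E// (_ : _ `&` _ = `]0, 1[%classic).
  by rewrite lebesgue_measure_itv/= lte01 oppr0 adde0.
apply/seteqP; split => z /=; rewrite !in_itv/=; first by case.
by move=> /andP[z0 z1]; rewrite !ltW// z0 z1.
Qed.

(** The leading binary digit on [0, 1[; [dbl] is the doubling map modulo 1, which deletes that
    digit. *)
Definition bit (x : R) : bool := 2^-1 <= x.
Definition dbl (x : R) : R := if bit x then 2 * x - 1 else 2 * x.

Lemma measurable_bit : measurable_fun setT bit.
Proof. by apply: measurable_fun_ler. Qed.

Lemma measurable_dbl : measurable_fun setT dbl.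
Proof.
apply: measurable_fun_ifT; first exact: measurable_bit.
  by apply: measurable_funB => //; exact: measurable_funM.
exact: measurable_funM.
Qed.

(** The doubling map sends each half of the unit interval affinely onto the whole of it, doubling
    lengths. *)
Lemma bit_dbl_ray (b : bool) (t : R) :
  U01 ([set x | bit x = b] `&` dbl @^-1` `]t, +oo[%classic) =
  (2^-1 * fine (U01 `]t, +oo[%classic))%:E.
Proof.
have h0 : (0 : R) <= 2^-1 by rewrite invr_ge0.
have h1 : (2^-1 : R) <= 1 by rewrite invf_le1// ler1n.
have hh : (2^-1 + 2^-1 : R) = 1 by lra.
have mray : forall b t, measurable [set` Interval (BSide b t) (+oo%O : itv_bound R)].
  by move=> *; exact: measurable_itv.
have [t0|t0] := ltP t 0.
  have -> : U01 `]t, +oo[%classic = 1%E.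
    by have [//|e] := U01_ray0 false (ltW t0); move: t0; rewrite e ltxx.
  rewrite mulr1; case: b.
    have -> : [set x | bit x = true] `&` dbl @^-1` `]t, +oo[%classic =
       `[2^-1 : R, +oo[%classic.
      apply/seteqP; split => z /=; rewrite !in_itv/= !andbT; first by case.
      move=> hz; have zb : bit z by []. by split => //; rewrite /dbl zb; lra.
    by rewrite U01_ray ?h0//; congr EFin; lra.
  have -> : [set x | bit x = false] `&` dbl @^-1` `]t, +oo[%classic =
       `](t / 2) : R, +oo[%classic `\` `[2^-1, +oo[%classic.
    apply/seteqP; split => z /=; rewrite !in_itv/= !andbT.
      by move=> [zb]; rewrite /dbl zb => tz; split; [lra|move/negP: zb].
    move=> [tz zb]; have zF : bit z = false by apply/negP.
    by rewrite /dbl zF; split=> //; lra.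
  rewrite prob_setD//.
  have -> : U01 `](t / 2), +oo[%classic = 1%E.
    have t20 : t / 2 < 0 by lra.
    by have [//|e] := U01_ray0 false (ltW t20); move: t20; rewrite e ltxx.
  rewrite setIidr; last first.
    by move=> z /=; rewrite !in_itv/= !andbT => hz; lra.
  by rewrite U01_ray ?h0// -EFinB; congr EFin; lra.
have [t1|t1] := leP 1 t.
  rewrite (@U01_ray1 false)// mulr0; apply/eqP; rewrite -measure_le0.
  apply: (@le_trans _ _ (U01 `](1 : R), +oo[%classic)); last by rewrite U01_ray1.
  apply: prob_le => //.
    apply: measurableI; last first.
      by rewrite -[X in measurable X]setTI; apply: measurable_dbl.
    by rewrite -[X in measurable X]setTI; apply: (measurable_bit measurableT (Y := [set b])).
  move=> x /=; rewrite !in_itv/= !andbT /dbl => -[xb]; case: ifPn; rewrite /bit; lra.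
rewrite (@U01_ray false)/= ?t0 ?ltW//; case: b.
  have -> : [set x | bit x = true] `&` dbl @^-1` `]t, +oo[%classic =
       `]((t + 1) / 2) : R, +oo[%classic.
    apply/seteqP; split => z /=; rewrite !in_itv/= !andbT.
      by move=> [zb]; rewrite /dbl zb; lra.
    move=> hz; have zb : bit z by rewrite /bit; lra.
    by split => //; rewrite /dbl zb; lra.
  by rewrite (@U01_ray false)/=; [congr EFin; lra | apply/andP; split; lra].
have -> : [set x | bit x = false] `&` dbl @^-1` `]t, +oo[%classic =
     `](t / 2) : R, +oo[%classic `\` `[2^-1, +oo[%classic.
  apply/seteqP; split => z /=; rewrite !in_itv/= !andbT.
    by move=> [zb]; rewrite /dbl zb => tz; split; [lra|move/negP: zb].
  move=> [tz zb]; have zF : bit z = false by apply/negP.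
  by rewrite /dbl zF; split=> //; lra.
rewrite prob_setD//.
rewrite setIidr; last by move=> z /=; rewrite !in_itv/= !andbT => hz; lra.
rewrite (@U01_ray false)/=; last by apply/andP; split; lra.
by rewrite U01_ray ?h0// -EFinB; congr EFin; lra.
all: exact: mray.
Qed.

End unit_interval.

Lemma measU (R : realType) d (T : measurableType d)
    (mu : {measure set T -> \bar R}) A B :
  measurable A -> measurable B -> A `&` B `<=` set0 ->
  mu (A `|` B) = (mu A + mu B)%E.
Proof. by move=> mA mB; rewrite subset0 => AB; rewrite measureU. Qed.

Lemma measure_fin_partition (R : realType) d (T : measurableType d)
    (mu : {measure set T -> \bar R}) (I : finType) (Q : pred I) (F : I -> set T) :
  (forall i, Q i -> measurable (F i)) ->
  (forall i j x, F i x -> F j x -> i = j) ->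
  mu [set x | exists2 i, Q i & F i x] = (\sum_(i | Q i) mu (F i))%E.
Proof.
move=> mF tF.
suff H (s : seq I) : uniq s -> all Q s ->
   measurable [set x | exists2 i, i \in s & F i x] /\
   mu [set x | exists2 i, i \in s & F i x] = (\sum_(i <- s) mu (F i))%E.
  have [] := H (enum Q) (enum_uniq _) _; first by apply/allP => i; rewrite mem_enum.
  move=> _; rewrite big_enum => <-; congr (mu _).
  apply/seteqP; split => x [i Qi Fi]; exists i => //; last by rewrite mem_enum in Qi.
  by rewrite mem_enum.
elim: s => [|i s IH] /= us Qs.
  have -> : [set x | exists2 i, i \in [::] & F i x] = set0.
    by rewrite -subset0 => x [].
  by rewrite measure0 big_nil.
case/andP: us => iNs us; case/andP: Qs => Qi Qs; have {IH} [mS muS] := IH us Qs.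
have -> : [set x | exists2 j, j \in i :: s & F j x] =
   F i `|` [set x | exists2 j, j \in s & F j x].
  apply/seteqP; split => x.
    by move=> [j]; rewrite inE => /orP[/eqP->|js] Fj; [left|right; exists j].
  move=> [Fi|[j js Fj]]; first by exists i; rewrite ?mem_head.
  by exists j => //; rewrite inE js orbT.
split; first exact: measurableU (mF _ Qi) mS.
rewrite measU ?big_cons ?muS//; first exact: mF.
move=> x [Fi [j js Fj]].
by move: iNs; rewrite (tF _ _ _ Fi Fj) js.
Qed.

Section bits.
Context {R : realType}.
Local Notation U := (@U01 R).

Lemma measurable_preT d d' (T : measurableType d) (T' : measurableType d')
  (f : T -> T') A : measurable_fun setT f -> measurable A -> measurable (f @^-1` A).
Proof. by move=> mf mA; rewrite -[X in measurable X]setTI; exact: mf. Qed.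

Lemma measurable_biteq (b : bool) : measurable [set x : R | bit x = b].
Proof. exact: (measurable_preT (A := [set b]) measurable_bit). Qed.

Lemma U01_bit b : U [set x | bit x = b] = (2^-1)%:E.
Proof.
have e : [set x : R | bit x = true] = `[2^-1, +oo[%classic.
  by apply/seteqP; split => x /=; rewrite in_itv/= andbT.
have h : U [set x | bit x = true] = (2^-1)%:E.
  by rewrite e U01_ray; [congr EFin; lra|apply/andP; split; lra].
case: b => //.
have -> : [set x : R | bit x = false] = ~` [set x | bit x = true].
  by apply/seteqP; split => x /=; [move=> -> | move/negP/negbTE].
rewrite probability_setC; last exact: measurable_biteq.
by rewrite h -EFinB; congr EFin; lra.
Qed.

Lemma U01_bit_dbl (b : bool) (S : set R) : measurable S ->
  U ([set x | bit x = b] `&` dbl @^-1` S) = ((2^-1)%:E * U S)%E.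
Proof.
move=> mS.
have half0 : 0 <= (2^-1 : R) by rewrite invr_ge0.
pose D : {mfun R >-> R} := mkRV U measurable_dbl.
pose m1 := pushforward (mrestr U (measurable_biteq b)) D.
pose m2 := mscale (NngNum half0) U.
have m1E X : m1 X = U ([set x | bit x = b] `&` dbl @^-1` X).
  by rewrite setIC.
have m2E X : m2 X = ((2^-1)%:E * U X)%E by [].
have {}mS : (@RGenOInfty.G R).-sigma.-measurable S.
  by rewrite -RGenOInfty.measurableE; exact: mS.
rewrite -m1E -m2E; apply: (@measure_unique_pi _ _ _ m1 m2 (@RGenOInfty.G R) _ _ _ _ _ S mS).
- by move=> _ [x ->]; exact: measurable_itv.
- move=> _ _ [x ->] [y ->]; exists (Num.max x y).
  apply/seteqP; split => z /=; rewrite !in_itv/= !andbT gt_max; last by case/andP.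
  by case=> -> ->.
- by rewrite [X in (X < _)%E]m1E preimage_setT setIT U01_bit ltry.
- by rewrite [LHS]m1E [RHS]m2E preimage_setT setIT U01_bit [U _]probability_setT mule1.
- move=> _ [x ->]; rewrite [LHS]m1E [RHS]m2E bit_dbl_ray EFinM fineK//.
  by rewrite fin_num_measure.
Qed.

Definition nbit (k : nat) (x : R) : bool := bit (iter k dbl x).

Lemma measurable_iter_dbl k : measurable_fun setT (iter k (@dbl R)).
Proof.
elim: k => [|k IH]; first exact: measurable_id.
exact: measurableT_comp measurable_dbl IH.
Qed.

Lemma measurable_nbit k : measurable_fun setT (nbit k).
Proof. exact: measurableT_comp measurable_bit (measurable_iter_dbl k). Qed.

Lemma U01_bitset_dbl (A : set bool) (S : set R) : measurable S ->
  U (bit @^-1` A `&` dbl @^-1` S) = (U (bit @^-1` A) * U S)%E.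
Proof.
move=> mS.
suff H X : measurable X -> U (bit @^-1` A `&` dbl @^-1` X) =
   (((\1_A true + \1_A false) / 2)%:E * U X)%E.
  rewrite H//; congr (_ * _)%E.
  (* Taking the whole space for [X] identifies the constant of [H] with the probability of the digit
     event. *)
  have := H setT measurableT; rewrite preimage_setT setIT.
  by rewrite [U setT]probability_setT mule1.
move=> mX.
pose B b := [set x : R | bit x = b] `&` dbl @^-1` X.
have mB b : measurable (B b).
  apply: measurableI; first exact: measurable_biteq.
  exact: measurable_preT measurable_dbl mX.
have -> : bit @^-1` A `&` dbl @^-1` X =
   (if true \in A then B true else set0) `|` (if false \in A then B false else set0).
  apply/seteqP; split => x /=.
    move=> [Ax Xx]; case e : (bit x) Ax => /mem_set Ax.
      by left; rewrite Ax /B /=.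
    by right; rewrite Ax /B /=.
  by case; case: ifPn => // /set_mem Ab [/= e ?]; (split; [rewrite /preimage /= e|]).
rewrite measU; [|by case: ifP|by case: ifP|]; last first.
  by move=> x []; case: ifP => // _; case: ifP => // _ [/= e _] [/=]; rewrite e.
have E b : U (if b \in A then B b else set0) = ((\1_A b / 2)%:E * U X)%E.
  rewrite indicE; case: ifP => _ /=; last by rewrite measure0 mul0r mul0e.
  by rewrite U01_bit_dbl// mul1r.
rewrite [X in (X + _)%E](E true) [X in (_ + X)%E](E false) -ge0_muleDl ?lee_fin ?divr_ge0//; congr (_ * _)%E.
by rewrite -EFinD mulrDl.
Qed.

Lemma U01_dbl (S : set R) : measurable S -> U (dbl @^-1` S) = U S.
Proof.
move=> mS; have := @U01_bitset_dbl setT _ mS; rewrite preimage_setT setTI => ->.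
by rewrite [U setT]probability_setT mul1e.
Qed.

(** The digits of [dbl x] are those of [x] shifted by one, and the first digit is independent of
    [dbl x]. *)
Lemma nbit_initial (K : nat) (A : nat -> set bool) :
  U (\bigcap_(i < K) (nbit i @^-1` A i)) = (\prod_(i < K) U (nbit i @^-1` A i))%E.
Proof.
elim: K A => [|K IH] A.
  by rewrite bigcap_mkord !big_ord0 [LHS]probability_setT.
have mI (B : nat -> set bool) : measurable (\bigcap_(i < K) (nbit i @^-1` B i)).
  rewrite bigcap_mkord; apply: bigsetI_measurable => i _.
  exact: measurable_preT (measurable_nbit i) _.
have sh i x : nbit i.+1 x = nbit i (dbl x) by rewrite /nbit iterSr.
have -> : \bigcap_(i < K.+1) (nbit i @^-1` A i) = bit @^-1` A 0%N `&`
    dbl @^-1` (\bigcap_(i < K) (nbit i @^-1` A i.+1)).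
  apply/seteqP; split => x.
    move=> h; split; first exact: (h 0%N).
    by move=> i iK /=; rewrite -sh; exact: h.
  move=> [h0 h] [|i] //= iK; rewrite sh; exact: h.
rewrite U01_bitset_dbl// IH big_ord_recl; congr (_ * _)%E.
apply: eq_bigr => i _; rewrite lift0 -U01_dbl.
  by congr (U _); apply/seteqP; split => x /=; rewrite sh.
exact: measurable_preT (measurable_nbit i) _.
Qed.

Definition discrete_preimages (T I : Type) (b : I -> T -> bool) (i : I) : set (set T) :=
  preimage_set_system setT (b i) setT.

Lemma independent_nbit : independent U setT (discrete_preimages nbit).
Proof.
move=> s A us H.
(* The index list is completed by trivial events to the initial segment below [K]. *)
pose K := (\max_(i <- s) i).+1.
have sK i : i \in s -> (i < K)%N by move=> si; rewrite ltnS; exact: leq_bigmax_seq.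
have /choice[B hB] i : exists B : set bool, (i \in s -> A i = nbit i @^-1` B) /\
    (i \notin s -> B = setT).
  case: (boolP (i \in s)) => si; last by exists setT.
  by have [_ [B _ e]] := H _ si; exists B; split => // _; rewrite -e setTI.
have e1 : \bigcap_(i in [set` s]) A i = \bigcap_(i < K) (nbit i @^-1` B i).
  apply/seteqP; split => x h i /= hi.
    case: (boolP (i \in s)) => si; last by have [_ ->] := hB i.
    by have [e _] := hB i; have := h i si; rewrite e.
  by have [e _] := hB i; rewrite e//; exact: (h i (sK i hi)).
rewrite e1 nbit_initial -(big_mkord xpredT (fun i => U (nbit i @^-1` B i))).
rewrite (bigID (mem s))/= [X in (_ * X)%E]big1 ?mule1; last first.
  by move=> i si; have [_ ->] := hB i; rewrite ?preimage_setT ?[LHS]probability_setT.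
rewrite -big_filter (perm_big s); last first.
  apply: uniq_perm; [exact: filter_uniq (iota_uniq _ _)|exact: us|].
  move=> i; rewrite mem_filter mem_index_iota.
  by apply/andP/idP => [[]//|si]; split => //; exact: sK.
by apply: eq_big_seq => i si; have [e _] := hB i; rewrite e.
Qed.

(** Fair coin flips, described only through cylinders over initial segments: these determine the law
    of the real number with these digits. *)
Definition fair (b : nat -> R -> bool) := (forall k, measurable_fun setT (b k)) /\
  forall n (e : nat -> bool),
    U (\bigcap_(i < n) (b i @^-1` [set e i])) = ((2^-1) ^+ n)%:E.

Definition bsum n (c : nat -> bool) : R := \sum_(i < n) (c i)%:R / 2 ^+ i.+1.
Definition binreal (c : nat -> bool) : R := limn (bsum ^~ c).

Lemma bsum_nd c : nondecreasing_seq (bsum ^~ c).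
Proof.
apply/nondecreasing_seqP => n; rewrite /bsum big_ord_recr/= lerDl.
by rewrite divr_ge0// exprn_ge0.
Qed.

Lemma bsum_le c n : bsum n c <= 1 - 2 ^- n.
Proof.
elim: n => [|n IH]; first by rewrite /bsum big_ord0 expr0 invr1 subrr.
rewrite /bsum big_ord_recr/= -/(bsum n c).
have -> : 1 - 2 ^- n.+1 = (1 - 2 ^- n) + 2 ^- n.+1 :> R.
  by rewrite exprS invfM; lra.
rewrite lerD// ler_pdivrMr ?exprn_gt0// mulVf ?expf_neq0//; by case: (c n).
Qed.

Lemma bsum_cvg c : bsum ^~ c @ \oo --> binreal c.
Proof.
apply: nondecreasing_is_cvgn; first exact: bsum_nd.
exists 1 => _ [n _ <-]; apply: le_trans (bsum_le c n) _.
by rewrite gerBl invr_ge0 exprn_ge0.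
Qed.

(** The partial sums increase to the limit, so exceeding [t] is an increasing union of events that
    depend on finitely many digits. *)
Lemma binreal_gt c t : (t < binreal c) <-> exists n, t < bsum n c.
Proof.
split=> [h|[n h]].
  have [//|/forallNP H] := pselect (exists n, t < bsum n c).
  suff : binreal c <= t by rewrite leNgt h.
  apply: limr_le; first exact: bsum_cvg.
  by near=> n; rewrite leNgt; apply/negP/H.
apply: lt_le_trans h _; apply: nondecreasing_cvgn_le; first exact: bsum_nd.
exact: bsum_cvg.
Unshelve. all: end_near. Qed.

Section fair_law.
Variable b : nat -> R -> bool.
Hypothesis fb : fair b.

(** All words of length [n] have the same weight, so only the number of favourable ones matters. *)
Lemma fair_event n (Q : pred {ffun 'I_n -> bool}) :
  U [set x | Q [ffun i : 'I_n => b i x]] = (#|Q|%:R * (2^-1) ^+ n)%:E.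
Proof.
have [mb fbn] := fb.
pose C (e : {ffun 'I_n -> bool}) := [set x | forall i : 'I_n, b i x = e i].
have CE e : U (C e) = ((2^-1) ^+ n)%:E /\ measurable (C e).
  pose e' k := if insub k is Some i then e i else false.
  have -> : C e = \bigcap_(i < n) (b i @^-1` [set e' i]).
    apply/seteqP; split => x h.
      move=> i /= lin; rewrite /e' insubT/=; exact: (h (Ordinal lin)).
    by move=> i; have := h i (ltn_ord i); rewrite /= /e' valK.
  split; first exact: fbn.
  rewrite bigcap_mkord; apply: bigsetI_measurable => i _.
  exact: measurable_preT (mb i) _.
have -> : [set x | Q [ffun i : 'I_n => b i x]] = [set x | exists2 e, Q e & C e x].
  apply/seteqP; split => x /=.
    by move=> h; exists [ffun i : 'I_n => b i x] => // i; rewrite ffunE.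
  by move=> [e Qe h]; rewrite (_ : finfun _ = e)//; apply/ffunP => i; rewrite ffunE.
rewrite measure_fin_partition.
- rewrite (eq_bigr (fun=> ((2^-1) ^+ n)%:E)); last by move=> e _; have [] := CE e.
  by rewrite sumEFin sumr_const mulr_natl.
- by move=> e _; have [] := CE e.
- by move=> e e' x h h'; apply/ffunP => i; rewrite -h -h'.
Qed.

Lemma measurable_bsum n : measurable_fun setT (fun x => bsum n (b ^~ x)).
Proof.
have [mb _] := fb.
apply: measurable_sum => i; apply: measurable_funM => //.
apply: (measurableT_comp (f := fun c : bool => c%:R : R)) => //.
Qed.

Lemma measurable_binreal : measurable_fun setT (fun x => binreal (b ^~ x)).
Proof.
apply: (measurable_fun_cvg (h := fun n x => bsum n (b ^~ x))).
  exact: measurable_bsum.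
by move=> x _; exact: bsum_cvg.
Qed.

End fair_law.

(** Events of finitely many digits have the same probability for both sequences, and rays are
    increasing unions of such events. Compared with the digits of [x], which sum to [x], this shows
    that any fair subsequence of digits encodes a uniform variable. *)
Lemma fair_binreal_law b b' : fair b -> fair b' -> forall A, measurable A ->
  U ((fun x => binreal (b ^~ x)) @^-1` A) = U ((fun x => binreal (b' ^~ x)) @^-1` A).
Proof.
move=> fb fb' A mA.
pose X := mkRV U (measurable_binreal fb); pose X' := mkRV U (measurable_binreal fb').
change (distribution U X A = distribution U X' A).
apply: ray_measure_unique mA => t.
have cv c (fc : fair c) : U [set x | t < bsum n (c ^~ x)] @[n --> \oo] -->
    U ((fun x => binreal (c ^~ x)) @^-1` `]t, +oo[%classic).
  have -> : (fun x => binreal (c ^~ x)) @^-1` `]t, +oo[%classic =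
      \bigcup_n [set x | t < bsum n (c ^~ x)].
    apply/seteqP; split => x /=; rewrite in_itv/= andbT.
      by move=> /binreal_gt[n hn]; exists n.
    by move=> [n _ hn]; apply/binreal_gt; exists n.
  have mS n : measurable [set x | t < bsum n (c ^~ x)].
    have -> : [set x | t < bsum n (c ^~ x)] =
        (fun x => bsum n (c ^~ x)) @^-1` `]t, +oo[%classic.
      by apply/seteqP; split => x /=; rewrite in_itv/= andbT.
    exact: measurable_preT (measurable_bsum fc n) _.
  apply: nondecreasing_cvg_mu => //; first exact: bigcupT_measurable.
  move=> n m nm; apply/subsetPset => x /= h; apply: lt_le_trans h _.
  exact: bsum_nd.
have e n : U [set x | t < bsum n (b ^~ x)] = U [set x | t < bsum n (b' ^~ x)].
  pose Q : pred {ffun 'I_n -> bool} :=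
    fun f => t < \sum_(i < n) (f i)%:R / 2 ^+ i.+1.
  have QE c : [set x | t < bsum n (c ^~ x)] = [set x | Q [ffun i : 'I_n => c i x]].
    by apply/seteqP; split => x; rewrite /Q /bsum /=; under eq_bigr do rewrite ?ffunE;
      under [X in _ -> _ < X]eq_bigr do rewrite ?ffunE.
  by rewrite !QE !fair_event.
have h1 := cvg_lim (@ereal_hausdorff R) (cv _ fb).
have h2 := cvg_lim (@ereal_hausdorff R) (cv _ fb').
by rewrite /distribution/= /pushforward/= -[LHS]h1 -[RHS]h2; under eq_fun do rewrite e.
Qed.

Lemma U01_nbit i b : U (nbit i @^-1` [set b]) = (2^-1)%:E.
Proof.
transitivity (U [set x | bit x = b]); last exact: U01_bit.
elim: i => [|i IH] //.
rewrite -IH -[RHS]U01_dbl; last exact: (measurable_preT (measurable_nbit i) (A := [set b])).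
by congr (U _); apply/seteqP; split => x; rewrite /nbit /= -iterS iterSr.
Qed.

Lemma prod_half n : (\prod_(i < n) (2^-1)%:E = ((2^-1 : R) ^+ n)%:E)%E.
Proof.
rewrite big_const card_ord.
elim: n => [|n IH]; first by rewrite expr0.
by rewrite iterS IH exprS EFinM.
Qed.

Lemma fair_nbit : fair nbit.
Proof.
split=> [k|n e]; first exact: measurable_nbit.
by rewrite nbit_initial -prod_half; apply: eq_bigr => i _; exact: U01_nbit.
Qed.

Lemma binreal_nbit x : 0 <= x < 1 -> binreal (nbit ^~ x) = x.
Proof.
move=> x01.
have dbl01 y : 0 <= y < 1 -> 0 <= dbl y < 1.
  by rewrite /dbl /bit; case: ifPn => ?; lra.
(* The remainder after [n] digits is the [n]-fold doubled point divided by [2 ^ n]; it tends to 0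
   since doubling preserves [0, 1[. *)
have key n y : 0 <= y < 1 -> y = bsum n (nbit ^~ y) + iter n dbl y / 2 ^+ n.
  elim: n y => [|n IH] y hy; first by rewrite /bsum big_ord0 add0r expr0 divr1.
  rewrite /bsum big_ord_recr/= -/(bsum n _) {1}(IH y hy) -addrA; congr (_ + _).
  rewrite /nbit -/(iter n dbl y) exprS invfM; set z := iter n _ y; set w := (_ ^+ n)^-1.
  by rewrite /dbl; case: (bit z) => /=; lra.
have it n : 0 <= iter n dbl x < 1.
  by elim: n => // n IH; rewrite iterS dbl01.
apply: (@cvg_lim _ (@Rhausdorff R)).
have -> : bsum ^~ (nbit ^~ x) = fun n => x - iter n dbl x / 2 ^+ n.
  by apply/funext => n; rewrite {2}(key n x x01) addrK.
rewrite -[X in _ --> X]subr0; apply: cvgB; first exact: cvg_cst.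
apply: (@squeeze_cvgr _ _ _ _ (fun=> 0) (fun n => (2^-1) ^+ n)).
- near=> n; have /andP[h0 h1] := it n; rewrite divr_ge0 ?exprn_ge0//=.
  by rewrite exprVn ler_piMl ?invr_ge0 ?exprn_ge0// ltW.
- exact: cvg_cst.
- by apply: cvg_expr; rewrite ger0_norm ?invr_ge0//; lra.
Unshelve. all: end_near. Qed.

End bits.

Lemma independent_inj (R : realType) d (T : measurableType d) (P : probability T R)
    (I J : eqType) (f : I -> J) (D : set J) (F : J -> set (set T)) :
  injective f -> independent P D F ->
  independent P (f @^-1` D) (fun i => F (f i)).
Proof.
move=> fI ind s A us H.
have [i0|s0] := pselect (exists i0 : I, True); last first.
  have -> : s = [::] by case: s s0 {us H} => // i s []; exists i.
  by rewrite bigcap_nil_seq big_nil probability_setT.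
case: i0 => i0 _.
have /choice[g gf] j : exists i, (exists i', f i' = j) -> f i = j.
  by have [[i <-]|h] := pselect (exists i', f i' = j); [exists i|exists i0 => /h].
have gK i : g (f i) = i by apply: fI; apply: gf; exists i.
have := ind [seq f i | i <- s] (A \o g); rewrite map_inj_uniq// => /(_ us).
rewrite big_map; under eq_bigr do rewrite /= gK.
move=> <-; last by move=> _ /mapP[i si ->]; rewrite /= gK; exact: H.
congr (P _); apply/seteqP; split => w h i /=.
  by move=> /mapP[j sj ->]; rewrite gK; exact: h.
by move=> si; have := h (f i); rewrite /= gK; apply; exact: map_f.
Qed.

Lemma prob_eq_on (R : realType) d (T : measurableType d) (P : probability T R)
    (S A B : set T) : measurable S -> measurable A -> measurable B ->
  P S = 1%E -> A `&` S = B `&` S -> P A = P B.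
Proof.
move=> mS mA mB PS e.
have nC : P (~` S) = 0%E by rewrite probability_setC// PS subee.
suff H X : measurable X -> P X = P (X `&` S) by rewrite (H A)// (H B)// e.
move=> mX; rewrite -{1}(setIT X) -(setUv S) setIUr.
rewrite [LHS]measU; first last.
- by move=> w [[_ ?] [_ ?]].
- by apply: measurableI => //; exact: measurableC.
- exact: measurableI.
rewrite [X in (_ + X)%E](_ : _ = 0%E) ?adde0//.
apply/eqP; rewrite -measure_le0 -nC; apply: prob_le => //.
- by apply: measurableI => //; exact: measurableC.
- exact: measurableC.
Qed.

(** * Countably many uniform variables from the digits of one point *)

Section iid_uniform.
Context {R : realType}.
Local Notation U := (@U01 R).

(** The pairing splits the digits of one point into countably many disjoint infinite subsequences;
    the [j]-th one is read by [ub j]. *)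
Let code (j k : nat) : nat := pickle (j, k).
Let codeI j k j' k' : code j k = code j' k' -> (j, k) = (j', k').
Proof. exact: (pcan_inj pickleK). Qed.

Let ub (j : nat) (x : R) : R := binreal (fun k => nbit (code j k) x).

Lemma fair_ub j : fair (fun k : nat => @nbit R (code j k)).
Proof.
split=> [k|n e]; first exact: measurable_nbit.
pose s := [seq code j i | i <- iota 0 n].
pose dec m := (odflt (0%N, 0%N) (unpickle m)).2.
pose A m := nbit m @^-1` [set e (dec m)] : set R.
have decK k : dec (code j k) = k by rewrite /dec /code pickleK.
have us : uniq s.
  by rewrite map_inj_uniq ?iota_uniq// => k k' /codeI[].
have := @independent_nbit R s A us.
rewrite big_map (eq_bigr (fun=> (2^-1)%:E)); last by move=> k _; exact: U01_nbit.
have -> : iota 0 n = index_iota 0 n by rewrite /index_iota subn0.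
rewrite big_mkord prod_half => <-.
  congr (U _); apply/seteqP; split => x h.
    by move=> _ /= /mapP[k + ->]; rewrite mem_iota/= => kn; rewrite /A decK; exact: h.
  move=> k /= kn; have := h (code j k); rewrite /A/= decK; apply.
  by apply: map_f; rewrite mem_iota.
move=> m _; split=> //; exists [set e (dec m)] => //.
by rewrite setTI.
Qed.

Lemma ub_law j A : measurable A -> U (ub j @^-1` A) = U A.
Proof.
move=> mA; have -> := fair_binreal_law (fair_ub j) fair_nbit mA.
have := @prob_eq_on R _ _ U `]0, 1[%classic ((fun x : R => binreal (nbit^~ x)) @^-1` A) A. apply => //.
- exact: measurable_preT (measurable_binreal fair_nbit) mA.
- exact: U01_itv01.
- apply/seteqP; split => x /= [Ax]; rewrite in_itv/= => /andP[x0 x1].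
    by split; rewrite ?x0//; move: Ax; rewrite binreal_nbit// (ltW x0).
  by split; rewrite ?x0// binreal_nbit// (ltW x0).
Qed.

Let D j := [set m | exists k, m = code j k].
Let G j := \bigcup_(m in D j) discrete_preimages (@nbit R) m.

Lemma ub_salgebra j A : measurable A -> <<s G j >> (ub j @^-1` A).
Proof.
move=> mA.
suff mf : measurable_fun setT (ub j : g_sigma_algebraType (G j) -> R).
  by rewrite -[X in <<s _ >> X]setTI; exact: mf.
apply: (@measurable_fun_cvg _ (g_sigma_algebraType (G j)) R setT (fun n x => bsum n (fun k => nbit (code j k) x))). 
  move=> n; apply: measurable_sum => i; apply: measurable_funM => //.
  apply: (measurableT_comp (f := fun c : bool => c%:R : R)) => //.
  move=> _ B _; rewrite setTI; apply: sub_sigma_algebra.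
  exists (code j i); first by exists i.
  by exists B => //; rewrite setTI.
by move=> x _; exact: bsum_cvg.
Qed.

Lemma independent_ub :
  independent U setT (fun j => preimage_set_system setT (ub j) measurable).
Proof.
apply: (@independent_sub _ _ _ _ _ setT _ (fun j => <<s G j >>)) => //.
  by move=> j _ _ [A mA <-]; rewrite setTI; exact: ub_salgebra.
apply: (@independent_groups _ _ _ U _ _ (discrete_preimages (@nbit R)) D setT _ _ _ independent_nbit) => //.
- move=> m _; split.
  + by move=> _ [B _ <-]; apply: measurable_nbit.
  + move=> _ _ [B _ <-] [C _ <-]; exists (B `&` C) => //.
    by rewrite !setTI.
  + by exists setT => //; rewrite setTI.
- by move=> m j j' [k ->] [k' /codeI[]].
Qed.

Lemma iid_uniform_sequence : exists u : nat -> R -> R,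
  [/\ forall i, measurable_fun setT (u i), forall i x, 0 < u i x < 1,
      forall i A, measurable A -> U (u i @^-1` A) = U A &
      independent U setT (fun i => preimage_set_system setT (u i) measurable)].
Proof.
(* The value of [ub j] may be 0 or 1 on a null set; [c] moves it inside, so that the strict bounds
   hold everywhere. *)
pose c (y : R) := if 0 < y < 1 then y else 2^-1.
have mc : measurable_fun setT c.
  apply: measurable_fun_ifT => //.
  by apply: measurable_and; apply: measurable_fun_ltr.
have mub j : measurable_fun setT (ub j) := measurable_binreal (fair_ub j).
exists (fun j => c \o ub j); split.
- by move=> i; exact: measurableT_comp mc (mub i).
- by move=> i x; rewrite /c/=; case: ifPn => // _; lra.
- move=> i A mA; rewrite comp_preimage ub_law; last exact: measurable_preT.
  have := @prob_eq_on R _ _ U `]0, 1[%classic (c @^-1` A) A; apply => //.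
  + exact: measurable_preT.
  + exact: U01_itv01.
  + by apply/seteqP; split => x /= [Ax]; rewrite in_itv/= => x01; split => //;
      move: Ax; rewrite /c x01.
- apply: independent_sub independent_ub => // i _ _ [A mA <-].
  exists (c @^-1` A); first exact: measurable_preT.
  by rewrite !setTI comp_preimage.
Qed.

End iid_uniform.

(** * Sampling discrete laws and unit pieces of Lebesgue measure *)

Section sampling.
Context {R : realType}.
Local Notation U := (@U01 R).
Local Notation leb := (@lebesgue_measure R).

Lemma U01_on01 (A B : set R) : measurable A -> measurable B ->
  A `&` `]0, 1[%classic = B `&` `]0, 1[%classic -> U A = U B.
Proof.
move=> mA mB e; have := @prob_eq_on R _ _ U `]0, 1[%classic A B; apply => //.
exact: U01_itv01.
Qed.

Lemma shift_ray (a t : R) :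
  U ((fun y => a + y) @^-1` `]t, +oo[%classic) =
  leb (`]t, +oo[%classic `&` `[a, a + 1]%classic).
Proof.
have -> : (fun y => a + y) @^-1` `]t, +oo[%classic = `](t - a), +oo[%classic.
  by apply/seteqP; split => y /=; rewrite !in_itv/= !andbT ltrBlDl.
have [ta|at_] := ltP (t - a) 0.
  rewrite (_ : _ `&` _ = `[a, a + 1]%classic); last first.
    apply/seteqP; split => y /=; rewrite !in_itv/= ?andbT; first by case.
    by move=> /andP[ay ->]; rewrite ay; split => //; lra.
  have -> : U `](t - a), +oo[%classic = 1%E.
    by have [//|e] := U01_ray0 false (ltW ta); move: ta; rewrite e ltxx.
  rewrite lebesgue_measure_itv/= lte_fin ifT; last by lra.
  by rewrite -EFinB; congr EFin; lra.
have [t1|t1] := leP (t - a) 1; last first.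
  rewrite U01_ray1 ?ltW// (_ : _ `&` _ = set0) ?measure0//.
  by rewrite -subset0 => y []/=; rewrite !in_itv/=; lra.
rewrite U01_ray ?at_// (_ : _ `&` _ = `]t, (a + 1)]%classic); last first.
  apply/seteqP; split => y /=; rewrite !in_itv/= ?andbT; first by case=> -> /andP[].
  by move=> /andP[ty ->]; rewrite ty; split => //; rewrite andbT; lra.
rewrite lebesgue_measure_itv/= lte_fin; case: ltP => h.
  by rewrite -EFinB; congr EFin; lra.
by congr EFin; lra.
Qed.

Lemma U01_shift (a : R) (B : set R) : measurable B ->
  U ((fun y => a + y) @^-1` B) = leb (B `&` `[a, a + 1]%classic).
Proof.
have ma : measurable_fun setT (fun y : R => a + y) by exact: measurable_funD.
have a1 : a < a + 1 by rewrite ltrDl.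
pose m2 : probability R R := toR (uniform_prob a1).
have m2E (A : set R) : measurable A -> m2 A = leb (A `&` `[a, a + 1]%classic).
  move=> mA; rewrite /m2/= /distribution/= /pushforward/= /uniform_prob.
  rewrite integral_uniform_pdf (eq_integral (cst 1%:E)).
    by rewrite integral_cst ?mul1e//; exact: measurableI.
  move=> x; rewrite inE => -[_]/=; rewrite in_itv/= /uniform_pdf => ->.
  by rewrite addrC addKr invr1.
move=> mB; rewrite -m2E//.
change (distribution U (mkRV U ma) B = m2 B).
apply: ray_measure_unique mB => t; rewrite m2E//.
exact: shift_ray.
Qed.

(** Half-open pieces []l, l + 1]] are disjoint, so that their contributions add up to the Lebesgue
    measure of a set of positive reals. *)
Lemma U01_shift_oc (a : R) (B : set R) : measurable B ->
  U ((fun y => a + y) @^-1` B) = leb (B `&` `]a, a + 1]%classic).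
Proof.
move=> mB.
have ma : measurable_fun setT (fun y : R => a + y) by exact: measurable_funD.
transitivity (U ((fun y => a + y) @^-1` (B `&` `]a, a + 1]%classic))).
  apply: U01_on01.
  - exact: measurable_preT ma mB.
  - by apply: measurable_preT ma _; exact: measurableI.
  apply/seteqP; split => y /=; rewrite !in_itv/= => -[].
    by move=> By y01; split=> //; split=> //; lra.
  by move=> [].
rewrite U01_shift; last exact: measurableI.
congr (leb _); apply/seteqP; split => y /=; rewrite !in_itv/=; first by case.
by move=> [By /andP[y0 y1]]; rewrite (ltW y0) y0 y1.
Qed.

Lemma lebesgue_unit_pieces (B : set R) : measurable B -> B `<=` [set x | 0 < x] ->
  (\sum_(0 <= l <oo) leb (B `&` `]l%:R, (l%:R + 1)%R]%classic) = leb B)%E.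
Proof.
move=> mB B0.
rewrite -measure_semi_bigcup//=.
- congr (leb _); apply/seteqP; split => x; first by case=> ? _ [].
  move=> Bx; have x0 : 0 < x by exact: B0.
  have : exists l, x <= l%:R + 1.
    exists (Num.bound x); have := archi_boundP (ltW x0); lra.
  (* The least such [l] also satisfies [l < x]: otherwise its predecessor would do, and for [l = 0]
     this is the positivity of [x]. *)
  move=> /ex_minnP[l xl lmin]; exists l => //; split => //=; rewrite in_itv/= xl andbT.
  case: l xl lmin => // l xl lmin; rewrite ltNge; apply/negP => h.
  by have := lmin l; rewrite natr1 h ltnn => /(_ isT).
- by move=> l; exact: measurableI.
- apply/trivIsetP => i j _ _ ij; rewrite -subset0 => x [[_ /=]].
  rewrite !in_itv/= => /andP[xi1 xi2] [_ /andP[xj1 xj2]].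
  have h (a b : nat) : (a%:R : R) < x -> x <= b%:R + 1 -> (a <= b)%N.
    move=> ax xb; have : (a%:R : R) < b%:R + 1 by lra.
    by rewrite natr1 ltr_nat ltnS.
  by move: ij; rewrite eqn_leq (h i j)// (h j i).
- by apply: bigcupT_measurable => l; exact: measurableI.
Qed.

(** Inverse distribution function: the cell [[F c, F c.+1[], of length [q c], is sent to [c]. *)
Lemma discrete_sampler (q : nat -> R) : (forall c, 0 <= q c) ->
  (\sum_(0 <= k < n) q k @[n --> \oo] --> (1 : R)) ->
  exists s : R -> nat, (forall A, measurable (s @^-1` A)) /\
    forall c, U (s @^-1` [set c]) = (q c)%:E.
Proof.
move=> q0 q1.
pose F n := \sum_(0 <= k < n) q k.
have FS n : F n.+1 = F n + q n by rewrite /F big_nat_recr.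
have ndF : nondecreasing_seq F.
  by apply/nondecreasing_seqP => n; rewrite FS lerDl.
have F0 : F 0%N = 0 by rewrite /F big_geq.
have F1 n : F n <= 1.
  rewrite -(cvg_lim (@Rhausdorff R) q1); apply: nondecreasing_cvgn_le => //.
  by apply/cvg_ex; exists 1.
pose I c := `[F c, F c.+1[%classic.
have II y c c' : I c y -> I c' y -> c = c'.
  rewrite /I/= !in_itv/= => /andP[a b] /andP[a' b'].
  wlog cc : c c' a b a' b' / (c < c')%N.
    by move=> H; case: (ltngtP c c') => // h; [exact: H|apply/esym/H].
  by have := le_trans (ndF _ _ cc) a'; rewrite leNgt b.
pose s y := xget 0%N [set c | I c y].
have sI y c : I c y -> s y = c.
  by move=> h; rewrite /s; apply: xget_unique => // c' h'; exact: II h' h.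
have mI c : measurable (I c) by exact: measurable_itv.
have s1 c : measurable (s @^-1` [set c]).
  (* Points in no cell receive the default value 0 of [xget], so they join the fibre of 0. *)
  have -> : s @^-1` [set c] = I c `|`
     (if c == 0%N then ~` \bigcup_c' I c' else set0).
    apply/seteqP; split => y /=; last first.
      case=> [/sI //|]; case: eqP => // -> h.
      rewrite /s xgetPN// => c' h'; apply: h; exists c' => //.
    have [[c' h]|h] := pselect (exists c', I c' y).
      by rewrite (sI _ _ h) => <-; left.
    have -> : s y = 0%N by rewrite /s xgetPN// => c' h'; apply: h; exists c'.
    by move=> <-; right; rewrite eqxx => -[c' _ h']; apply: h; exists c'.
  apply: measurableU => //; case: ifP => // _.
  by apply: measurableC; exact: bigcupT_measurable.
exists s; split.
  move=> A; have -> : s @^-1` A = \bigcup_(c in A) (s @^-1` [set c]).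
    by apply/seteqP; split => y /=; [move=> ?; exists (s y)|move=> [c Ac /= ->]].
  exact: bigcup_measurable.
move=> c; transitivity (U (I c)).
  apply: U01_on01 => //; apply/seteqP; split => y /= [h y01]; split => //.
    have [[c' h']|H] := pselect (exists c', I c' y).
      by rewrite -h (sI _ _ h').
    exfalso; move: y01; rewrite in_itv/= => /andP[y0 y1].
    (* A point of ]0, 1[ in no cell would bound every partial sum, hence also their limit 1. *)
    have {}H n : F n <= y.
      elim: n => [|n IH]; first by rewrite F0 ltW.
      rewrite leNgt; apply/negP => h'; apply: H; exists n.
      by rewrite /I/= in_itv/= IH h'.
    suff : 1 <= y by rewrite leNgt y1.
    rewrite -(cvg_lim (@Rhausdorff R) q1); apply: limr_le; first by apply/cvg_ex; exists 1.
    by near=> n; exact: H.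
  exact: sI.
have F01 n : 0 <= F n <= 1 by rewrite F1 andbT -F0 ndF.
have -> : I c = `[F c, +oo[%classic `\` `[F c.+1, +oo[%classic.
  apply/seteqP; split => y; rewrite /I /= !in_itv/= !andbT.
    by move=> /andP[-> h]; split=> //; apply/negP; rewrite -ltNge.
  by move=> [-> /negP]; rewrite -ltNge.
rewrite prob_setD// setIidr; last first.
  by move=> y /=; rewrite !in_itv/= !andbT; apply: le_trans; exact: ndF.
by rewrite !U01_ray// -EFinB FS; congr EFin; lra.
Unshelve. all: end_near. Qed.

Lemma poisson1_sampler : exists s : R -> nat, (forall A, measurable (s @^-1` A)) /\
    forall c, U (s @^-1` [set c]) = (expR (-1) / c`!%:R)%:E.
Proof.
apply: discrete_sampler => [c|]; first by rewrite divr_ge0// expR_ge0.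
have := is_cvg_series_exp_coeff (1 : R).
have e : \sum_(0 <= k < n) expR (-1) / k`!%:R @[n --> \oo] = 
   (fun n => expR (-1) * series (exp_coeff (1 : R)) n) @ \oo.
  congr (_ @ \oo); apply/funext => n; rewrite /series/= mulr_sumr.
  by apply: eq_bigr => k _; rewrite /exp_coeff/= expr1n mul1r.
rewrite e => h; rewrite -[1 in X in _ --> X](expRxMexpNx_1 (1 : R)) mulrC.
by apply: cvgMr; rewrite /expR; exact: h.
Qed.

Lemma uniform_sampler n : exists s : R -> 'I_n.+1,
  (forall A, measurable (s @^-1` A)) /\
  forall c, U (s @^-1` [set c]) = ((n.+1%:R)^-1)%:E.
Proof.
have [||s [ms Us]] := @discrete_sampler (fun c => if (c < n.+1)%N then (n.+1%:R)^-1 else 0).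
- by move=> c; case: ifP.
- apply: cvg_near_cst; near=> m.
  rewrite (big_cat_nat (n := n.+1))//=; last by near: m; exact: nbhs_infty_ge.
  rewrite [X in _ + X]big_nat_cond [X in _ + X]big1 ?addr0; last first.
    by move=> i /andP[/andP[h _] _]; rewrite ltnNge h.
  rewrite big_mkord (eq_bigr (fun=> (n.+1%:R)^-1)); last by move=> i _; rewrite ltn_ord.
  by rewrite sumr_const card_ord -[LHS]mulr_natl divff.
(* [inord] alters only values above [n], which have probability 0. *)
exists (fun x => inord (s x)); split.
  by move=> A; exact: (ms (inord @^-1` A)).
have full : U [set x | (s x < n.+1)%N] = 1%E.
  have -> : [set x | (s x < n.+1)%N] =
      [set x | exists2 i : 'I_n.+1, xpredT i & s x = i].
    apply/seteqP; split => x /=; first by move=> h; exists (Ordinal h).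
    by move=> [i _ ->].
  rewrite (@measure_fin_partition _ _ _ _ _ _ (fun i : 'I_n.+1 => [set x | s x = i])).
  - rewrite (eq_bigr (fun=> ((n.+1%:R)^-1)%:E)).
      by rewrite sumEFin sumr_const card_ord; congr EFin; rewrite -[LHS]mulr_natl divff.
    by move=> i _; have := Us i; rewrite ltn_ord.
  - by move=> i _; exact: (ms [set (i : nat)]).
  - by move=> i j x /= -> /val_inj.
move=> c; have := Us c; rewrite ltn_ord => <-.
have := @prob_eq_on R _ _ U [set x | (s x < n.+1)%N]
  ((fun x => inord (s x)) @^-1` [set c]) (s @^-1` [set (c : nat)]); apply => //.
- exact: (ms [set k | (k < n.+1)%N]).
- exact: (ms [set k | inord k = c]).
- apply/seteqP; split => x /= [] h sn; split => //; first by rewrite -h inordK.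
  by rewrite h inord_val.
Unshelve. all: end_near. Qed.
End sampling.

(** * The points of a row of the PWIT *)

Lemma measurable_nat_bind d d' (T : measurableType d) (T' : measurableType d')
    (f : nat -> T -> T') (n : T -> nat) :
  (forall c, measurable_fun setT (f c)) -> measurable_fun setT n ->
  measurable_fun setT (fun w => f (n w) w).
Proof.
move=> mf mn _ B mB; rewrite setTI.
have -> : (fun w => f (n w) w) @^-1` B =
    \bigcup_c (n @^-1` [set c] `&` f c @^-1` B).
  apply/seteqP; split => w /=; first by move=> h; exists (n w).
  by move=> [c _ [/= <-]].
apply: bigcupT_measurable => c; apply: measurableI.
  exact: measurable_preT.
exact: measurable_preT.
Qed.

Lemma measurable_fun_ray (R : realType) d (T : measurableType d) (f : T -> R) :
  (forall t, measurable [set w | f w <= t]) -> measurable_fun setT f.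
Proof.
move=> mf; apply: (measurability _ (RGenOInfty.measurableE R)) => _ [_ [t ->] <-].
rewrite setTI; have -> : f @^-1` `]t, +oo[%classic = ~` [set w | f w <= t].
  apply/seteqP; split => w /=; rewrite in_itv/= andbT ltNge; first by move/negP.
  by move=> ?; apply/negP.
exact: measurableC.
Qed.

(** Reduces the distribution function of an order statistic to a count of indicators, from which
    measurability follows. *)
Lemma sorted_nth_le (R : realType) (s : seq R) j t :
  sorted <=%R s -> (j < size s)%N ->
  (nth 0 s j <= t) = (j < count (fun x => (x <= t)%R) s)%N.
Proof.
elim: s j => // x s IH j ss; have {}IH := IH _ (path_sorted ss).
have xs y : y \in s -> x <= y.
  by move=> ys; move: ss; rewrite /= le_path_sortedE => /andP[/allP/(_ _ ys)].
rewrite /=; have [xt|tx] := leP x t.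
  by case: j => [|j] //=; rewrite ltnS => /IH ->.
have c0 : count (fun x => x <= t) s = 0%N.
  apply/eqP; rewrite -leqn0 leqNgt -has_count; apply/hasPn => y ys.
  by rewrite -ltNge; apply: lt_le_trans tx _; exact: xs.
rewrite c0 addn0 ltn0; case: j => [_|j] /=; first by rewrite leNgt tx.
rewrite ltnS => js; rewrite leNgt (lt_le_trans tx)//; apply: xs; exact: mem_nth.
Qed.

Section row.
Context {R : realType} {T : Type} (N : nat -> T -> nat) (xi : nat -> nat -> T -> R).

Definition piece l w := sort <=%R [seq l%:R + xi l a w | a <- iota 0 (N l w)].
Definition rowpts L w := flatten [seq piece l w | l <- iota 0 L].
(** The entry is eventually constant in [L], and constantly 0 when there are at most [k] points. As
    a limit it inherits measurability from the finite stages. *)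
Definition rowX k w : R := limn (fun L => nth 0 (rowpts L w) k).

Lemma rowptsS L w : rowpts L.+1 w = rowpts L w ++ piece L w.
Proof. by rewrite /rowpts -addn1 iotaD map_cat flatten_cat /= cats0. Qed.

Lemma size_rowptsS L w : size (rowpts L.+1 w) = (size (rowpts L w) + N L w)%N.
Proof. by rewrite rowptsS size_cat size_sort size_map size_iota. Qed.

Lemma leq_size_rowpts L L' w : (L <= L')%N ->
  (size (rowpts L w) <= size (rowpts L' w))%N.
Proof.
elim: L' => [|L' IH]; first by rewrite leqn0 => /eqP->.
rewrite [(L <= _)%N]leq_eqVlt => /orP[/eqP -> //|/IH h].
by rewrite size_rowptsS (leq_trans h)// leq_addr.
Qed.

Lemma nth_rowpts_stable L L' w k : (L <= L')%N -> (k < size (rowpts L w))%N ->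
  nth 0 (rowpts L' w) k = nth 0 (rowpts L w) k.
Proof.
move=> LL kL; suff: (k < size (rowpts L' w))%N /\ nth 0 (rowpts L' w) k = nth 0 (rowpts L w) k by case.
elim: L' LL => [|L' IH]; first by rewrite leqn0 => /eqP e; rewrite -e.
rewrite [(L <= _)%N]leq_eqVlt => /orP[/eqP <- //|/IH[h1 h2]].
by rewrite size_rowptsS (leq_trans h1) ?leq_addr// rowptsS nth_cat h1.
Qed.

Lemma rowX_cvg w k : nth 0 (rowpts L w) k @[L --> \oo] --> rowX k w.
Proof.
rewrite /rowX; have [[L kL]|H] := pselect (exists L, (k < size (rowpts L w))%N).
  apply/cvg_ex; exists (nth 0 (rowpts L w) k); apply: cvg_near_cst.
  by near=> L'; apply: nth_rowpts_stable => //; near: L'; exact: nbhs_infty_ge.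
apply/cvg_ex; exists 0; apply: cvg_near_cst; near=> L.
by rewrite nth_default// leqNgt; apply/negP => h; apply: H; exists L.
Unshelve. all: end_near. Qed.

Lemma rowXE L w k : (k < size (rowpts L w))%N -> rowX k w = nth 0 (rowpts L w) k.
Proof.
move=> kL; apply: (@cvg_lim _ (@Rhausdorff R)); apply: cvg_near_cst.
by near=> L'; apply: nth_rowpts_stable => //; near: L'; exact: nbhs_infty_ge.
Unshelve. all: end_near. Qed.

(** A product over the points ignores the sorting, so it can be computed from the unsorted
    independent variables. *)
Lemma prod_rowX (phi : R -> R) L w :
  \prod_(k < size (rowpts L w)) phi (rowX k w) =
  \prod_(l < L) \prod_(a < N l w) phi (l%:R + xi l a w).
Proof.
transitivity (\prod_(x <- rowpts L w) phi x).
  rewrite (big_nth 0) big_mkord; apply: eq_bigr => k _.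
  by rewrite (rowXE (ltn_ord k)).
elim: L => [|L IH]; first by rewrite /rowpts /= big_nil big_ord0.
rewrite rowptsS big_cat/= IH big_ord_recr/=; congr (_ * _).
rewrite (perm_big _ (permEl (perm_sort _ _))) big_map.
by rewrite -[in LHS](subn0 (N L w)) big_mkord.
Qed.

(** The almost sure event on which the row is an infinite strictly increasing sequence: points never
    run out, and ties have to be excluded only inside a piece, since distinct pieces lie in disjoint
    intervals. *)
Definition row_good w := (forall L, exists2 l, (L <= l)%N & (0 < N l w)%N) /\
  forall l a a', (a < a')%N -> xi l a w <> xi l a' w.

Hypothesis xi01 : forall l a w, 0 < xi l a w < 1.

Lemma rowpts_unbounded w : row_good w -> forall n, exists L, (n <= size (rowpts L w))%N.
Proof.
move=> [inf _]; elim => [|n [L nL]]; first by exists 0%N.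
have [l Ll Nl] := inf L; exists l.+1; rewrite size_rowptsS -addn1 leq_add//.
apply: leq_trans nL _; elim: l Ll {Nl} => [|l IH]; first by rewrite leqn0 => /eqP->.
rewrite leq_eqVlt => /orP[/eqP -> //|/IH h].
by rewrite size_rowptsS (leq_trans h)// leq_addr.
Qed.

Lemma rowpts_sorted w L : row_good w -> sorted <%R (rowpts L w) /\
  forall x, x \in rowpts L w -> 0 < x < L%:R.
Proof.
move=> [_ tie]; rewrite lt_sorted_pairwise; elim: L => [|L [s1 s2]] //.
have memp x : x \in piece L w -> L%:R < x < L.+1%:R.
  rewrite mem_sort => /mapP[a _ ->]; have /andP[h0 h1] := xi01 L a w.
  by rewrite ltrDl h0 -natr1 ltrD2l h1.
rewrite rowptsS; split; last first.
  move=> x; rewrite mem_cat => /orP[/s2/andP[-> /= h]|/memp/andP[h ->]].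
    by rewrite (lt_trans h)// ltr_nat.
  by rewrite andbT (le_lt_trans _ h).
rewrite pairwise_cat s1 /=; apply/andP; split.
  apply/allrelP => x y /s2/andP[_ xL] /memp/andP[Ly _]; exact: lt_trans xL Ly.
rewrite -lt_sorted_pairwise lt_sorted_uniq_le sort_le_sorted andbT sort_uniq.
rewrite map_inj_in_uniq ?iota_uniq// => a a' _ _ /addrI e.
by case: (ltngtP a a') => // h; [have := tie L _ _ h|have := tie L _ _ h; rewrite e].
Qed.

Lemma rowX_gt0_incr w : row_good w -> 0 < rowX 0%N w /\ forall k, rowX k w < rowX k.+1 w.
Proof.
move=> gw; split.
  have [L h] := rowpts_unbounded gw 1.
  rewrite (rowXE h); have [_ H] := rowpts_sorted L gw.
  by have /andP[] := H _ (mem_nth 0 h).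
move=> k; have [L h] := rowpts_unbounded gw k.+2.
rewrite (rowXE h) (rowXE (ltnW h)); have [H _] := rowpts_sorted L gw.
by rewrite lt_sorted_ltn_nth ?inE// ltnW.
Qed.

End row.

Section measurable_row.
Context {R : realType} {d : measure_display} {T : measurableType d}.
Context (N : nat -> T -> nat) (xi : nat -> nat -> T -> R).
Hypothesis mN : forall l, measurable_fun setT (N l).
Hypothesis mxi : forall l a, measurable_fun setT (xi l a).

Lemma measurable_size_rowpts L : measurable_fun setT (fun w => size (rowpts N xi L w)).
Proof.
elim: L => [|L IH]; first exact: measurable_cst.
under eq_fun do rewrite size_rowptsS.
apply: (@measurable_nat_bind _ _ _ _ (fun c w => (c + N L w)%N)) => // c.
apply: (@measurable_nat_bind _ _ _ _ (fun c' w => (c + c')%N)) => // c'.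
Qed.

Lemma measurable_order_statistic (f : nat -> T -> R) n j :
  (forall a, measurable_fun setT (f a)) ->
  measurable_fun setT (fun w => nth 0 (sort <=%R [seq f a w | a <- iota 0 n]) j).
Proof.
move=> mf; apply: measurable_fun_ray => t.
have sz w : size (sort <=%R [seq f a w | a <- iota 0 n]) = n.
  by rewrite size_sort size_map size_iota.
have [jn|nj] := ltnP j n; last first.
  under eq_set do rewrite nth_default ?sz//.
  by case: (0 <= t); [rewrite (_ : mkset _ = setT)//|rewrite (_ : mkset _ = set0)//];
    apply/seteqP; split.
pose c w : R := \sum_(a < n) (f a w <= t)%R%:R.
have -> : [set w | nth 0 (sort <=%R [seq f a w | a <- iota 0 n]) j <= t] =
   c @^-1` `]j%:R, +oo[%classic.
  apply: eq_set => w; rewrite sorted_nth_le ?sort_le_sorted ?sz//.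
  rewrite /preimage/= in_itv/= andbT /c -natr_sum ltr_nat; congr (is_true (_ < _)%N).
  rewrite (permP (permEl (perm_sort _ _))) count_map -sum1_count big_mkcond/=.
  rewrite -[X in iota 0 X](subn0 n) big_mkord.
  by apply: eq_bigr => a _; case: (_ <= _).
apply: measurable_preT; last exact: measurable_itv.
apply: measurable_sum => a.
apply: (measurableT_comp (f := fun c : bool => c%:R : R)) => //.
exact: measurable_fun_ler.
Qed.

Lemma measurable_rowX k : measurable_fun setT (rowX N xi k).
Proof.
apply: (@measurable_fun_cvg _ _ _ _ (fun L w => nth 0 (rowpts N xi L w) k)); last first.
  by move=> w _; exact: rowX_cvg.
move=> L; elim: L k => [|L IH] k.
  by under eq_fun do rewrite /rowpts/= nth_nil; exact: measurable_cst.
under eq_fun do rewrite rowptsS nth_cat.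
apply: measurable_fun_ifT => //.
  apply: (measurableT_comp (f := fun n => (k < n)%N)) => //.
  exact: measurable_size_rowpts.
apply: (@measurable_nat_bind _ _ _ _ (fun c w => nth 0 (piece N xi L w) (k - c)%N)); last first.
  exact: measurable_size_rowpts.
move=> c; pose g n w := nth 0 (sort <=%R [seq L%:R + xi L a w | a <- iota 0 n]) (k - c)%N.
apply: (@measurable_nat_bind _ _ _ _ g) => // n.
by apply: measurable_order_statistic => a; exact: measurable_funD.
Qed.

End measurable_row.

Lemma bounded_convergence (R : realType) d (T : measurableType d) (P : probability T R)
    (f_ : nat -> T -> R) (f : T -> R) :
  (forall n, measurable_fun setT (f_ n)) -> measurable_fun setT f ->
  (forall n w, 0 <= f_ n w <= 1) ->
  {ae P, forall w, f_ ^~ w @ \oo --> f w} ->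
  (\int[P]_w (f_ n w)%:E)%E @[n --> \oo] --> (\int[P]_w (f w)%:E)%E.
Proof.
move=> mf_ mf f01 cv.
have [|||||_ _ h] := @dominated_convergence _ _ _ P setT measurableT
  (fun n w => (f_ n w)%:E) (fun w => (f w)%:E) (cst 1%:E); last exact: h.
- by move=> n; apply/measurable_EFinP.
- by apply/measurable_EFinP.
- by apply: filterS cv => w h _; apply: cvg_EFin h; near=> n.
- exact: finite_measure_integrable_cst.
- apply: nearW => w n _; have /andP[h0 h1] := f01 n w.
  by rewrite /= ger0_norm // lee_fin.
Unshelve. all: end_near. Qed.

Lemma cvg_sumR (R : realType) (I : Type) (r : seq I) (f : I -> nat -> R) (a : I -> R) :
  (forall i, f i @ \oo --> a i) ->
  \sum_(i <- r) f i n @[n --> \oo] --> \sum_(i <- r) a i.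
Proof.
move=> fa; elim: r => [|i r IH].
  by rewrite big_nil; under eq_fun do rewrite big_nil; exact: cvg_cst.
by rewrite big_cons; under eq_fun do rewrite big_cons; exact: cvgD.
Qed.

(** Fubini: the diagonal has one-point sections, which the law of [Y] does not charge. *)
Lemma tie_null (R : realType) d (T : measurableType d) (P : probability T R)
    (X Y : {RV P >-> R}) :
  (forall A B, measurable A -> measurable B ->
     P (X @^-1` A `&` Y @^-1` B) = (P (X @^-1` A) * P (Y @^-1` B))%E) ->
  (forall x, P (Y @^-1` [set x]) = 0%E) ->
  measurable [set w | X w = Y w] /\ P [set w | X w = Y w] = 0%E.
Proof.
move=> ind Y0; pose S := [set z : R * R | z.1 - z.2 = 0].
have mS : measurable S.
  have -> : S = (fun z : R * R => z.1 - z.2) @^-1` [set 0] by [].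
  apply: measurable_preT => //; exact: measurable_funB.
have -> : [set w | X w = Y w] = [set w | S (X w, Y w)].
  apply/seteqP; split => w; rewrite /S /=; first by move=> ->; rewrite subrr.
  by move/eqP; rewrite subr_eq0 => /eqP.
split.
  have mXY : measurable_fun setT (fun w => (X w, Y w)).
    by apply: measurable_fun_pair; exact: measurable_funPT.
  exact: measurable_preT mXY mS.
rewrite joint_distribution// /product_measure1 integral0_eq// => x _ /=.
rewrite (_ : xsection S x = [set x]); first exact: Y0.
apply/seteqP; split => y; rewrite /xsection /S /= inE/=.
  by move/eqP; rewrite subr_eq0 => /eqP.
by move=> ->; rewrite subrr.
Qed.

(** * Laplace functional of a row *)

Section row_law.
Context {R : realType} {d : measure_display} {T : measurableType d}.
Context (P : probability T R) (zeta : nat -> nat -> T -> R) (s : R -> nat).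
Hypothesis mzeta : forall l a, measurable_fun setT (zeta l a).
Hypothesis zeta01 : forall l a w, 0 < zeta l a w < 1.
Hypothesis zeta_law : forall l a A, measurable A -> P (zeta l a @^-1` A) = U01 A.
Hypothesis zeta_ind : independent P setT
  (fun p : nat * nat => preimage_set_system setT (zeta p.1 p.2) measurable).
Hypothesis ms : forall A, measurable (s @^-1` A).
Hypothesis s_law : forall c, U01 (s @^-1` [set c]) = (expR (-1) / c`!%:R)%:E.

(** In each interval the variable of index 0 feeds the Poisson sampler, and those of index [a.+1]
    are the positions. *)
Let N l w := s (zeta l 0%N w).
Let xi l a w := zeta l a.+1 w.
Let F (p : nat * nat) := preimage_set_system setT (zeta p.1 p.2) measurable.

Let mN l : measurable_fun setT (N l).
Proof. by move=> _ A _; rewrite setTI; exact: (measurable_preT (mzeta l 0%N) (ms A)). Qed.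

Let FP p : [/\ F p `<=` measurable, setI_closed (F p) & F p setT].
Proof.
split.
- by move=> _ [A mA <-]; exact: mzeta.
- by move=> _ _ [A mA <-] [B mB <-]; exists (A `&` B); [exact: measurableI|rewrite !setTI].
- by exists setT => //; rewrite setTI.
Qed.

Let Fpre p A : measurable A -> F p (zeta p.1 p.2 @^-1` A).
Proof. by move=> mA; exists A => //; rewrite setTI. Qed.

Section laplace.
Variable phi : R -> R.
Hypothesis mphi : measurable_fun setT phi.
Hypothesis phi01 : forall x, 0 <= phi x <= 1.

Let q l := fine (\int[U01]_y (phi (l%:R + y))%:E)%E.

Let mshift (a : R) : measurable_fun setT (fun y : R => phi (a + y)).
Proof. by apply: (measurableT_comp mphi); exact: measurable_funD. Qed.

Let q01 l : (\int[U01]_y (phi (l%:R + y))%:E)%E = (q l)%:E /\ 0 <= q l.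
Proof.
have h0 : (0 <= \int[U01]_y (phi (l%:R + y))%:E)%E.
  by apply: integral_ge0 => y _; rewrite lee_fin; have /andP[] := phi01 (l%:R + y).
split; last by rewrite /q fine_ge0.
rewrite /q fineK// ge0_fin_numE//.
apply: (@le_lt_trans _ _ (\int[U01]_y (cst 1%:E y))%E); last first.
  by rewrite integral_cst// mul1e prob_lty.
apply: ge0_le_integral => //.
- by move=> y _; rewrite lee_fin; have /andP[] := phi01 (l%:R + y).
- by apply/measurable_EFinP; exact: mshift.
- by move=> y _; rewrite lee_fin; have /andP[] := phi01 (l%:R + y).
Qed.

Let zeta_int l a : (\int[P]_w (phi (l%:R + zeta l a w))%:E = (q l)%:E)%E.
Proof.
have [<- _] := q01 l.
pose Z := mkRV P (mzeta l a).
rewrite -(@ge0_integral_distribution _ _ _ _ _ P Z (fun y => (phi (l%:R + y))%:E)).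
- apply: eq_measure_integral => A mA _; exact: zeta_law.
- by apply/measurable_EFinP; exact: mshift.
- by move=> y; rewrite lee_fin; have /andP[] := phi01 (l%:R + y).
Qed.

Let Y l w := \prod_(a < N l w) phi (l%:R + xi l a w).

Let Y01 l w : 0 <= Y l w <= 1.
Proof.
apply/andP; split; first by apply: prodr_ge0 => a _; have /andP[] := phi01 (l%:R + xi l a w).
by apply: prodr_ile1 => a _; exact: phi01.
Qed.

Let G l := \bigcup_(p in [set p : nat * nat | p.1 = l]) F p.

Lemma measurable_prod_points d' (T' : measurableType d') (z : nat -> T' -> R) (l : nat) :
  (forall a, measurable_fun setT (z a)) ->
  measurable_fun setT (fun w => \prod_(a < s (z 0%N w)) phi (l%:R + z a.+1 w)).
Proof.
move=> mz; apply: (@measurable_nat_bind _ _ _ _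
    (fun c w => \prod_(a < c) phi (l%:R + z a.+1 w)) (fun w => s (z 0%N w))); last first.
  by move=> _ A _; rewrite setTI; exact: (measurable_preT (mz 0%N) (ms A)).
move=> c; apply: measurable_prod => a _.
exact: (measurableT_comp (mshift _) (mz _)).
Qed.

Let Y_G l B : measurable B -> <<s G l >> ((fun w => (Y l w)%:E) @^-1` B).
Proof.
move=> mB.
suff mf : measurable_fun setT ((fun w => (Y l w)%:E) : g_sigma_algebraType (G l) -> \bar R).
  by rewrite -[X in <<s _ >> X]setTI; exact: mf.
apply/measurable_EFinP.
apply: (@measurable_prod_points _ (g_sigma_algebraType (G l)) (fun a => zeta l a) l).
move=> a _ A mA; rewrite setTI; apply: sub_sigma_algebra.
by exists (l, a) => //; exact: (Fpre (l, a)).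
Qed.

(** Summation over the Poisson(1) number [c] of points: the sum of e^{-1} q^c / c! is e^{q - 1}. *)
Let EY l : (\int[P]_w (Y l w)%:E)%E = (expR (q l - 1))%:E.
Proof.
pose A c := N l @^-1` [set c].
have mA c : measurable (A c) by exact: measurable_preT (mN l) _.
have mY : measurable_fun setT (fun w => (Y l w)%:E).
  by apply/measurable_EFinP; exact: measurable_prod_points.
have TA : setT = \bigcup_c A c.
  by apply/seteqP; split => w // _; exists (N l w).
rewrite TA ge0_integral_bigcup//=; last 3 first.
- by rewrite -TA.
- by move=> w _; rewrite lee_fin; have /andP[] := Y01 l w.
- by apply/trivIsetP => i j _ _ ij; rewrite -subset0 => w [/= e1 e2];
    move: ij; rewrite -e1 -e2 eqxx.
have part c : (\int[P]_(w in A c) (Y l w)%:E)%E = (expR (-1) * (q l ^+ c / c`!%:R))%:E.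
  (* On [A c] the integrand becomes a product of [c.+1] independent factors: at index 0 the
     indicator of the count, then one factor [phi] per point. *)
  pose g (p : nat * nat) (y : R) : \bar R :=
    if p.2 is a.+1 then (phi (l%:R + y))%:E else (\1_(s @^-1` [set c]) y)%:E.
  have mg p : measurable_fun setT (g p).
    case: p => l' [|a] /=; rewrite /g /=; apply/measurable_EFinP.
      by apply: measurable_indic; exact: ms.
    exact: mshift.
  pose Z (p : nat * nat) w := g p (zeta p.1 p.2 w).
  pose sq := (l, 0%N) :: [seq (l, a.+1) | a <- iota 0 c].
  have io : iota 0 c = index_iota 0 c by rewrite /index_iota subn0.
  transitivity (\int[P]_w \prod_(p <- sq) Z p w)%E.
    rewrite integral_mkcond; apply: eq_integral => w _.
    rewrite patchE /sq big_cons big_map /Z /g /= indicE.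
    rewrite (_ : (w \in A c) = (zeta l 0%N w \in s @^-1` [set c])); last first.
      by apply/idP/idP; rewrite !inE.
    case: ifPn => [wA|_]; last by rewrite mul0e.
    rewrite mul1e prodEFin; congr EFin.
    have -> : Y l w = \prod_(a < c) phi (l%:R + xi l a w).
      by rewrite /Y; move: wA; rewrite inE /= /N => ->.
    by rewrite io big_mkord.
  rewrite (expectation_prod_independent (D := setT) (F := F))//.
  - rewrite /sq big_cons big_map /Z /g /=.
    rewrite (eq_bigr (fun=> (q l)%:E)); last by move=> a _; exact: zeta_int.
    have -> : (\int[P]_w (\1_(s @^-1` [set c]) (zeta l 0%N w))%:E)%E = (expR (-1) / c`!%:R)%:E.
      rewrite -s_law -(zeta_law l 0%N)//.
      have hm := measurable_preT (mzeta l 0%N) (ms [set c]).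
      have := @integral_indic _ T R P setT measurableT _ hm.
      rewrite setIT => <-; apply: eq_integral => w _.
      by rewrite !indicE; congr (_%:R%:E); apply/idP/idP; rewrite !inE.
    rewrite io big_mkord prodEFin prodr_const card_ord -EFinM.
    by congr EFin; lra.
  - rewrite /sq /= map_inj_uniq ?iota_uniq ?andbT; last by move=> ? ? [].
    by apply/negP => /mapP[].
  - move=> p _ B mB; apply: (Fpre p (A := g p @^-1` B)).
    exact: measurable_preT (mg p) mB.
  - move=> [l' [|a]] w; rewrite /Z /g /= lee_fin//.
    by have /andP[] := phi01 (l%:R + zeta l' a.+1 w).
under eq_eseriesr do rewrite part.
transitivity (limn (fun n => (expR (-1) * series (exp_coeff (q l)) n)%:E)).
  congr (limn _); apply/funext => n; rewrite sumEFin; congr EFin.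
  by rewrite /series/= mulr_sumr.
apply: cvg_lim => //; rewrite expRD mulrC; apply: cvg_EFin; first by near=> n.
by apply: cvgMr; rewrite /expR; exact: is_cvg_series_exp_coeff.
Unshelve. all: end_near. Qed.

Lemma laplace_raw L : (\int[P]_w (\prod_(l < L) \prod_(a < N l w) phi (l%:R + xi l a w))%:E)%E =
  (\prod_(l < L) expR (q l - 1))%:E.
Proof.
have io : iota 0 L = index_iota 0 L by rewrite /index_iota subn0.
transitivity (\int[P]_w \prod_(l <- iota 0 L) (Y l w)%:E)%E.
  by apply: eq_integral => w _; rewrite io big_mkord prodEFin.
rewrite (expectation_prod_independent (D := setT) (F := fun l => <<s G l >>))//.
- by rewrite io big_mkord -prodEFin; apply: eq_bigr => l _; exact: EY.
- move=> l _; split.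
  + apply: smallest_sub; first exact: sigma_algebra_measurable.
    by move=> A [p _ FA]; have [+ _ _] := FP p; exact.
  + by move=> A B; exact: (@measurableI _ (g_sigma_algebraType (G l))).
  + exact: (@measurableT _ (g_sigma_algebraType (G l))).
- have := @independent_groups _ _ _ P _ _ F (fun l => [set p : nat * nat | p.1 = l]) setT.
  by apply => //= p l l' <- <-.
- exact: iota_uniq.
- by move=> l _ B mB; exact: Y_G.
- by move=> l w; rewrite lee_fin; have /andP[] := Y01 l w.
Qed.
End laplace.

Lemma U01_set1 (x : R) : U01 [set x] = 0%E.
Proof.
rewrite U01E//; apply/eqP; rewrite -measure_le0 -(lebesgue_measure_set1 x).
by apply: le_measure; rewrite ?inE//; exact: measurableI.
Qed.

Lemma zeta_tie l a l' a' : (l, a) <> (l', a') ->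
  measurable [set w | zeta l a w = zeta l' a' w] /\
  P [set w | zeta l a w = zeta l' a' w] = 0%E.
Proof.
move=> ne.
apply: (@tie_null _ _ _ P (mkRV P (mzeta l a)) (mkRV P (mzeta l' a'))); last first.
  by move=> x; rewrite -(U01_set1 x); exact: zeta_law.
move=> A B mA mB.
pose C p := if p == (l, a) then zeta l a @^-1` A else zeta l' a' @^-1` B.
have := @zeta_ind [:: (l, a); (l', a')] C.
rewrite /= inE andbT; move/eqP: ne => ne; rewrite ne => /(_ isT).
rewrite !bigcap_cons_seq bigcap_nil_seq setIT !big_cons big_nil mule1.
rewrite /C eqxx eq_sym (negbTE ne); apply => p; rewrite !inE => /orP[/eqP->|/eqP->].
  by rewrite eqxx; split => //; exact: (Fpre (l, a)).
by rewrite eq_sym (negbTE ne); split => //; exact: (Fpre (l', a')).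
Qed.

Lemma N_zero_run L n : P (\bigcap_(l in [set` iota L n]) [set w | N l w = 0%N]) =
  (expR (-1) ^+ n)%:E.
Proof.
pose C (p : nat * nat) := zeta p.1 p.2 @^-1` (s @^-1` [set 0%N]).
have := @zeta_ind [seq (l, 0%N) | l <- iota L n] C.
rewrite map_inj_uniq ?iota_uniq; last by move=> ? ? [].
rewrite big_map => /(_ isT) H.
have -> : \bigcap_(l in [set` iota L n]) [set w | N l w = 0%N] =
    \bigcap_(i in [set` [seq (l, 0%N) | l <- iota L n]]) C i.
  apply/seteqP; split => w h.
    by move=> _ /= /mapP[l ll ->]; exact: h.
  by move=> l ll; have := h (l, 0%N); apply; exact: map_f.
rewrite H; last by move=> p _; split => //; apply: Fpre; exact: ms.
rewrite (eq_bigr (fun=> (expR (-1))%:E)); last first.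
  by move=> l _; rewrite /C/= zeta_law// s_law fact0 divr1.
by rewrite prodEFin big_const_seq count_predT size_iota iter_mulr_1.
Qed.

Lemma row_good_ae : {ae P, forall w, row_good N xi w}.
Proof.
have mN0 l : measurable [set w | N l w = 0%N] := measurable_preT (mN l) (A := [set 0%N]) I.
pose E L := \bigcap_(l in [set l | (L <= l)%N]) [set w | N l w = 0%N].
have mE L : measurable (E L) by apply: bigcap_measurable => // ; exists L => /=.
(* An empty tail contains [n] consecutive empty pieces for every [n], so its probability is at most
   [expR (-1) ^+ n]. *)
have E0 L : P (E L) = 0%E.
  apply/eqP; rewrite -measure_le0; apply/lee_addgt0Pr => e e0; rewrite add0e.
  have : expR (-1 : R) ^+ n @[n --> \oo] --> 0.
    apply: cvg_expr; rewrite ger0_norm ?expR_ge0// -[ltRHS]expR0 ltr_expR; lra.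
  move=> /cvgrPdist_lt/(_ _ e0)[n _ /(_ n (leqnn n))]; rewrite sub0r normrN => h.
  apply: (@le_trans _ _ (expR (-1) ^+ n)%:E); last by rewrite lee_fin ltW// (le_lt_trans _ h)// ler_norm.
  rewrite -(N_zero_run L); apply: prob_le => //.
    by apply: measurable_capl => l _.
  by move=> w h' l /=; rewrite mem_iota => /andP[Ll _]; exact: h'.
pose D (p : nat * (nat * nat)) := if (p.2.1 < p.2.2)%N then
  [set w | xi p.1 p.2.1 w = xi p.1 p.2.2 w] else set0.
have mD p : measurable (D p) /\ P (D p) = 0%E.
  rewrite /D; case: ifPn => [lt|_]; last by rewrite measure0.
  by apply: zeta_tie => -[] e; move: lt; rewrite e ltnn.
pose bad := \bigcup_L E L `|` \bigcup_n D (odflt (0%N, (0%N, 0%N)) (unpickle n)).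
apply: (@negligibleS _ _ _ _ bad).
  move=> w /= /not_andP[/existsNP[L h]|].
    left; exists L => // l Ll /=; apply/eqP; rewrite -leqn0 leqNgt; apply/negP => h'.
    by apply: h; exists l.
  move=> /existsNP[l /existsNP[a /existsNP[a' h]]]; right.
  exists (pickle (l, (a, a'))) => //; rewrite pickleK /= /D /=.
  by move: h => /not_implyP[-> /contrapT].
apply: negligibleU; apply: negligible_bigcup => n.
  by apply/negligibleP => //; exact: E0.
by have [m0 h] := mD (odflt (0%N, (0%N, 0%N)) (unpickle n)); apply/negligibleP.
Qed.

Section step_function.
Variables (r : nat) (c : 'I_r -> R) (B : 'I_r -> set R).
Hypothesis c0 : forall i, 0 <= c i.
Hypothesis mB : forall i, measurable (B i).
Hypothesis Bpos : forall i, B i `<=` [set x | 0 < x].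
Hypothesis Bfin : forall i, (lebesgue_measure (B i) < +oo)%E.
Let psi x := \sum_(i < r) c i * \1_(B i) x.
Hypothesis psi1 : forall x, psi x <= 1.
Let phi x := 1 - psi x.

Let psi0 x : 0 <= psi x.
Proof. by apply: sumr_ge0 => i _; rewrite mulr_ge0. Qed.

Let mpsi : measurable_fun setT psi.
Proof. by apply: measurable_sum => i; apply: measurable_funM => //; exact: measurable_indic. Qed.

Let mphi : measurable_fun setT phi. Proof. exact: measurable_funB. Qed.

Let phi01 x : 0 <= phi x <= 1.
Proof. by rewrite subr_ge0 psi1 gerBl psi0. Qed.

Let beta (i : 'I_r) (l : nat) : R :=
  fine (lebesgue_measure (B i `&` `]l%:R, (l%:R + 1)%R]%classic)).

Let mpiece (i : 'I_r) (l : nat) : measurable (B i `&` `](l%:R : R), (l%:R + 1)%R]%classic).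
Proof. exact: measurableI. Qed.

Let beta_fin i l : lebesgue_measure (B i `&` `]l%:R, (l%:R + 1)%R]%classic) = (beta i l)%:E.
Proof.
rewrite /beta fineK// ge0_fin_numE//; apply: le_lt_trans (Bfin i).
by apply: le_measure; [rewrite inE; exact: mpiece|rewrite inE; exact: mB|move=> x []].
Qed.

(** Hence the exponent [q l - 1] is minus the integral of [psi] over one unit interval, and these
    integrals add up over [l]. *)
Let q_step l : fine (\int[U01]_y (phi (l%:R + y))%:E)%E = 1 - \sum_(i < r) c i * beta i l.
Proof.
have ma : measurable_fun setT (fun y : R => l%:R + y) by exact: measurable_funD.
have mphi' : measurable_fun setT (fun y : R => phi (l%:R + y)) := measurableT_comp mphi ma.
have mpsi' : measurable_fun setT (fun y : R => psi (l%:R + y)) := measurableT_comp mpsi ma.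
have psiE : (\int[U01]_y (psi (l%:R + y))%:E)%E = (\sum_(i < r) c i * beta i l)%:E.
  have mi i : measurable_fun setT (fun y : R => (\1_(B i) (l%:R + y))%:E).
    by apply/measurable_EFinP; apply: measurableT_comp ma; exact: measurable_indic.
  under eq_integral do rewrite /psi -sumEFin.
  rewrite ge0_integral_sum//; last 2 first.
  - by move=> i; under eq_fun do rewrite EFinM; apply: emeasurable_funM.
  - by move=> i y _; rewrite lee_fin mulr_ge0.
  rewrite -sumEFin; apply: eq_bigr => i _.
  under eq_integral do rewrite EFinM.
  rewrite ge0_integralZl//; last by rewrite lee_fin.
  rewrite EFinM; congr (_ * _)%E.
  rewrite -beta_fin -U01_shift_oc//.
  have := @integral_indic _ _ R U01 setT measurableT _ (measurable_preT ma (mB i)).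
  rewrite setIT => <-; apply: eq_integral => y _.
  by rewrite !indicE; congr (_%:R%:E); apply/idP/idP; rewrite !inE.
have sum1 : (\int[U01]_y (phi (l%:R + y))%:E + \int[U01]_y (psi (l%:R + y))%:E = 1)%E.
  rewrite -ge0_integralD//.
  - under eq_integral do rewrite -EFinD /phi subrK.
    by rewrite integral_cst// mul1e; exact: probability_setT.
  - by move=> y _; rewrite lee_fin; have /andP[] := phi01 (l%:R + y).
  - by apply/measurable_EFinP.
  - by move=> y _; rewrite lee_fin.
  - by apply/measurable_EFinP.
move: sum1; rewrite psiE.
have : (0 <= \int[U01]_y (phi (l%:R + y))%:E)%E.
  by apply: integral_ge0 => y _; rewrite lee_fin; have /andP[] := phi01 (l%:R + y).
case: (\int[U01]_y (phi (l%:R + y))%:E)%E => [z| |] //= _.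
by rewrite -EFinD => -[] <-; rewrite addrK.
Qed.

Let rawprod L w := \prod_(l < L) \prod_(a < N l w) phi (l%:R + xi l a w).

Lemma laplace_raw_cvg : (\int[P]_w (rawprod L w)%:E)%E @[L --> \oo] -->
  (expR (- \sum_(i < r) c i * fine (lebesgue_measure (B i))))%:E.
Proof.
have -> : (fun L => (\int[P]_w (rawprod L w)%:E)%E) =
    EFin \o (fun L => expR (- \sum_(i < r) c i * \sum_(0 <= l < L) beta i l)).
  apply/funext => L; rewrite (laplace_raw mphi phi01) /=; congr EFin.
  under eq_bigr do rewrite q_step addrAC subrr sub0r.
  rewrite -expR_sum; congr expR; rewrite sumrN; congr (- _).
  by rewrite exchange_big/=; apply: eq_bigr => i _; rewrite -mulr_sumr big_mkord.
apply: cvg_EFin; first by near=> n.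
rewrite /comp/=.
apply: continuous_cvg; first exact: continuous_expR.
apply: cvgN; apply: cvg_sumR => i; apply: cvgMr.
have : (\sum_(0 <= l < n) (beta i l)%:E)%E @[n --> \oo] --> lebesgue_measure (B i).
  rewrite -(lebesgue_unit_pieces (mB i) (@Bpos i)).
  under [X in _ --> X]eq_eseriesr do rewrite beta_fin.
  by apply: is_cvg_nneseries => l _ _; rewrite lee_fin fine_ge0.
have fB : lebesgue_measure (B i) = (fine (lebesgue_measure (B i)))%:E.
  by rewrite fineK// ge0_fin_numE.
rewrite {1}fB; under eq_fun do rewrite sumEFin.
by move/fine_cvg.
Unshelve. all: end_near. Qed.

Let G K w := \prod_(k < K) phi (rowX N xi k w).

Let G01 K w : 0 <= G K w <= 1.
Proof.
apply/andP; split; first by apply: prodr_ge0 => a _; have /andP[] := phi01 (rowX N xi a w).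
by apply: prodr_ile1 => a _; exact: phi01.
Qed.

Let Gcvg w : cvgn (G ^~ w).
Proof.
apply: nonincreasing_is_cvgn.
  apply/nonincreasing_seqP => n; rewrite /G big_ord_recr/= ler_piMr//.
    by have /andP[] := G01 n w.
  by have /andP[] := phi01 (rowX N xi n w).
by exists 0 => _ [n _ <-]; have /andP[] := G01 n w.
Qed.

(** [G K] decreases to a limit, and on good rows [rawprod L] is [G] evaluated at the number of
    points in the first [L] pieces. Bounded convergence gives both expectations the same limit,
    which is known for [rawprod]. *)
Lemma laplace_rowX : (\int[P]_w (\prod_(k < K) phi (rowX N xi k w))%:E)%E @[K --> \oo] -->
  (expR (- \sum_(i < r) c i * fine (lebesgue_measure (B i))))%:E.
Proof.
have mX := measurable_rowX mN (fun l a => mzeta l a.+1).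
have mG K : measurable_fun setT (G K).
  by apply: measurable_prod => k _; exact: measurableT_comp mphi (mX k).
pose Goo w := limn (G ^~ w).
have mGoo : measurable_fun setT Goo.
  by apply: (measurable_fun_cvg (h := G)) => // w _; exact: Gcvg.
have h1 : (\int[P]_w (G K w)%:E)%E @[K --> \oo] --> (\int[P]_w (Goo w)%:E)%E.
  apply: bounded_convergence => //.
  by apply: aeW => w; exact: Gcvg.
have h2 : (\int[P]_w (rawprod L w)%:E)%E @[L --> \oo] --> (\int[P]_w (Goo w)%:E)%E.
  apply: bounded_convergence => //.
  - move=> L; apply: measurable_prod => l _.
    exact: (measurable_prod_points mphi l (mzeta l)).
  - move=> L w; apply/andP; split.
      by apply: prodr_ge0 => l _; apply: prodr_ge0 => a _; have /andP[] := phi01 (l%:R + xi l a w).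
    apply: prodr_ile1 => l _; apply/andP; split.
      by apply: prodr_ge0 => a _; have /andP[] := phi01 (l%:R + xi l a w).
    by apply: prodr_ile1 => a _; exact: phi01.
  - apply: filterS row_good_ae => w gw.
    have -> : rawprod ^~ w = (G ^~ w) \o (fun L => size (rowpts N xi L w)).
      by apply/funext => L; rewrite /G /= prod_rowX.
    apply: (@cvg_comp _ _ _ (fun L => size (rowpts N xi L w)) (G ^~ w) \oo \oo); last exact: Gcvg.
    apply/cvgnyPge => n; have [L hL] := rowpts_unbounded gw n.
    near=> L'; apply: leq_trans hL _; apply: leq_size_rowpts.
    by near: L'; exact: nbhs_infty_ge.
suff <- : (\int[P]_w (Goo w)%:E)%E = (expR (- \sum_(i < r) c i * fine (lebesgue_measure (B i))))%:E.
  exact: h1.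
rewrite -(cvg_lim (@ereal_hausdorff R) h2); apply: cvg_lim; first exact: ereal_hausdorff.
exact: laplace_raw_cvg.
Unshelve. all: end_near. Qed.

End step_function.
End row_law.

(** * From Laplace functionals to Poisson counts *)

Lemma card_initial (Q : pred nat) K :
  ([set k | (k < K)%N && Q k] #= `I_(\sum_(k < K) Q k)%N)%card.
Proof.
elim: K => [|K IH].
  have e : [set k | (k < 0)%N && Q k] = `I_0 by apply/seteqP; split => k.
  by rewrite big_ord0 e; exact: card_eqxx.
rewrite big_ord_recr/=; case QK : (Q K).
  rewrite addn1; apply/eq_cardSP; exists K; first by rewrite /= ltnSn QK.
  suff -> : [set k | (k < K.+1)%N && Q k] `\ K = [set k | (k < K)%N && Q k] by [].
  apply/seteqP; split => k /=; rewrite ltnS.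
    by move=> [/andP[kK ->] /eqP ne]; rewrite andbT ltn_neqAle ne kK.
  by move=> /andP[kK ->]; rewrite ltnW//; split=> // e; move: kK; rewrite e ltnn.
rewrite addn0; suff -> : [set k | (k < K.+1)%N && Q k] = [set k | (k < K)%N && Q k] by [].
apply/seteqP; split => k /= /andP[kK Qk]; rewrite Qk andbT; last exact: ltnW.
move: kK; rewrite ltnS leq_eqVlt => /orP[/eqP e|//].
by move: Qk; rewrite e QK.
Qed.

(** Replaces a cardinality by the eventual value of partial counts, a countable combination of
    measurable events. *)
Lemma card_eventually (Q : pred nat) c :
  ([set k | Q k] #= `I_c)%card <->
  exists K0, forall K, (K0 <= K)%N -> (\sum_(k < K) Q k)%N = c.
Proof.
have mono K K' : (K <= K')%N -> (\sum_(k < K) Q k <= \sum_(k < K') Q k)%N.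
  elim: K' => [|K' IH]; first by rewrite leqn0 => /eqP->.
  rewrite [(K <= _)%N]leq_eqVlt => /orP[/eqP->//|/IH h].
  by rewrite big_ord_recr/= (leq_trans h)// leq_addr.
split=> [h|[K0 h]].
  have /finite_seqP[s hs] : finite_set [set k | Q k] by exists c.
  exists (\max_(k <- s) k.+1) => K sK.
  apply/card_eq_II; rewrite card_eq_sym; apply: (card_eq_trans (card_esym h)).
  rewrite (_ : [set k | Q k] = [set k | (k < K)%N && Q k]); first exact: card_initial.
  apply/seteqP; split => k /=; last by case/andP.
  move=> Qk; rewrite Qk andbT; apply: leq_trans sK.
  have ks : k \in s by have : [set k | Q k] k by []; rewrite hs.
  exact: (@leq_bigmax_seq _ s xpredT (fun k => k.+1)).
rewrite (_ : [set k | Q k] = [set k | (k < K0)%N && Q k]).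
  by rewrite -(h K0 (leqnn _)); exact: card_initial.
apply/seteqP; split => k /=; last by case/andP.
move=> Qk; rewrite Qk andbT ltnNge; apply/negP => kK.
have := h k.+1 (leqW kK); rewrite big_ord_recr/= (h k kK) Qk addn1.
by move/eqP; rewrite eqn_leq ltnn.
Qed.

(** At the first index [m] where the coefficients might differ, division by [z ^ m] leaves a
    remainder of order [M * z]. *)
Lemma power_series_unique (R : realType) (a b : nat -> R) (M : R) :
  (forall c, 0 <= a c <= M) -> (forall c, 0 <= b c <= M) ->
  (forall z : R, 0 < z <= 2^-1 -> exists l : R,
    \sum_(0 <= c < n) a c * z ^+ c @[n --> \oo] --> l /\
    \sum_(0 <= c < n) b c * z ^+ c @[n --> \oo] --> l) ->
  a = b.
Proof.
move=> a0 b0 H; apply/funext.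
have M0 : 0 <= M by have /andP[h0 h1] := a0 0%N; exact: le_trans h0 h1.
have tail (z : R) m n : 0 < z <= 2^-1 -> \sum_(m.+1 <= c < n) z ^+ c <= 2 * z ^+ m.+1.
  move=> /andP[z0 z1].
  (* The subtracted term makes the geometric bound inductive in [n]. *)
  suff : \sum_(m.+1 <= c < n) z ^+ c <= 2 * z ^+ m.+1 - 2 * z ^+ (maxn m.+1 n).
    by move=> /le_trans; apply; rewrite gerBl mulr_ge0// exprn_ge0// ltW.
  elim: n => [|n IH]; first by rewrite big_geq// maxn0; have := exprn_gt0 m.+1 z0; lra.
  have [mn|nm] := leqP m.+1 n; last first.
    by rewrite big_geq// (maxn_idPl nm); have := exprn_gt0 m.+1 z0; lra.
  rewrite big_nat_recr//= (maxn_idPr (leqW mn)) [z ^+ n.+1]exprS.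
  move: IH; rewrite (maxn_idPr mn) => IH.
  have zn := exprn_gt0 n z0.
  have : z * z ^+ n <= 2^-1 * z ^+ n by rewrite ler_pM2r.
  lra.
suff key (a' b' : nat -> R) m : (forall c, 0 <= a' c <= M) -> (forall c, 0 <= b' c <= M) ->
  (forall z : R, 0 < z <= 2^-1 -> exists l : R,
    \sum_(0 <= c < n) a' c * z ^+ c @[n --> \oo] --> l /\
    \sum_(0 <= c < n) b' c * z ^+ c @[n --> \oo] --> l) ->
  (forall c, (c < m)%N -> a' c = b' c) -> a' m <= b' m.
  move=> m; elim/ltn_ind: m => m IH.
  apply/eqP; rewrite eq_le; apply/andP; split; apply: key => //.
    by move=> z /H[l [? ?]]; exists l.
  by move=> c /IH.
move: a' b' m => {H a0 b0}a {}b m a0 b0 H IH.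
apply/ler_addgt0Pr => e e0.
(* The tail contributes at most [2 * M * z] after division by [z ^ m]; the added 1 keeps the
   denominator positive when [M = 0]. *)
pose z := Num.min 2^-1 (e / (2 * M + 1)).
have M1 : 0 < 2 * M + 1 by lra.
have z0 : 0 < z by rewrite lt_min divr_gt0// invr_gt0 ltr0n.
have z2 : z <= 2^-1 by rewrite ge_min lexx.
have ze : z * (2 * M + 1) <= e by rewrite -ler_pdivlMr// ge_min lexx orbT.
have zz : 0 < z <= 2^-1 by rewrite z0.
have [l [ca cb]] := H z zz.
have zm := exprn_gt0 m z0.
have ndsum (u : nat -> R) : (forall c, 0 <= u c <= M) ->
    nondecreasing_seq (fun n => \sum_(0 <= c < n) u c * z ^+ c).
  move=> u0; apply/nondecreasing_seqP => n; rewrite big_nat_recr//= lerDl.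
  by apply: mulr_ge0; [have /andP[] := u0 n|rewrite exprn_ge0// ltW].
have la : \sum_(0 <= c < m.+1) a c * z ^+ c <= l.
  rewrite -(cvg_lim (@Rhausdorff R) ca); apply: nondecreasing_cvgn_le; first exact: ndsum.
  by apply/cvg_ex; exists l.
have lb : l <= \sum_(0 <= c < m.+1) b c * z ^+ c + M * (2 * z ^+ m.+1).
  rewrite -(cvg_lim (@Rhausdorff R) cb); apply: limr_le; first by apply/cvg_ex; exists l.
  near=> n; rewrite (big_cat_nat (n := m.+1))//=; last by near: n; exact: nbhs_infty_ge.
  rewrite lerD2l; apply: (@le_trans _ _ (\sum_(m.+1 <= c < n) M * z ^+ c)).
    apply: ler_sum => c _; apply: ler_wpM2r; first by rewrite exprn_ge0// ltW.
    by have /andP[] := b0 c.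
  by rewrite -mulr_sumr ler_wpM2l// tail.
have := le_trans la lb; rewrite !big_nat_recr//=.
rewrite (eq_big_nat _ _ (F2 := fun c => b c * z ^+ c)); last first.
  by move=> c /andP[_ /IH ->].
rewrite -addrA lerD2l exprS => h.
have : a m * z ^+ m <= (b m + 2 * M * z) * z ^+ m by rewrite mulrDl; lra.
rewrite ler_pM2r// => /le_trans; apply; rewrite lerD2l; lra.
Unshelve. all: end_near. Qed.

Lemma cvg_prodR (R : realType) (I : Type) (r : seq I) (f : I -> nat -> R) (a : I -> R) :
  (forall i, f i @ \oo --> a i) ->
  \prod_(i <- r) f i n @[n --> \oo] --> \prod_(i <- r) a i.
Proof.
move=> fa; elim: r => [|i r IH].
  by rewrite big_nil; under eq_fun do rewrite big_nil; exact: cvg_cst.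
by rewrite big_cons; under eq_fun do rewrite big_cons; exact: cvgM.
Qed.

Definition pois {R : realType} (l : R) (c : nat) : R := expR (- l) * (l ^+ c / c`!%:R).

Lemma pois_series {R : realType} (l z : R) :
  \sum_(0 <= c < n) pois l c * z ^+ c @[n --> \oo] --> expR (- ((1 - z) * l)).
Proof.
have -> : (fun n => \sum_(0 <= c < n) pois l c * z ^+ c) =
    (fun n => expR (- l) * series (exp_coeff (l * z)) n).
  apply/funext => n; rewrite /series/= mulr_sumr; apply: eq_bigr => c _.
  by rewrite /pois /exp_coeff/= exprMn mulrA; lra.
have -> : - ((1 - z) * l) = - l + l * z by lra.
by rewrite expRD; apply: cvgMr; rewrite /expR; exact: is_cvg_series_exp_coeff.
Qed.

Lemma pois01 {R : realType} (l : R) c : 0 <= l -> 0 <= pois l c <= 1.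
Proof.
move=> l0; have p0 k : 0 <= pois l k by rewrite mulr_ge0 ?expR_ge0// divr_ge0// exprn_ge0.
rewrite p0 /=; have cv : \sum_(0 <= c < n) pois l c @[n --> \oo] --> (1 : R).
  have := @pois_series R l 1; rewrite subrr mul0r oppr0 expR0.
  by under eq_fun do (under eq_bigr do rewrite expr1n mulr1).
have nd : nondecreasing_seq (fun n => \sum_(0 <= c < n) pois l c).
  by apply/nondecreasing_seqP => n; rewrite big_nat_recr//= lerDl.
apply: (@le_trans _ _ (\sum_(0 <= k < c.+1) pois l k)).
  by rewrite big_nat_recr//= lerDr sumr_ge0.
rewrite -(cvg_lim (@Rhausdorff R) cv); apply: nondecreasing_cvgn_le => //.
by apply/cvg_ex; exists 1.
Qed.

(** At rate 0 [poisson_prob] is the Dirac mass at 0, which agrees with the formula because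
    [0 ^+ 0 = 1]. *)
Lemma poisson_prob_set1 {R : realType} (l : R) k c : 0 <= l ->
  poisson_prob l k [set c] = (pois l c)%:E.
Proof.
rewrite /poisson_prob le_eqVlt => /orP[/eqP<-|l0]; last first.
  rewrite l0 esum_set1; last by rewrite lee_fin poisson_pmf_ge0.
  by rewrite /poisson_pmf l0 /pois; congr EFin; lra.
rewrite ltxx /pois oppr0 expR0 mul1r diracE; case: c => [|c].
  by rewrite mem_set// expr0 fact0 divr1.
by rewrite expr0n /= mul0r memNset.
Qed.

Section counts.
Context {R : realType} {d : measure_display} {T : measurableType d}.
Context (P : probability T R) (X : nat -> T -> R).
Hypothesis mX : forall k, measurable_fun setT (X k).

Definition cnt (B : set R) K w := (\sum_(k < K) (X k w \in B))%N.
Definition iscnt (B : set R) (c : nat) : set T :=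
  [set w | ([set k | B (X k w)] #= `I_c)%card].
(** For [0 <= z < 1], this is [z] to the number of points in [B], read as 0 when there are
    infinitely many. *)
Definition zpow (z : R) (B : set R) w : R := limn (fun K => z ^+ cnt B K w).

Lemma iscntP B c w : iscnt B c w <->
  exists K0, forall K, (K0 <= K)%N -> cnt B K w = c.
Proof.
rewrite /iscnt /=.
have -> : [set k | B (X k w)] = [set k | X k w \in B].
  by apply/seteqP; split => k /=; rewrite inE.
exact: (card_eventually (fun k => X k w \in B) c).
Qed.

Lemma cnt_nd B K K' w : (K <= K')%N -> (cnt B K w <= cnt B K' w)%N.
Proof.
elim: K' => [|K' IH]; first by rewrite leqn0 => /eqP->.
rewrite [(K <= _)%N]leq_eqVlt => /orP[/eqP->//|/IH h].
by rewrite /cnt big_ord_recr/= (leq_trans h)// leq_addr.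
Qed.

Lemma measurable_cnt B K : measurable B -> measurable_fun setT (cnt B K).
Proof.
move=> mB; elim: K => [|K IH].
  by rewrite (_ : cnt B 0 = cst 0%N)//; apply/funext => w; rewrite /cnt big_ord0.
rewrite (_ : cnt B K.+1 = fun w => (cnt B K w + (X K w \in B))%N); last first.
  by apply/funext => w; rewrite /cnt big_ord_recr.
apply: (@measurable_nat_bind _ _ _ _ (fun c w => (c + (X K w \in B))%N)) => // c.
apply: (measurableT_comp (f := fun b : bool => (c + b)%N)) => //.
apply: (measurableT_comp (f := fun x : R => x \in B)) => //.
move=> _ A _; rewrite setTI.
have -> : (fun x : R => x \in B) @^-1` A =
    (if true \in A then B else set0) `|` (if false \in A then ~` B else set0).
  apply/seteqP; split => x /=.
    case: (boolP (x \in B)) => [xB /mem_set -> | xB /mem_set ->]; [left|right].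
      by rewrite inE in xB.
    by rewrite notin_setE in xB.
  case; case: ifPn => // /set_mem h; first by move=> xB; rewrite (mem_set xB).
  by move=> xB; rewrite (memNset xB).
by apply: measurableU; case: ifP => // _; exact: measurableC.
Qed.

Lemma measurable_iscnt B c : measurable B -> measurable (iscnt B c).
Proof.
move=> mB.
have -> : iscnt B c = \bigcup_K0 \bigcap_(K in [set K | (K0 <= K)%N]) (cnt B K @^-1` [set c]).
  apply/seteqP; split => w.
    by move/iscntP => [K0 h]; exists K0 => // K; exact: h.
  by move=> [K0 _ h]; apply/iscntP; exists K0 => K; exact: h.
apply: bigcupT_measurable => K0; apply: bigcap_measurable; first by exists K0 => /=.
by move=> K _; exact: measurable_preT (measurable_cnt K mB) _.
Qed.

Section zpow.
Variable z : R.
Hypothesis z01 : 0 <= z < 1.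

Lemma zexp01 n : 0 <= z ^+ n <= 1.
Proof. by have /andP[z0 z1] := z01; rewrite exprn_ge0// exprn_ile1// ltW. Qed.

Lemma zpow_cvg B w : z ^+ cnt B K w @[K --> \oo] --> zpow z B w.
Proof.
have /andP[z0 z1] := z01.
apply: nonincreasing_is_cvgn.
  by move=> K K' KK; rewrite ler_wiXn2l// ?cnt_nd// ltW.
by exists 0 => _ [K _ <-]; have /andP[] := zexp01 (cnt B K w).
Qed.

Lemma zpow01 B w : 0 <= zpow z B w <= 1.
Proof.
have c : cvgn (fun K => z ^+ cnt B K w) by exact: zpow_cvg.
apply/andP; split.
  by apply: limr_ge => //; near=> K; have /andP[] := zexp01 (cnt B K w).
by apply: limr_le => //; near=> K; have /andP[] := zexp01 (cnt B K w).
Unshelve. all: end_near. Qed.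

Lemma measurable_zpow B : measurable B -> measurable_fun setT (zpow z B).
Proof.
move=> mB; apply: (measurable_fun_cvg (h := fun K w => z ^+ cnt B K w)).
  move=> K; apply: (measurableT_comp (f := fun n : nat => z ^+ n)) => //.
  exact: measurable_cnt.
by move=> w _; exact: zpow_cvg.
Qed.

Lemma zpow_series B w :
  \sum_(0 <= c < n) \1_(iscnt B c) w * z ^+ c @[n --> \oo] --> zpow z B w.
Proof.
have /andP[z0 z1] := z01.
have [[c0 hc]|H] := pselect (exists c, iscnt B c w).
  have uniq c : iscnt B c w -> c = c0.
    move: hc => /iscntP[K0 h0] /iscntP[K1 h1].
    by rewrite -(h0 (maxn K0 K1)) ?leq_maxl// -(h1 (maxn K0 K1))// leq_maxr.
  have -> : zpow z B w = z ^+ c0.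
    apply: (cvg_lim (@Rhausdorff R)); apply: cvg_near_cst.
    move: hc => /iscntP[K0 h0]; near=> K; rewrite h0//.
    by near: K; exact: nbhs_infty_ge.
  apply: cvg_near_cst; near=> n.
  have c0n : (c0 < n)%N by near: n; exact: nbhs_infty_gt.
  rewrite big_mkord (bigD1 (Ordinal c0n))//= big1 ?addr0.
    by rewrite indicE mem_set// mul1r.
  move=> i /eqP ne; rewrite indicE memNset ?mul0r// => /uniq e.
  by apply: ne; exact: val_inj.
have -> : zpow z B w = 0.
  have unb n : exists K, (n <= cnt B K w)%N.
    elim: n => [|n [K hK]]; first by exists 0%N.
    apply: contrapT => /forallNP h; apply: H; exists n; apply/iscntP; exists K => K' KK.
    apply/eqP; rewrite eqn_leq (leq_trans hK) ?cnt_nd// andbT -ltnS ltnNge.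
    exact/negP/h.
  apply: (cvg_lim (@Rhausdorff R)).
  apply: (@cvg_comp _ _ _ (fun K => cnt B K w) (fun n => z ^+ n) \oo \oo).
    apply/cvgnyPge => n; have [K hK] := unb n; near=> K'.
    by apply: leq_trans hK _; apply: cnt_nd; near: K'; exact: nbhs_infty_ge.
  by apply: cvg_expr; rewrite ger0_norm.
apply: cvg_near_cst; near=> n; rewrite big1// => c _.
by rewrite indicE memNset ?mul0r// => h; apply: H; exists c.
Unshelve. all: end_near. Qed.

Lemma zpow_partial01 B w n : 0 <= \sum_(0 <= c < n) \1_(iscnt B c) w * z ^+ c <= 1.
Proof.
have /andP[z0 z1] := z01.
have t0 c : 0 <= \1_(iscnt B c) w * z ^+ c by rewrite mulr_ge0// exprn_ge0.
apply/andP; split; first exact: sumr_ge0.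
apply: le_trans (_ : zpow z B w <= 1); last by have /andP[] := zpow01 B w.
rewrite -(cvg_lim (@Rhausdorff R) (zpow_series (B := B) (w := w))).
apply: nondecreasing_cvgn_le.
  by apply/nondecreasing_seqP => m; rewrite big_nat_recr//= lerDl.
by apply/cvg_ex; exists (zpow z B w); exact: zpow_series.
Qed.

End zpow.

(* For [phi = 1 - \sum_i c i * \1_(B i)], the expectation of the product of [phi]
   over the points is [exp (- \int (1 - phi))] when they form a Poisson process. *)
Definition laplace_poisson := forall r (c : 'I_r -> R) (B : 'I_r -> set R),
  (forall i, 0 <= c i) -> (forall i, measurable (B i)) ->
  (forall i, B i `<=` [set x | 0 < x]) ->
  (forall i, (lebesgue_measure (B i) < +oo)%E) ->
  (forall x, \sum_(i < r) c i * \1_(B i) x <= 1) ->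
  (\int[P]_w (\prod_(k < K) (1 - \sum_(i < r) c i * \1_(B i) (X k w)))%:E)%E @[K --> \oo]
    --> (expR (- \sum_(i < r) c i * fine (lebesgue_measure (B i))))%:E.

Hypothesis Lap : laplace_poisson.

Section joint.
Variables (r : nat) (B : 'I_r -> set R).
Hypothesis mB : forall i, measurable (B i).
Hypothesis Bpos : forall i, B i `<=` [set x | 0 < x].
Hypothesis Bfin : forall i, (lebesgue_measure (B i) < +oo)%E.
Hypothesis tB : trivIset setT B.

Let lam i := fine (lebesgue_measure (B i)).
Let lam0 i : 0 <= lam i. Proof. exact: fine_ge0. Qed.

Let indicB i j x : B i x -> \1_(B j) x = (j == i)%:R :> R.
Proof.
move=> Bi; rewrite indicE; case: eqP => [->|ne]; first by rewrite mem_set.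
by rewrite memNset// => Bj; apply: ne; apply: (tB I I); exists x.
Qed.

Let sum_indic (c : 'I_r -> R) x : 
  \sum_(i < r) c i * \1_(B i) x = 0 /\ (forall i, ~ B i x) \/
  exists2 i, B i x & \sum_(i < r) c i * \1_(B i) x = c i.
Proof.
have [[i Bi]|/forallNP H] := pselect (exists i, B i x); [right|left].
  exists i => //; rewrite (bigD1 i)//= big1 ?addr0 => [|j ji]; rewrite (indicB _ Bi).
    by rewrite eqxx mulr1.
  by rewrite (negbTE ji) mulr0.
by split => //; apply: big1 => i _; rewrite indicE memNset ?mulr0.
Qed.

(** The sets are disjoint, so at most one indicator is nonzero. This turns the Laplace functional
    into the joint generating function of the counts. *)
Let factor (z : 'I_r -> R) x :
  1 - \sum_(i < r) (1 - z i) * \1_(B i) x = \prod_(i < r) z i ^+ (x \in B i).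
Proof.
have [[-> nB]|[i Bi ->]] := sum_indic (fun i => 1 - z i) x.
  by rewrite subr0 big1// => i _; rewrite memNset.
rewrite subKr (bigD1 i)//= big1 ?mulr1 ?mem_set// => j ji.
have := indicB j Bi; rewrite (negbTE ji) indicE => /eqP.
by rewrite pnatr_eq0 eqb0 => /negbTE ->.
Qed.

Let prod_factor (z : 'I_r -> R) K w :
  \prod_(k < K) (1 - \sum_(i < r) (1 - z i) * \1_(B i) (X k w)) =
  \prod_(i < r) z i ^+ cnt (B i) K w.
Proof.
under eq_bigr do rewrite factor.
rewrite exchange_big/=; apply: eq_bigr => i _.
elim: K => [|K IH]; first by rewrite big_ord0 /cnt big_ord0.
by rewrite big_ord_recr/= IH -exprD /cnt big_ord_recr.
Qed.

(* [inl c] stands for the event that the count of [B i] is [c], [inr z] for the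
   generating function [z ^ count]. Uniqueness of power series coefficients turns
   one [inr] into an [inl] at a time. *)
Let kind := (nat + R)%type.
Let fk i (k : kind) w : R := match k with
  | inl c => \1_(iscnt (B i) c) w | inr z => zpow z (B i) w end.
Let ek i (k : kind) : R := match k with
  | inl c => pois (lam i) c | inr z => expR (- ((1 - z) * lam i)) end.
Let kok (k : kind) := match k with inl _ => True | inr z => 0 <= z < 1 end.

Let fk01 i k w : kok k -> 0 <= fk i k w <= 1.
Proof.
case: k => [c _|z /zpow01]; last exact.
by rewrite /= indicE; case: (_ \in _); rewrite ?lexx ?ler01.
Qed.

Let mfk i k : kok k -> measurable_fun setT (fk i k).
Proof.
case: k => [c _|z zz]; last exact: measurable_zpow.
by apply: measurable_indic; exact: measurable_iscnt.
Qed.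

Let ek01 i k : kok k -> 0 <= ek i k <= 1.
Proof.
case: k => [c _|z /andP[z0 z1]]; first exact: pois01.
rewrite /ek expR_ge0 /= -[X in _ <= X]expR0 ler_expR oppr_le0; apply: mulr_ge0 => //; lra.
Qed.

Lemma expectation_kinds n (kappa : 'I_r -> kind) : (forall i, kok (kappa i)) ->
  (\sum_(i < r) (if kappa i is inl _ then 1 else 0) = n)%N ->
  (\int[P]_w (\prod_(i < r) fk i (kappa i) w)%:E)%E = (\prod_(i < r) ek i (kappa i))%:E.
Proof.
elim: n kappa => [|n IH] kappa ok hn.
  (* Base case: only generating functions remain, and the Laplace functional with weights [1 - z i]
     evaluates them. *)
  have /choice[z hz] i : exists z, 0 <= z < 1 /\ kappa i = inr z.
    have := ok i; case e : (kappa i) => [c|z] /= h; last by exists z.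
    by move/eqP: hn; rewrite sum_nat_eq0 => /forallP/(_ i)/=; rewrite e.
  have z01 i : 0 <= z i < 1 by have [] := hz i.
  have kz i : kappa i = inr (z i) by have [] := hz i.
  have h1 : (\int[P]_w (\prod_(i < r) z i ^+ cnt (B i) K w)%:E)%E @[K --> \oo] -->
     (expR (- \sum_(i < r) (1 - z i) * lam i))%:E.
    under eq_fun do under eq_integral do rewrite -prod_factor.
    apply: Lap => // [i|x]; first by have /andP[_ h] := z01 i; rewrite subr_ge0 ltW.
    have [[-> _]|[i _ ->]] := sum_indic (fun i => 1 - z i) x; first exact: ler01.
    by rewrite gerBl; have /andP[] := z01 i.
  have h2 : (\int[P]_w (\prod_(i < r) z i ^+ cnt (B i) K w)%:E)%E @[K --> \oo] -->
     (\int[P]_w (\prod_(i < r) zpow (z i) (B i) w)%:E)%E.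
    apply: bounded_convergence.
    - move=> K; apply: measurable_prod => i _.
      apply: (measurableT_comp (f := fun n : nat => z i ^+ n)) => //.
      exact: measurable_cnt.
    - by apply: measurable_prod => i _; exact: measurable_zpow.
    - move=> K w; apply/andP; split.
        by apply: prodr_ge0 => i _; have /andP[] := zexp01 (z01 i) (cnt (B i) K w).
      by apply: prodr_ile1 => i _; exact: zexp01.
    - by apply: aeW => w; apply: cvg_prodR => i; exact: zpow_cvg.
  under eq_integral do (under eq_bigr do rewrite kz /=).
  rewrite -(cvg_lim (@ereal_hausdorff R) h2) (cvg_lim (@ereal_hausdorff R) h1).
  rewrite -sumrN expR_sum; congr EFin; apply: eq_bigr => i _.
  by rewrite kz.
have [i0 [c0 ki0]] : exists i0, exists c0, kappa i0 = inl c0.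
  apply: contrapT => H; move: hn; rewrite big1// => i _.
  by case e : (kappa i) => [c|//]; exfalso; apply: H; exists i, c.
pose upd k i : kind := if i == i0 then k else kappa i.
have updok k : kok k -> forall i, kok (upd k i).
  by move=> h i; rewrite /upd; case: eqP.
pose rest w := \prod_(i < r | i != i0) fk i (kappa i) w.
pose A := \prod_(i < r | i != i0) ek i (kappa i).
have rest01 w : 0 <= rest w <= 1.
  apply/andP; split; first by apply: prodr_ge0 => i _; have /andP[] := fk01 i w (ok i).
  by apply: prodr_ile1 => i _; exact: fk01.
have A01 : 0 <= A <= 1.
  apply/andP; split; first by apply: prodr_ge0 => i _; have /andP[] := ek01 i (ok i).
  by apply: prodr_ile1 => i _; exact: ek01.
have updf k w : \prod_(i < r) fk i (upd k i) w = rest w * fk i0 k w.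
  rewrite (bigD1 i0)//= {1}/upd eqxx mulrC; congr (_ * _).
  by apply: eq_bigr => i /negbTE ne; rewrite /upd ne.
have upde k : \prod_(i < r) ek i (upd k i) = A * ek i0 k.
  rewrite (bigD1 i0)//= {1}/upd eqxx mulrC; congr (_ * _).
  by apply: eq_bigr => i /negbTE ne; rewrite /upd ne.
have kupd : kappa = upd (inl c0).
  by apply/funext => i; rewrite /upd; case: eqP => // ->.
have mrest : measurable_fun setT rest.
  have -> : rest = fun w => \prod_(i < r) (if i != i0 then fk i (kappa i) w else 1).
    by apply/funext => w; rewrite /rest big_mkcond.
  apply: measurable_prod => i _; case: (i != i0); last exact: measurable_cst.
  exact: mfk.
(* The coefficients of a power series in [z] whose sum is the same expectation with [inr z] at [i0].
   The induction hypothesis evaluates that sum, so comparing coefficients returns to [inl c0]. *)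
pose a c := fine (\int[P]_w (rest w * \1_(iscnt (B i0) c) w)%:E)%E.
have ia c : (\int[P]_w (rest w * \1_(iscnt (B i0) c) w)%:E)%E = (a c)%:E /\ 0 <= a c <= 1.
  have h01 w : 0 <= rest w * \1_(iscnt (B i0) c) w <= 1.
    have /andP[x0 x1] := rest01 w; have /andP[y0 y1] := fk01 i0 w (k := inl c) I.
    by rewrite mulr_ge0//= mulr_ile1.
  have i0' : (0 <= \int[P]_w (rest w * \1_(iscnt (B i0) c) w)%:E)%E.
    by apply: integral_ge0 => w _; rewrite lee_fin; have /andP[] := h01 w.
  have i1 : (\int[P]_w (rest w * \1_(iscnt (B i0) c) w)%:E <= 1%:E)%E.
    have <- : (\int[P]_w (cst 1%:E w))%E = 1%:E.
      by rewrite integral_cst// mul1e; exact: probability_setT.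
    apply: ge0_le_integral => //.
    - by move=> w _; rewrite lee_fin; have /andP[] := h01 w.
    - apply/measurable_EFinP; apply: measurable_funM => //.
      by apply: measurable_indic; exact: measurable_iscnt.
    - by move=> w _; rewrite lee_fin; have /andP[] := h01 w.
  rewrite /a fineK ?fine_ge0//=; last by rewrite ge0_fin_numE// (le_lt_trans i1)// ltry.
  by split=> //; rewrite -lee_fin fineK// ge0_fin_numE// (le_lt_trans i1)// ltry.
have ab : a = (fun c => A * pois (lam i0) c).
  apply: (@power_series_unique _ _ _ 1).
  - by move=> c; have [] := ia c.
  - move=> c; have /andP[x0 x1] := A01; have /andP[y0 y1] := pois01 c (lam0 i0).
    by rewrite mulr_ge0//= mulr_ile1.
  move=> z /andP[z0 z2]; have z01 : 0 <= z < 1 by apply/andP; split; lra.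
  exists (A * expR (- ((1 - z) * lam i0))); split; last first.
    under eq_fun do (under eq_bigr do rewrite -mulrA); under eq_fun do rewrite -mulr_sumr.
    by apply: cvgMr; exact: pois_series.
  have hz : (\int[P]_w (rest w * zpow z (B i0) w)%:E)%E = (A * expR (- ((1 - z) * lam i0)))%:E.
    rewrite -(upde (inr z)) -IH; first by under [RHS]eq_integral do rewrite updf.
      exact: updok.
    apply/eqP; rewrite -eqSS -hn kupd (bigD1 i0)//= [X in _ == X](bigD1 i0)//=.
    rewrite /upd eqxx add0n add1n eqSS; apply/eqP; apply: eq_bigr => i /negbTE ne.
    by rewrite ne.
  have cv : (\int[P]_w (rest w * \sum_(0 <= c < n) \1_(iscnt (B i0) c) w * z ^+ c)%:E)%E
      @[n --> \oo] --> (\int[P]_w (rest w * zpow z (B i0) w)%:E)%E.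
    apply: bounded_convergence.
    - move=> n'; apply: measurable_funM => //; apply: measurable_sum => c.
      by apply: measurable_funM => //; apply: measurable_indic; exact: measurable_iscnt.
    - by apply: measurable_funM => //; exact: measurable_zpow.
    - move=> n' w; have /andP[x0 x1] := rest01 w.
      have /andP[y0 y1] := zpow_partial01 z01 (B i0) w n'.
      by rewrite mulr_ge0//= mulr_ile1.
    - by apply: aeW => w; apply: cvgMr; exact: zpow_series.
  have e n' : (\int[P]_w (rest w * \sum_(0 <= c < n') \1_(iscnt (B i0) c) w * z ^+ c)%:E)%E =
      (\sum_(0 <= c < n') a c * z ^+ c)%:E.
    transitivity (\int[P]_w (\sum_(0 <= c < n') ((z ^+ c)%:E * (rest w * \1_(iscnt (B i0) c) w)%:E)))%E.
      apply: eq_integral => w _; rewrite mulr_sumr -sumEFin; apply: eq_bigr => c _.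
      by rewrite -EFinM; congr EFin; lra.
    have h0 c w : 0 <= rest w * \1_(iscnt (B i0) c) w.
      by have /andP[x0 x1] := rest01 w; rewrite mulr_ge0.
    have hm c : measurable_fun setT (fun w => (rest w * \1_(iscnt (B i0) c) w)%:E).
      apply/measurable_EFinP; apply: measurable_funM => //.
      by apply: measurable_indic; exact: measurable_iscnt.
    have zc c : 0 <= z ^+ c by rewrite exprn_ge0// ltW.
    rewrite ge0_integral_sum//; last 2 first.
    - by move=> c; apply: emeasurable_funM.
    - by move=> c w _; rewrite mule_ge0// lee_fin.
    rewrite -sumEFin; apply: eq_bigr => c _.
    rewrite ge0_integralZl//; last by rewrite lee_fin.
    by have [-> _] := ia c; rewrite -EFinM mulrC.
    by move=> w _; rewrite lee_fin.
  have cv2 : (\sum_(0 <= c < n) a c * z ^+ c)%:E @[n --> \oo] -->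
      (A * expR (- ((1 - z) * lam i0)))%:E.
    by rewrite -hz; under eq_fun do rewrite -e; exact: cv.
  by move/fine_cvg : cv2.
rewrite kupd upde /=; under eq_integral do rewrite updf.
by have [-> _] := ia c0; rewrite ab.
Qed.

Lemma counts_poisson (c : 'I_r -> nat) :
  P (\bigcap_(i in [set: 'I_r]) iscnt (B i) (c i)) =
  (\prod_(i < r) poisson_prob (fine (lebesgue_measure (B i))) 0 [set c i])%E.
Proof.
have h := expectation_kinds (kappa := fun i => inl (c i)) (fun=> I) erefl.
under eq_bigr do rewrite poisson_prob_set1 ?lam0//.
rewrite prodEFin -h.
have mC : measurable (\bigcap_(i in [set: 'I_r]) iscnt (B i) (c i)).
  by apply: fin_bigcap_measurable => // i _; exact: measurable_iscnt.
have := @integral_indic _ T R P setT measurableT _ mC.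
rewrite setIT => <-; apply: eq_integral => w _; congr EFin; rewrite /= indicE.
have [wC|wC] := boolP (w \in _).
  by rewrite big1// => i _; rewrite indicE mem_set//; move: wC; rewrite inE; exact.
have [i Hi] : exists i, ~ iscnt (B i) (c i) w.
  apply: contrapT => /forallNP H; move: wC; rewrite notin_setE; apply => i _.
  exact: contrapT.
by rewrite (bigD1 i)//= indicE memNset ?mul0r.
Qed.

End joint.
End counts.

(** * Existence of the weights and of the marks *)

Section existence.
Context {R : realType}.
Local Notation U := (@U01 R).

Lemma salgebra_preimage_measurable (T : pointedType) (G : set (set T)) d'
    (T' : measurableType d') (f : T -> T') :
  measurable_fun setT (f : g_sigma_algebraType G -> T') ->
  preimage_set_system setT f measurable `<=` <<s G >>.
Proof. by move=> mf _ [A mA <-]; exact: mf. Qed.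

(** The Laplace functional is exported along with the law because thinning the rows by marks is
    computed from it. *)
Lemma pwit_exists : exists X : vertex -> {RV U >-> R}, PWIT_weights X /\
  forall v, laplace_poisson U (fun k => X (k :: v)).
Proof.
have [u [mu u01 u_law u_ind]] := @iid_uniform_sequence R.
have [s [ms s_law]] := @poisson1_sampler R.
(* One independent uniform variable for each vertex, each unit interval and each index in that
   interval. *)
pose code (v : vertex) (p : nat * nat) : nat := pickle (v, p).
have codeI v p v' p' : code v p = code v' p' -> (v, p) = (v', p').
  exact: (pcan_inj pickleK).
pose zeta v l a w := u (code v (l, a)) w.
have mz v l a : measurable_fun setT (zeta v l a) := mu _.
have z01 v l a w : 0 < zeta v l a w < 1 := u01 _ _.
have z_law v l a A : measurable A -> U (zeta v l a @^-1` A) = U A := u_law _ A.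
have z_ind v : independent U setT
    (fun p : nat * nat => preimage_set_system setT (zeta v p.1 p.2) measurable).
  have := @independent_inj _ _ _ U _ _ (code v) setT
    (fun i => preimage_set_system setT (u i) measurable) _ u_ind.
  rewrite preimage_setT => H.
  have {}H := H (fun p p' e => congr1 snd (codeI _ _ _ _ e)).
  by move=> sq A us h; apply: H => // -[l a]; exact: h.
pose row v k := rowX (fun l w => s (zeta v l 0%N w)) (fun l a => zeta v l a.+1) k.
have mrow v k : measurable_fun setT (row v k).
  apply: measurable_rowX => [l|l a]; last exact: mz.
  by move=> _ A _; rewrite setTI; exact: (measurable_preT (mz v l 0%N) (ms A)).
pose Xf (v : vertex) : R -> R := if v is k :: v' then row v' k else fun=> 0.
have mX v : measurable_fun setT (Xf v) by case: v => [|k v] //=; exact: measurable_cst.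
pose X v : {RV U >-> R} := mkRV U (mX v).
exists X; split; last first.
  move=> v r c B c0 mB B0 Bfin psi1.
  exact: (laplace_rowX (mz v) (z_law v) (z_ind v) ms s_law c0 mB B0 Bfin psi1).
split.
  move=> v; split.
    have := row_good_ae (mz v) (z_law v) (z_ind v) ms s_law.
    apply: filterS => w gw.
    by have := rowX_gt0_incr (fun l a w => z01 v l a.+1 w) gw.
  move=> r B c hB tB.
  apply: (@counts_poisson _ _ _ U (row v) (mrow v) _ r B) => //.
  - move=> r' c' B' c0 mB B0 Bfin psi1.
    exact: (laplace_rowX (mz v) (z_law v) (z_ind v) ms s_law c0 mB B0 Bfin psi1).
  - by move=> i; have [] := hB i.
  - by move=> i; have [] := hB i.
  - by move=> i; have [] := hB i.
pose D v := [set m | exists p, m = code v p].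
pose F m := preimage_set_system setT (u m) measurable.
pose G v := \bigcup_(m in D v) F m.
apply: (@independent_sub _ _ _ U _ setT setT (fun v => <<s G v >>)) => //; last first.
  have := @independent_groups _ _ _ U _ _ F D setT; apply => //.
    move=> m _; split.
    - by move=> _ [A mA <-]; exact: mu.
    - by move=> _ _ [A mA <-] [A' mA' <-]; exists (A `&` A'); [exact: measurableI|rewrite !setTI].
    - by exists setT => //; rewrite setTI.
  by move=> m v v' [p ->] [p' /codeI[]].
move=> v _; apply: smallest_sub; first exact: smallest_sigma_algebra.
move=> A [_ [k _ <-]].
apply: (@salgebra_preimage_measurable R (G v) _ R (row v k)).
have mzG l a : measurable_fun setT (zeta v l a : g_sigma_algebraType (G v) -> R).
  move=> _ B mB; rewrite setTI; apply: sub_sigma_algebra.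
  by exists (code v (l, a)); [exists (l, a)|exists B => //; rewrite setTI].
apply: measurable_rowX => [l|l a]; last exact: mzG.
by move=> _ B _; rewrite setTI; exact: (measurable_preT (mzG l 0%N) (ms B)).
Qed.

(** Inversion, [- ln u] with [u] uniform. Positivity holds at every point, not only almost surely,
    because [u] stays strictly between 0 and 1. *)
Lemma exp_edges_exist (V : finType) : exists E : {set V} -> {RV U >-> R},
  [/\ iid_exp1_edges E, forall e w, 0 < E e w &
      forall e t, 0 <= t -> U [set w | t <= E e w] = (expR (- t))%:E].
Proof.
have [u [mu u01 u_law u_ind]] := @iid_uniform_sequence R.
pose Ef (e : {set V}) w : R := - ln (u (pickle e) w).
have mE e : measurable_fun setT (Ef e).
  apply: measurable_funN; apply: measurableT_comp (mu _); exact: measurable_ln.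
exists (fun e => mkRV U (mE e)); split; last first.
  move=> e t t0; rewrite [X in U X](_ : _ = u (pickle e) @^-1` `]-oo, expR (- t)]%classic).
    rewrite u_law// -[X in U X]setCitvr probability_setC// U01_ray.
      by rewrite -EFinB; congr EFin; lra.
    by rewrite expR_ge0/= -expR0 ler_expR oppr_le0.
  apply/seteqP; split => w /=; rewrite in_itv/= /Ef => h; have /andP[u0 u1] := u01 (pickle e) w.
    by rewrite -(@lnK _ (u (pickle e) w)) ?posrE// ler_expR lerNr.
  by rewrite lerNr -ler_expR lnK.
  by move=> e w; rewrite /= /Ef oppr_gt0; have /andP[u0 u1] := u01 (pickle e) w; rewrite ln_lt0// u0.
split.
  have h := @independent_inj _ _ _ U _ _ (@pickle {set V}) setT
    (fun i => preimage_set_system setT (u i) measurable) (pcan_inj pickleK) u_ind.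
  apply: independent_sub h => // e Ee; apply: smallest_sub.
    exact/sigma_algebra_preimage/sigma_algebra_measurable.
  move=> A [_ -> [B mB <-]]; exists ((fun x => - ln x) @^-1` B).
    apply: measurable_preT mB; apply: measurable_funN; exact: measurable_ln.
  by [].
move=> e Ee B mB.
have mexp : measurable_fun setT (fun x : R => expR (- x)).
  by apply: measurableT_comp => //; exact: measurable_funN.
have mEe := mE e.
have tail t : U (Ef e @^-1` `]t, +oo[%classic) = if t <= 0 then 1%E else (expR (- t))%:E.
  have -> : Ef e @^-1` `]t, +oo[%classic = u (pickle e) @^-1` `]-oo, expR (- t)[%classic.
    apply/seteqP; split => w /=; rewrite !in_itv/= andbT /Ef => h;
      have /andP[u0 u1] := u01 (pickle e) w.
      by rewrite -(@lnK _ (u (pickle e) w)) ?posrE// ltr_expR ltrNr.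
    by rewrite ltrNr -ltr_expR lnK.
  rewrite u_law//.
  have -> : `]-oo, expR (- t)[%classic = ~` `[expR (- t), +oo[%classic.
    by rewrite setCitvr.
  rewrite probability_setC//; case: ifPn => t0.
    by rewrite U01_ray1 ?sube0// -expR0 ler_expR oppr_ge0.
  rewrite -ltNge in t0; rewrite U01_ray.
    by rewrite -EFinB; congr EFin; lra.
  by rewrite expR_ge0/= -expR0 ler_expR oppr_le0 ltW.
pose m2 : probability R R := toR
  (@exponential_distribution_exponential_prob__canonical__probability_measure_Probability R 1 ltr01).
change (distribution U (mkRV U mEe) B = m2 B).
apply: ray_measure_unique mB => t; rewrite [LHS]tail.
have m2neg : m2 `]-oo, 0[%classic = 0%E.
  rewrite /m2/= /distribution/= /pushforward/= /exponential_prob integral0_eq// => x /=.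
  by rewrite in_itv/= => x0; rewrite lt0_exponential_pdf.
have m2itv (x : R) : 0 < x -> m2 `[0, x]%classic = (1 - expR (- x))%:E.
  move=> x0; have := exponential_prob_itv0c 1 x0; rewrite mulN1r EFinB => <-.
  by [].
(* No atom at 0: the mass of [0, x] is [1 - expR (- x)], at most [x]. *)
have m20 : m2 [set 0] = 0%E.
  apply/eqP; rewrite -measure_le0; apply/lee_addgt0Pr => x x0; rewrite add0e.
  apply: (@le_trans _ _ (m2 `[0, x]%classic)).
    by apply: prob_le => // y /= ->; rewrite in_itv/= lexx ltW.
  by rewrite m2itv// lee_fin; have := expR_ge1Dx (- x); lra.
have full : m2 `]0, +oo[%classic = 1%E.
  have -> : `]0, +oo[%classic = ~` (`]-oo, 0[ `|` [set 0]) :> set R.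
    apply/seteqP; split => x /=; rewrite !in_itv/= andbT.
      by move=> x0 [|ex]; [lra|move: x0; rewrite ex ltxx].
    move=> /not_orP[/negP h /eqP ne]; rewrite lt_neqAle eq_sym ne /=.
    by rewrite leNgt.
  rewrite probability_setC; last exact: measurableU.
  rewrite measU//; first by rewrite [X in (_ - (X + _))%E]m2neg [X in (_ - (_ + X))%E]m20 adde0 sube0.
  by move=> x [/=]; rewrite in_itv/= => /[swap] ->; rewrite ltxx.
case: ifPn => t0.
  rewrite -(probability_setT m2).
  have := @prob_eq_on _ _ _ m2 `]0, +oo[%classic setT `]t, +oo[%classic; apply => //.
  rewrite setTI; apply/seteqP; split => x; rewrite /= !in_itv/= !andbT; last by case.
  by move=> x0; split=> //; lra.
rewrite -ltNge in t0.
have -> : `]t, +oo[%classic = ~` `]-oo, t]%classic by rewrite setCitvl.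
rewrite probability_setC//.
have -> : m2 `]-oo, t]%classic = m2 `[0, t]%classic.
  have := @prob_eq_on _ _ _ m2 `]0, +oo[%classic `]-oo, t]%classic `[0, t]%classic; apply => //.
  apply/seteqP; split => x; rewrite /= !in_itv/= !andbT.
    by move=> [xt x0]; rewrite xt x0 (ltW x0).
  by move=> [/andP[_ xt] x0]; rewrite xt x0.
by rewrite m2itv// -EFinB; congr EFin; lra.
Qed.

Lemma uniform_marks_exist N : exists M : vertex -> R -> 'I_N.+1,
  iid_uniform_marks U (ord0 : 'I_N.+1) M.
Proof.
have [u [mu u01 u_law u_ind]] := @iid_uniform_sequence R.
have [s [ms s_law]] := @uniform_sampler R N.
pose M (v : vertex) w : 'I_N.+1 := if v is [::] then ord0 else s (u (pickle v) w).
have MS (v : vertex) w : nonroot v -> M v w = s (u (pickle v) w) by case: v.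
have MSpre (v : vertex) A : nonroot v -> M v @^-1` A = u (pickle v) @^-1` (s @^-1` A).
  by case: v.
exists M; split => //.
- move=> [|k v] i.
    by rewrite (_ : M [::] = cst ord0)// preimage_cst; case: ifP.
  exact: (measurable_preT (mu _) (ms [set i])).
- move=> v nv i; rewrite MSpre// u_law; last exact: ms.
  by rewrite s_law card_ord.
- have h := @independent_inj _ _ _ U _ _ (@pickle vertex) setT
    (fun i => preimage_set_system setT (u i) measurable) (pcan_inj pickleK) u_ind.
  apply: independent_sub h => // v nv; apply: smallest_sub.
    exact/sigma_algebra_preimage/sigma_algebra_measurable.
  move=> A [_ -> [B _ <-]]; exists (s @^-1` B); first exact: ms.
  by rewrite MSpre.
Qed.

End existence.

(** * Gluing two probability spaces *)

Section glue.
Context {R : realType} {d1 d2 : measure_display}.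
Context {T1 : measurableType d1} {T2 : measurableType d2}.
Context (P1 : probability T1 R) (P2 : probability T2 R).

Lemma weighted_restrictions d (T : measurableType d) (m : {measure set T -> \bar R})
    (I : Type) (s : seq I) (c : I -> R) (D : I -> set T) :
  (forall i, 0 <= c i) -> (forall i, measurable (D i)) ->
  exists Q : {measure set T -> \bar R},
    forall S, Q S = (\sum_(i <- s) (c i)%:E * m (S `&` D i))%E.
Proof.
move=> c0 mD; elim: s => [|i s [Q hQ]].
  by exists mzero => S; rewrite big_nil.
exists (measure_add (mscale (NngNum (c0 i)) (mrestr m (mD i))) Q) => S.
by rewrite [LHS]measure_addE big_cons -hQ.
Qed.

Lemma partition_measure d (T : measurableType d) (P : probability T R)
    (J : finType) (A : J -> set T) (S : set T) :
  (forall a, measurable (A a)) -> (forall a b w, A a w -> A b w -> a = b) ->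
  (forall w, exists a, A a w) -> measurable S ->
  P S = (\sum_a P (S `&` A a))%E.
Proof.
move=> mA tA cA mS.
rewrite -(@measure_fin_partition _ _ _ P J xpredT (fun a => S `&` A a)).
- congr (P _); apply/seteqP; split => w; last by move=> [a _ []].
  by move=> Sw; have [a Aa] := cA w; exists a.
- by move=> a _; exact: measurableI.
- by move=> a b w [_ Aa] [_ Ab]; exact: tA Aa Ab.
Qed.

Section partitions.
Variables (J : finType) (A : J -> set T1) (B : J -> set T2) (pi : J -> J -> R).
Hypothesis mA : forall a, measurable (A a).
Hypothesis mB : forall a, measurable (B a).
Hypothesis tA : forall a b w, A a w -> A b w -> a = b.
Hypothesis tB : forall a b w, B a w -> B b w -> a = b.
Hypothesis cA : forall w, exists a, A a w.
Hypothesis cB : forall w, exists a, B a w.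
Hypothesis pi0 : forall a b, 0 <= pi a b.
Let mu a := fine (P1 (A a)).
Let nu b := fine (P2 (B b)).
Hypothesis pimu : forall a, \sum_b pi a b = mu a.
Hypothesis pinu : forall b, \sum_a pi a b = nu b.

Let muE a : P1 (A a) = (mu a)%:E. Proof. by rewrite fineK// prob_fin. Qed.
Let nuE a : P2 (B a) = (nu a)%:E. Proof. by rewrite fineK// prob_fin. Qed.

Let mu0 a b : mu a = 0 -> pi a b = 0.
Proof. by rewrite -pimu => /eqP; rewrite psumr_eq0// => /allP/(_ b)/(_ (mem_index_enum _))/eqP. Qed.

Let nu0 a b : nu b = 0 -> pi a b = 0.
Proof. by rewrite -pinu => /eqP; rewrite psumr_eq0// => /allP/(_ a)/(_ (mem_index_enum _))/eqP. Qed.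

(** Density of the glued law with respect to the product measure on a pair of cells. If a cell is
    null the quotient is 0, harmlessly, since [pi] vanishes there. *)
Let kappa (p : J * J) := pi p.1 p.2 / (mu p.1 * nu p.2).

(* Independent given the cells, whose joint law is [pi]. *)
Lemma glue_partitions : exists Q : probability (T1 * T2)%type R,
  [/\ forall S, measurable S -> Q (S `*` setT) = P1 S,
      forall S, measurable S -> Q (setT `*` S) = P2 S &
      forall a, Q (A a `*` B a) = (pi a a)%:E].
Proof.
have kappa0 p : 0 <= kappa p by rewrite divr_ge0// mulr_ge0// fine_ge0.
have mR (p : J * J) : measurable (A p.1 `*` B p.2) by exact: measurableX.
have [Q QE] := weighted_restrictions (P1 \x P2)%E (index_enum (J * J)%type) kappa0 mR.
have QX S S' : measurable S -> measurable S' -> Q (S `*` S') =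
    (\sum_a \sum_b kappa (a, b) * (fine (P1 (S `&` A a)) * fine (P2 (S' `&` B b))))%:E.
  move=> mS mS'; rewrite QE.
  transitivity (\sum_(p : J * J) (kappa p *
      (fine (P1 (S `&` A p.1)) * fine (P2 (S' `&` B p.2))))%:E)%E.
    apply: eq_bigr => p _; rewrite [RHS]EFinM; congr (_ * _)%E.
    rewrite -setXI [LHS]product_measure1E; [|exact: measurableI|exact: measurableI].
    by rewrite EFinM !fineK// prob_fin//; exact: measurableI.
  rewrite sumEFin; congr EFin; rewrite pair_bigA /=.
  by apply: eq_bigr => -[a b].
have P1E S : measurable S -> P1 S = (\sum_a fine (P1 (S `&` A a)))%:E.
  move=> mS; rewrite (partition_measure P1 mA tA cA mS) -sumEFin.
  by apply: eq_bigr => a _; rewrite fineK// prob_fin//; exact: measurableI.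
have P2E S : measurable S -> P2 S = (\sum_a fine (P2 (S `&` B a)))%:E.
  move=> mS; rewrite (partition_measure P2 mB tB cB mS) -sumEFin.
  by apply: eq_bigr => a _; rewrite fineK// prob_fin//; exact: measurableI.
have sub1 S a : measurable S -> mu a = 0 -> fine (P1 (S `&` A a)) = 0.
  move=> mS e; have : (P1 (S `&` A a) <= P1 (A a))%E.
    by apply: prob_le => //; exact: measurableI.
  by rewrite muE e measure_le0 => /eqP ->.
have sub2 S a : measurable S -> nu a = 0 -> fine (P2 (S `&` B a)) = 0.
  move=> mS e; have : (P2 (S `&` B a) <= P2 (B a))%E.
    by apply: prob_le => //; exact: measurableI.
  by rewrite nuE e measure_le0 => /eqP ->.
have Q1 S : measurable S -> Q (S `*` setT) = P1 S.
  move=> mS; rewrite QX// P1E//; congr EFin; apply: eq_bigr => a _.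
  have [e|ne] := eqVneq (mu a) 0.
    by rewrite sub1// big1// => b _; rewrite mul0r mulr0.
  transitivity (\sum_b pi a b * (fine (P1 (S `&` A a)) / mu a)).
    apply: eq_bigr => b _; rewrite setTI -/(nu b) /kappa /=.
    have [e|nb] := eqVneq (nu b) 0; first by rewrite (nu0 a e) !mul0r.
    by field; rewrite ne nb.
  by rewrite -mulr_suml pimu; field.
have Q2 S : measurable S -> Q (setT `*` S) = P2 S.
  move=> mS; rewrite QX// P2E// exchange_big /=; congr EFin; apply: eq_bigr => b _.
  have [e|ne] := eqVneq (nu b) 0.
    by rewrite sub2// big1// => a _; rewrite !mulr0.
  transitivity (\sum_a pi a b * (fine (P2 (S `&` B b)) / nu b)).
    apply: eq_bigr => a _; rewrite setTI -/(mu a) /kappa /=.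
    have [e|nb] := eqVneq (mu a) 0; first by rewrite (mu0 b e) !mul0r.
    by field; rewrite ne nb.
  by rewrite -mulr_suml pinu; field.
have QT : Q setT = 1%E by rewrite -setXTT Q1// probability_setT.
pose Q' : probability (T1 * T2)%type R := mnormalize Q (P1 \x P2)%E.
have Q'E S : Q' S = Q S.
  by rewrite /Q'/= /mnormalize QT onee_eq0/= invr1 mule1.
exists Q'; split=> [S mS|S mS|a]; rewrite [LHS]Q'E; [exact: Q1|exact: Q2|].
rewrite QX// (bigD1 a)//= [X in _ + X]big1 ?addr0; last first.
  move=> b ne; apply: big1 => c _.
  rewrite (_ : A a `&` A b = set0) ?measure0 ?mul0r ?mulr0//.
  by rewrite -subset0 => w [/tA h /h e]; move: ne; rewrite e eqxx.
rewrite (bigD1 a)//= [X in _ + X]big1 ?addr0; last first.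
  move=> b ne; rewrite (_ : B a `&` B b = set0) ?measure0 ?mulr0//.
  by rewrite -subset0 => w [/tB h /h e]; move: ne; rewrite e eqxx.
rewrite !setIid -/(mu a) -/(nu a) /kappa/=; congr EFin.
have [e|ne] := eqVneq (mu a) 0; first by rewrite (mu0 a e) !mul0r.
have [e|nb] := eqVneq (nu a) 0; first by rewrite (nu0 a e) !mul0r.
by field; rewrite ne nb.
Qed.
End partitions.

Lemma big_option_sum (I : finType) (F : option I -> R) :
  \sum_x F x = F None + \sum_i F (Some i).
Proof.
rewrite (bigD1 None)//=; congr (_ + _).
rewrite (reindex_omap Some id)/=; last by case.
by apply: eq_bigl => i; rewrite eqxx.
Qed.

(** Domination leaves room to let each [B i] occur only together with [A i]; a cell [None] completes
    either family to a partition. *)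
Lemma glue_dominated (I : finType) (A : I -> set T1) (B : I -> set T2) :
  (forall i, measurable (A i)) -> (forall i, measurable (B i)) ->
  (forall i j w, A i w -> A j w -> i = j) ->
  (forall i j w, B i w -> B j w -> i = j) ->
  (forall i, (P2 (B i) <= P1 (A i))%E) ->
  exists Q : probability (T1 * T2)%type R,
  [/\ forall S, measurable S -> Q (S `*` setT) = P1 S,
      forall S, measurable S -> Q (setT `*` S) = P2 S &
      forall i, Q (A i `*` B i) = P2 (B i)].
Proof.
move=> mA mB tA tB le21.
pose ext d (T : measurableType d) (D : I -> set T) (o : option I) : set T :=
  if o is Some i then D i else [set w | forall i, ~ D i w].
have mext d (T : measurableType d) (D : I -> set T) o :
    (forall i, measurable (D i)) -> measurable (ext _ _ D o).
  move=> mD; case: o => [i|] //=.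
  rewrite (_ : [set w | _] = ~` \bigcup_(i in [set: I]) D i).
    by apply: measurableC; apply: fin_bigcup_measurable.
  apply/seteqP; split => w /=; first by move=> h [i _ /h].
  by move=> h i Di; apply: h; exists i.
have text d (T : measurableType d) (D : I -> set T) :
    (forall i j w, D i w -> D j w -> i = j) ->
    forall a b w, ext _ _ D a w -> ext _ _ D b w -> a = b.
  move=> tD [i|] [j|] w //=; first by move=> Di /(tD _ _ _ Di) ->.
    by move=> Di /(_ i).
  by move=> + Dj => /(_ j).
have cext d (T : measurableType d) (D : I -> set T) w : exists a, ext _ _ D a w.
  have [[i Di]|/forallNP h] := pselect (exists i, D i w); first by exists (Some i).
  by exists None.
pose mu i := fine (P1 (A i)); pose nu i := fine (P2 (B i)).
pose m0 := fine (P1 (ext _ _ A None)).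
have numu i : nu i <= mu i by rewrite fine_le ?prob_fin.
(* All the mass of [B i] is paired with [A i]; the excess of [A i], like the complement of the
   [A]'s, is paired with the complement of the [B]'s. *)
pose pi (a b : option I) : R := match a, b with
  | Some i, Some j => if i == j then nu i else 0
  | Some i, None => mu i - nu i
  | None, None => m0 | None, Some _ => 0 end.
have tot d (T : measurableType d) (P : probability T R) (D : I -> set T) :
    (forall i, measurable (D i)) -> (forall i j w, D i w -> D j w -> i = j) ->
    fine (P (ext _ _ D None)) + \sum_i fine (P (D i)) = 1.
  move=> mD tD; have := partition_measure P (fun a => mext _ _ D a mD) (text _ _ D tD)
    (cext _ _ D) measurableT.
  rewrite [LHS]probability_setT.
  under eq_bigr do rewrite setTI.
  rewrite (eq_bigr (fun a => (fine (P (ext _ _ D a)))%:E)); last first.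
    by move=> a _; rewrite fineK// prob_fin//; exact: mext.
  by rewrite sumEFin big_option_sum => -[].
have totA := tot _ _ P1 A mA tA; have totB := tot _ _ P2 B mB tB.
have [|||Q [Q1 Q2 Q3]] := @glue_partitions _ (ext _ _ A) (ext _ _ B) pi
  (fun a => mext _ _ A a mA) (fun a => mext _ _ B a mB)
  (text _ _ A tA) (text _ _ B tB) (cext _ _ A) (cext _ _ B).
- move=> [i|] [j|] //=; rewrite ?subr_ge0 ?fine_ge0//.
  by case: ifP => // _; rewrite fine_ge0.
- move=> [i|]; rewrite big_option_sum /=; last by rewrite big1 ?addr0.
  rewrite (bigD1 i)//= eqxx big1 ?addr0 ?subrK// => j /negbTE ji.
  by rewrite eq_sym ji.
- move=> [j|]; rewrite big_option_sum /=.
    rewrite add0r (bigD1 j)//= eqxx big1 ?addr0// => i /negbTE ji.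
    by rewrite ji.
  rewrite sumrB; rewrite -/m0 -/mu -/nu in totA totB *.
  (* The column [None] has the right sum because both partitions have total mass 1. *)
  have : m0 + \sum_i mu i = fine (P2 (ext _ _ B None)) + \sum_i nu i by rewrite totA totB.
  by rewrite /= => h; lra.
exists Q; split => // i; have := Q3 (Some i) => /= ->.
by rewrite eqxx /nu fineK// prob_fin.
Qed.

End glue.

Lemma sigma_of_marks_measurable d (T : measurableType d) (V : finType) (I : Type)
    (D : set I) (M : I -> T -> V) :
  (forall v i, measurable (M v @^-1` [set i])) -> sigma_of setT D M `<=` measurable.
Proof.
move=> mM; apply: smallest_sub; first exact: sigma_algebra_measurable.
move=> _ [v _ [A _ <-]]; rewrite setTI.
have -> : M v @^-1` A = \bigcup_(i in A) (M v @^-1` [set i]).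
  by apply/seteqP; split => w /=; [move=> ?; exists (M v w)|move=> [i Ai /= ->]].
by apply: fin_bigcup_measurable.
Qed.

(** * Laws carried along a measure-preserving map *)

Section transfer.
Context {R : realType} {d d' : measure_display}.
Context {T : measurableType d} {T' : measurableType d'}.
Context (P : probability T R) (P' : probability T' R) (phi : T -> T').
Hypothesis mphi : measurable_fun setT phi.
Hypothesis pres : forall S, measurable S -> P (phi @^-1` S) = P' S.

Definition pullRV (X : {RV P' >-> R}) : {RV P >-> R} :=
  mkRV P (measurableT_comp (measurable_funPT X) mphi).

Lemma independent_transfer (I : eqType) (D : set I) (F : I -> set (set T'))
    (F' : I -> set (set T)) :
  (forall i, D i -> F i `<=` measurable) ->
  (forall i, D i -> F' i `<=` [set phi @^-1` A | A in F i]) ->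
  independent P' D F -> independent P D F'.
Proof.
move=> mF FF ind s A us H.
have /choice[B hB] i : exists B, i \in s -> [/\ D i, F i B & A i = phi @^-1` B].
  have [si|si] := boolP (i \in s); last by exists set0.
  by have [Di /(FF _ Di)[B FB <-]] := H i si; exists B.
have -> : \bigcap_(i in [set` s]) A i = phi @^-1` (\bigcap_(i in [set` s]) B i).
  rewrite preimage_bigcap; apply: eq_bigcapr => i /= si.
  by have [_ _ ->] := hB i si.
rewrite pres; last first.
  by apply: measurable_capl => i /hB[Di FB _]; exact: mF FB.
rewrite ind//; last by move=> i /hB[].
apply: eq_big_seq => i /hB[Di FB ->]; rewrite pres//; exact: mF FB.
Qed.

Lemma sigma_of_comp (V I : Type) (G : set (set V)) (D : set I) (X : I -> T' -> V)
    (Y : I -> T -> V) : (forall i w, Y i w = X i (phi w)) ->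
  sigma_of G D Y `<=` [set phi @^-1` A | A in sigma_of G D X].
Proof.
move=> YX; apply: smallest_sub.
  have := @sigma_algebra_preimage T T' (sigma_of G D X) setT phi.
  have -> : preimage_set_system setT phi (sigma_of G D X) =
     [set phi @^-1` A | A in sigma_of G D X].
    by apply: eq_imagel => A _; rewrite setTI.
  by apply; exact: smallest_sigma_algebra.
move=> _ [i Di [A GA <-]]; exists (X i @^-1` A).
  by apply: sub_sigma_algebra; exists i => //; exists A => //; rewrite setTI.
by rewrite setTI; apply/seteqP; split => w /=; rewrite YX.
Qed.

Lemma sigma_of_measurable (I : Type) (D : set I) (X : I -> {RV P' >-> R}) :
  sigma_of measurable D X `<=` measurable.
Proof.
apply: smallest_sub; first exact: sigma_algebra_measurable.
by move=> _ [i _ [A mA <-]]; apply: measurable_funPT.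
Qed.

Lemma ae_transfer (Q : set T') : {ae P', forall w, Q w} -> {ae P, forall w, Q (phi w)}.
Proof.
move=> [N [mN N0 sub]]; exists (phi @^-1` N); split.
- exact: measurable_preT.
- by rewrite [LHS]pres.
- by move=> w /= h; apply: sub.
Qed.

Lemma iid_exp1_edges_transfer (V : finType) (E : {set V} -> {RV P' >-> R}) :
  iid_exp1_edges E -> iid_exp1_edges (fun e => pullRV (E e)).
Proof.
move=> [ind law]; split.
  apply: independent_transfer ind => e _; first exact: sigma_of_measurable.
  exact: sigma_of_comp.
move=> e Ee B mB; rewrite -(law e Ee B mB); apply: (pres (S := E e @^-1` B)).
exact: measurable_preT (measurable_funPT _) mB.
Qed.

(** The counting events must be known to be measurable because [pres] speaks of measurable sets
    only. *)
Lemma PWIT_transfer (X : vertex -> {RV P' >-> R}) :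
  (forall v, forall (r : nat) (B : 'I_r -> set R) (c : 'I_r -> nat),
     (forall i, measurable (B i)) ->
     measurable (\bigcap_(i in [set: 'I_r]) [set w | ([set k | B i (X (k :: v) w)] #= `I_(c i))%card])) ->
  PWIT_weights X -> PWIT_weights (fun v => pullRV (X v)).
Proof.
move=> mC [ppp ind]; split; last first.
  apply: independent_transfer ind => v _; first exact: sigma_of_measurable.
  exact: sigma_of_comp.
move=> v; have [ae cnt] := ppp v; split; first exact: ae_transfer ae.
move=> r B c hB tB; rewrite -(cnt r B c hB tB) -pres//.
by apply: mC => i; have [] := hB i.
Qed.

Lemma marks_transfer (V : finType) (o : V) (M : vertex -> T' -> V) :
  iid_uniform_marks P' o M -> iid_uniform_marks P o (fun v => M v \o phi).
Proof.
move=> [M0 mM lM ind]; split.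
- by move=> w; exact: M0.
- by move=> v i; exact: measurable_preT mphi (mM v i).
- by move=> v nv i; rewrite comp_preimage pres//; exact: lM.
- apply: independent_transfer ind => v _; last exact: sigma_of_comp.
  exact: sigma_of_marks_measurable.
Qed.

End transfer.

Section glued.
Context {R : realType} (N : nat).
Local Notation U := (@U01 R).
Local Notation V := 'I_N.+1.
Variables (E : {set V} -> {RV U >-> R}) (X : vertex -> {RV U >-> R}) (M : vertex -> R -> V).
Hypothesis hE : iid_exp1_edges E.
Hypothesis hX : PWIT_weights X.
Hypothesis hM : iid_uniform_marks U (ord0 : V) M.
Variable Q : probability (R * (R * R))%type R.
Hypothesis Q1 : forall S, measurable S -> Q (S `*` setT) = U S.
Hypothesis Q2 : forall S, measurable S -> Q (setT `*` S) = (U \x U)%E S.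

Let m23 : measurable_fun setT (snd : R * (R * R) -> R * R) := measurable_snd.
Let m2 : measurable_fun setT (fun w : R * (R * R) => w.2.1) :=
  measurableT_comp measurable_fst m23.
Let m3 : measurable_fun setT (fun w : R * (R * R) => w.2.2) :=
  measurableT_comp measurable_snd m23.

Let pres1 S : measurable S -> Q (fst @^-1` S) = U S.
Proof. by move=> mS; rewrite -Q1// -setXT. Qed.

Let pres23 S : measurable S -> Q (snd @^-1` S) = (U \x U)%E S.
Proof. by move=> mS; rewrite -Q2// -setTX. Qed.

Let pres2 S : measurable S -> Q ((fun w => w.2.1) @^-1` S) = U S.
Proof.
move=> mS; have -> : (fun w : R * (R * R) => w.2.1) @^-1` S = snd @^-1` (S `*` setT).
  by apply/seteqP; split => w //= [].
rewrite pres23; last exact: measurableX.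
by rewrite product_measure1E// [X in (_ * X)%E](probability_setT U) mule1.
Qed.

Let pres3 S : measurable S -> Q ((fun w => w.2.2) @^-1` S) = U S.
Proof.
move=> mS; have -> : (fun w : R * (R * R) => w.2.2) @^-1` S = snd @^-1` (setT `*` S).
  by apply/seteqP; split => w //= [].
rewrite pres23; last exact: measurableX.
by rewrite product_measure1E// [X in (X * _)%E](probability_setT U) mul1e.
Qed.

Let gE : iid_exp1_edges (fun e => pullRV Q measurable_fst (E e)).
Proof. exact: iid_exp1_edges_transfer. Qed.

Let gX : PWIT_weights (fun v => pullRV Q m2 (X v)).
Proof.
apply: PWIT_transfer => // v r B c mB.
apply: fin_bigcap_measurable => // i _.
exact: (@measurable_iscnt R _ _ (fun k => X (k :: v)) (fun k => measurable_funPT (X (k :: v))) (B i) (c i) (mB i)).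
Qed.

Let gM : iid_uniform_marks Q (ord0 : V) (fun v => M v \o (fun w => w.2.2)).
Proof. exact: (marks_transfer m3 pres3 hM). Qed.

Let gMX : marks_indep_weights (fun v => pullRV Q m2 (X v)) (fun v => M v \o (fun w => w.2.2)).
Proof.
move=> A B sA sB.
have [A' sA' <-] := sigma_of_comp (phi := fun w => w.2.1) (X := fun v => X v) (fun _ _ => erefl) sA.
have [B' sB' <-] := sigma_of_comp (phi := fun w => w.2.2) (X := M) (fun _ _ => erefl) sB.
have mA' : measurable A' := sigma_of_measurable sA'.
have mB' : measurable B'.
  by have [_ mM _ _] := hM; exact: (sigma_of_marks_measurable mM sB').
rewrite pres2// pres3//.
have -> : (fun w : R * (R * R) => w.2.1) @^-1` A' `&` (fun w => w.2.2) @^-1` B' =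
   snd @^-1` (A' `*` B') by [].
rewrite pres23; last exact: measurableX.
exact: product_measure1E.
Qed.

(** The first coordinate carries the edge weights of K_n, the second the weights of the tree, the
    third the marks. [Q] is free except for its marginals; the product law of the last two keeps
    marks and weights independent. *)
Definition glued : coupling R (ord0 : V) := Coupling gE gX gM gMX.

End glued.

(** * Measurability of the coupling event *)

Lemma card_set_seq (F : choiceType) (s : seq F) : uniq s -> ([set` s] #= `I_(size s))%card.
Proof.
elim: s => [_|x s IH /= /andP[xs us]].
  by rewrite set_nil II0.
apply/eq_cardSP; exists x; first by rewrite /= inE eqxx.
rewrite (_ : _ `\ _ = [set` s]); first exact: IH.
apply/seteqP; split => y /=; rewrite inE.
  by move=> [/orP[/eqP->|//]].
by move=> ys; rewrite ys orbT; split => // yx; move: xs; rewrite -yx ys.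
Qed.

Section measurable_props.
Context {d : measure_display} {T : measurableType d}.
Implicit Types P Q : T -> Prop.
Local Notation mp P := (measurable [set w : T | P w]).

Lemma mprop_cst (P : Prop) : mp (fun=> P).
Proof.
have [p|p] := pselect P; [rewrite (_ : [set _ | _] = setT)//|rewrite (_ : [set _ | _] = set0)//];
  by apply/seteqP; split.
Qed.

Lemma mprop_not P : mp P -> mp (fun w => ~ P w).
Proof. exact: measurableC. Qed.

Lemma mprop_and P Q : mp P -> mp Q -> mp (fun w => P w /\ Q w).
Proof. exact: measurableI. Qed.

Lemma mprop_or P Q : mp P -> mp Q -> mp (fun w => P w \/ Q w).
Proof. exact: measurableU. Qed.

Lemma mprop_imply P Q : mp P -> mp Q -> mp (fun w => P w -> Q w).
Proof.
move=> mP mQ; rewrite (_ : [set _ | _] = [set w | ~ P w \/ Q w]).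
  by apply: mprop_or => //; exact: mprop_not.
apply/seteqP; split => w /=; first by move=> h; have [p|p] := pselect (P w); [right; exact: h|left].
by move=> [nP /nP//|q _].
Qed.

Lemma mprop_iff P Q : mp P -> mp Q -> mp (fun w => P w <-> Q w).
Proof. by move=> mP mQ; apply: mprop_and; exact: mprop_imply. Qed.

Lemma mprop_forall (J : countType) (P : J -> T -> Prop) :
  (forall i, mp (P i)) -> mp (fun w => forall i, P i w).
Proof.
move=> mP.
rewrite (_ : [set _ | _] = \bigcap_n [set w | if unpickle n is Some i then P i w else True]).
  apply: bigcapT_measurable => n; case: (unpickle n) => [i|]; first exact: mP.
  exact: mprop_cst.
apply/seteqP; split => w /=; first by move=> h n _ /=; case: (unpickle n).
by move=> h i; have := h (pickle i) I; rewrite /= pickleK.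
Qed.

Lemma mprop_exists (J : countType) (P : J -> T -> Prop) :
  (forall i, mp (P i)) -> mp (fun w => exists i, P i w).
Proof.
move=> mP; rewrite (_ : [set _ | _] = [set w | ~ forall i, ~ P i w]).
  by apply: mprop_not; apply: mprop_forall => i; exact: mprop_not.
by apply/seteqP; split => w /=; [move=> [i Pi] /(_ i)|move/existsNP => [i] /contrapT; exists i].
Qed.

Lemma mprop_le (R : realType) (f g : T -> R) :
  measurable_fun setT f -> measurable_fun setT g -> mp (fun w => f w <= g w).
Proof.
by move=> mf mg; have := measurable_fun_ler mf mg measurableT (Y := [set true]) I;
  rewrite setTI.
Qed.

Lemma mprop_eq (R : realType) (f g : T -> R) :
  measurable_fun setT f -> measurable_fun setT g -> mp (fun w => f w = g w).
Proof.
move=> mf mg; rewrite (_ : [set _ | _] = [set w | f w <= g w /\ g w <= f w]).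
  by apply: mprop_and; exact: mprop_le.
apply/seteqP; split => w /=; first by move=> ->.
by move=> [h1 h2]; apply/eqP; rewrite eq_le h1.
Qed.

Lemma mprop_card (F : finType) (Q : F -> T -> Prop) k :
  (forall e, mp (Q e)) -> mp (fun w => ([set e | Q e w] #= `I_k)%card).
Proof.
move=> mQ.
rewrite (_ : [set _ | _] =
    [set w | exists S : {set F}, #|S| = k /\ forall e, Q e w <-> e \in S]).
  apply: mprop_exists => S; apply: mprop_and; first exact: mprop_cst.
  by apply: mprop_forall => e; apply: mprop_iff => //; exact: mprop_cst.
have cardS (S : {set F}) : ([set` S] #= `I_#|S|)%card.
  rewrite (_ : [set` S] = [set` enum S]) 1?cardE; first exact/card_set_seq/enum_uniq.
  by apply/seteqP; split => x /=; rewrite mem_enum.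
apply/seteqP; split => w /=.
  move=> h; exists [set e | `[< Q e w >]]%SET; split; last first.
    by move=> e; rewrite inE; split => [/asboolP|/asboolP].
  apply/card_eq_II; apply: card_eq_trans h; rewrite card_eq_sym.
  rewrite [X in (X #= _)%card](_ : _ = [set` [set e | `[< Q e w >]]%SET]); first exact: cardS.
  by apply/seteqP; split => e /=; rewrite inE => /asboolP.
move=> [S [<- h]].
rewrite [X in (X #= _)%card](_ : _ = [set` S]); first exact: cardS.
by apply/seteqP; split => e /=; [move/h|move=> ?; apply/h].
Qed.

End measurable_props.

Section first_passage.
Context {R : realType} {V : finType}.
Implicit Types (Y : {set V} -> R) (i j o : V).

Lemma path_weight_ge0 Y i p : (forall e, 0 < Y e) -> 0 <= path_weight Y i p.
Proof. by move=> Y0; apply: sumr_ge0 => e _; exact: ltW. Qed.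

Lemma paths_nonempty o i : paths o i !=set0.
Proof.
have [->|ne] := eqVneq o i; first by exists [::].
by exists [:: i]; split => //=; rewrite inE ne.
Qed.

Lemma fp_dist_le Y o i p : (forall e, 0 < Y e) -> paths o i p ->
  fp_dist Y o i <= path_weight Y o p.
Proof.
move=> Y0 hp; apply: ge_inf; last by exists p.
by exists 0 => _ [q _ <-]; exact: path_weight_ge0.
Qed.

Lemma le_fp_dist Y o i t : (forall e, 0 < Y e) ->
  (t <= fp_dist Y o i <-> forall p, paths o i p -> t <= path_weight Y o p).
Proof.
move=> Y0; split=> [h p hp|h].
  exact: le_trans h (fp_dist_le Y0 hp).
apply: lb_le_inf; last by move=> _ [p hp <-]; exact: h.
by have [p hp] := paths_nonempty o i; exists (path_weight Y o p); exists p.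
Qed.

Lemma fp_dist_ge0 Y o i : (forall e, 0 < Y e) -> 0 <= fp_dist Y o i.
Proof. by move=> Y0; apply/le_fp_dist => // p _; exact: path_weight_ge0. Qed.

Lemma fp_distxx Y o : (forall e, 0 < Y e) -> fp_dist Y o o = 0.
Proof.
move=> Y0; apply/eqP; rewrite eq_le fp_dist_ge0// andbT.
have : paths o o [::] by [].
by move/(fp_dist_le Y0); rewrite /path_weight big_nil.
Qed.

Lemma edges_SWT_between Y o s t :
  (forall i, (fp_dist Y o i)%:E <= s <-> (fp_dist Y o i)%:E <= t)%E ->
  edges (SWT Y o s) = edges (SWT Y o t).
Proof.
move=> h; apply/seteqP; split => e /= [i [p [ht ? ?]]]; exists i, p; split => //; exact/h.
Qed.

(** The tree changes only at distances of vertices, so the infimum over real times reduces to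
    finitely many candidates, which makes it measurable. *)
Lemma le_SWT_time Y o i k : (forall e, 0 < Y e) ->
  ((fp_dist Y o i)%:E <= SWT_time Y o k)%E <->
  forall j, (edges (SWT Y o (fp_dist Y o j)%:E) #= `I_k)%card ->
    fp_dist Y o i <= fp_dist Y o j.
Proof.
move=> Y0; split=> [h j hj|h].
  rewrite -lee_fin; apply: le_trans h _; apply: ereal_inf_lbound.
  by exists (fp_dist Y o j) => //; split => //; exact: fp_dist_ge0.
apply: le_ereal_inf_tmp => _ [t [t0 ht] <-]; rewrite lee_fin.
(* The farthest vertex reached by time [t]: the tree at its distance is the tree at [t]. *)
pose j := [arg max_(j > o | fp_dist Y o j <= t) fp_dist Y o j]%O.
have [jt jmax] : fp_dist Y o j <= t /\ forall j', fp_dist Y o j' <= t -> fp_dist Y o j' <= fp_dist Y o j.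
  by rewrite /j; case: arg_maxP => [|j' h1 h2]; rewrite ?fp_distxx.
apply: le_trans (jt); apply: h.
rewrite (@edges_SWT_between _ _ _ t%:E)// => i'; rewrite !lee_fin; split.
  by move=> h'; exact: le_trans h' jt.
exact: jmax.
Qed.

End first_passage.

Section event_measurable.
Context {R : realType} {d : measure_display} {T : measurableType d} {V : finType}.
Variables (o : V) (Y : {set V} -> T -> R).
Hypothesis mY : forall e, measurable_fun setT (Y e).
Hypothesis Y0 : forall e w, 0 < Y e w.
Local Notation Yw w := (fun e => Y e w).
Local Notation mp P := (measurable [set w : T | P w]).

Lemma measurable_path_weight i p : measurable_fun setT (fun w => path_weight (Yw w) i p).
Proof. by apply: measurable_sum => e; exact: mY. Qed.

Lemma measurable_fp_dist i : measurable_fun setT (fun w => fp_dist (Yw w) o i).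
Proof.
apply: (measurability _ (RGenCInfty.measurableE R)) => _ [_ [t ->] <-].
rewrite setTI (_ : _ @^-1` _ =
    [set w | forall p : seq V, paths o i p -> t <= path_weight (Yw w) o p]).
  apply: mprop_forall => p; apply: mprop_imply; first exact: mprop_cst.
  by apply: mprop_le => //; exact: measurable_path_weight.
apply/seteqP; split => w /=; rewrite in_itv/= andbT.
  by move/(le_fp_dist _ _ _ (Y0^~ w)).
by move=> h; apply/(le_fp_dist _ _ _ (Y0^~ w)).
Qed.

Lemma mprop_SWT_edge e (Q : V -> T -> Prop) : (forall i, mp (Q i)) ->
  mp (fun w => exists i p, [/\ Q i w, optimal_path (Yw w) o i p & e \in path_edges o p]).
Proof.
move=> mQ; apply: mprop_exists => i; apply: mprop_exists => p.
rewrite (_ : [set _ | _] = [set w | Q i w /\ ((paths o i p /\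
   path_weight (Yw w) o p = fp_dist (Yw w) o i) /\ e \in path_edges o p)]).
  apply: mprop_and => //; apply: mprop_and; last exact: mprop_cst.
  apply: mprop_and; first exact: mprop_cst.
  by apply: mprop_eq; [exact: measurable_path_weight|exact: measurable_fp_dist].
by apply/seteqP; split => w /= [] // h1 []// h2 h3; split.
Qed.

Lemma mprop_SWT_time i k : mp (fun w => ((fp_dist (Yw w) o i)%:E <= SWT_time (Yw w) o k)%E).
Proof.
rewrite (_ : [set _ | _] = [set w | forall j,
    (edges (SWT (Yw w) o (fp_dist (Yw w) o j)%:E) #= `I_k)%card ->
    fp_dist (Yw w) o i <= fp_dist (Yw w) o j]).
  apply: mprop_forall => j; apply: mprop_imply; last first.
    by apply: mprop_le; exact: measurable_fp_dist.
  apply: mprop_card => e.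
  apply: (@mprop_SWT_edge e (fun i w => ((fp_dist (Yw w) o i)%:E <= (fp_dist (Yw w) o j)%:E)%E)).
  by move=> i'; under eq_set do rewrite lee_fin; apply: mprop_le; exact: measurable_fp_dist.
by apply/seteqP; split => w /=; [move/(le_SWT_time _ _ _ (Y0^~ w))|
  move=> h; apply/(le_SWT_time _ _ _ (Y0^~ w))].
Qed.

Variables (X : vertex -> T -> R) (M : vertex -> T -> V).
Hypothesis mX : forall v, measurable_fun setT (X v).
Hypothesis mM : forall v i, measurable (M v @^-1` [set i]).
Local Notation Xw w := (fun v => X v w).
Local Notation Mw w := (fun v => M v w).

Lemma mprop_boundary (S : T -> set vertex) v : (forall u, mp (fun w => S w u)) ->
  mp (fun w => IP_boundary (S w) v).
Proof.
move=> mS; rewrite (_ : [set _ | _] =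
  [set w | nonroot v /\ (~ S w v /\ S w (behead v))]).
  apply: mprop_and; first exact: mprop_cst.
  by apply: mprop_and => //; exact: mprop_not.
by apply/seteqP; split => w /= [] // ? [].
Qed.

Lemma mprop_IP k v : mp (fun w => IP (Xw w) k v).
Proof.
elim: k v => [|k IH] v; first exact: mprop_cst.
apply: mprop_or => //; apply: mprop_and; first exact: mprop_boundary.
apply: mprop_forall => u; apply: mprop_imply; first exact: mprop_boundary.
exact: mprop_le.
Qed.

Lemma mprop_mark v i : mp (fun w => M v w = i).
Proof. exact: mM. Qed.

Lemma measurable_SWT_eq_mark_image m : measurable
  [set w | forall k, (k <= m)%N ->
    SWT (Yw w) o (SWT_time (Yw w) o k) = mark_image (Mw w) (IP (Xw w) k)].
Proof.
apply: mprop_forall => k; apply: mprop_imply; first exact: mprop_cst.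
(* Equality of subgraphs unfolds into countably many conditions; naming the end marks [i] and [j]
   leaves only events of the form [M v w = i]. *)
rewrite (_ : [set _ | _] = [set w |
    (forall i, ((fp_dist (Yw w) o i)%:E <= SWT_time (Yw w) o k)%E <->
       exists v, IP (Xw w) k v /\ M v w = i) /\
    (forall e, (exists i p, [/\ ((fp_dist (Yw w) o i)%:E <= SWT_time (Yw w) o k)%E,
                      optimal_path (Yw w) o i p & e \in path_edges o p]) <->
      ((exists v, (nonroot v /\ (IP (Xw w) k v /\ IP (Xw w) k (behead v))) /\
        (exists i, exists j, (M v w = i /\ M (behead v) w = j) /\ [set i; j]%SET = e)) /\ 
       Kedges V e))]).
  apply: mprop_and; [apply: mprop_forall => i; apply: mprop_iff|apply: mprop_forall => e; apply: mprop_iff].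
  - exact: mprop_SWT_time.
  - by apply: mprop_exists => v; apply: mprop_and; [exact: mprop_IP|exact: mprop_mark].
  - by apply: (@mprop_SWT_edge e (fun i w => ((fp_dist (Yw w) o i)%:E <= SWT_time (Yw w) o k)%E)) => i;
      exact: mprop_SWT_time.
  - apply: mprop_and; last exact: mprop_cst.
    apply: mprop_exists => v; apply: mprop_and.
      apply: mprop_and; first exact: mprop_cst.
      by apply: mprop_and; exact: mprop_IP.
    apply: mprop_exists => i; apply: mprop_exists => j; apply: mprop_and; last exact: mprop_cst.
    by apply: mprop_and; exact: mprop_mark.
apply/seteqP; split => w /=.
  move=> e; split.
    move=> i; have := congr1 (fun G => vertices G i) e; rewrite /= => ->.
    by split => [[v ? ?]|[v [? ?]]]; exists v.
  move=> f; have := congr1 (fun G => edges G f) e; rewrite /= => ->.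
  split => [[[v [nv h1 h2] ef] kf]|[[v [[nv [h1 h2]] [i [j [[e1 e2] ef]]]]] kf]]; split => //.
    by exists v; split => //; exists (M v w), (M (behead v) w).
  by exists v; rewrite ?e1 ?e2.
move=> [hv he]; rewrite /SWT /mark_image; congr Subgraph; apply/seteqP; split.
- by move=> i /= /hv[v [h1 h2]]; exists v.
- by move=> i /= [v h1 h2]; apply/hv; exists v.
- move=> f /= /he[[v [[nv [h1 h2]] [i [j [[e1 e2] ef]]]]] kf]; split => //.
  by exists v; rewrite ?e1 ?e2.
- move=> f /= [[v [nv h1 h2] ef] kf]; apply/he; split => //.
  by exists v; split => //; exists (M v w), (M (behead v) w).
Qed.

End event_measurable.

(** * First passage percolation along a separated tree *)

Section tree_recursion.
Context {A : Type} (a0 : A) (f : seq A -> A -> A) (par : nat -> nat).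

(* [par k] is the index of the parent of node [k.+1]. *)
Fixpoint tree_list n : seq A :=
  if n is k.+1 then rcons (tree_list k) (f (tree_list k) (nth a0 (tree_list k) (par k)))
  else [:: a0].

Definition tree_node n := nth a0 (tree_list n) n.

Lemma size_tree_list n : size (tree_list n) = n.+1.
Proof. by elim: n => //= n IH; rewrite size_rcons IH. Qed.

Lemma nth_tree_list n k : (k <= n)%N -> nth a0 (tree_list n) k = tree_node k.
Proof.
elim: n => [|n IH]; first by rewrite leqn0 => /eqP->.
rewrite leq_eqVlt => /predU1P[->//|kn].
by rewrite /= nth_rcons size_tree_list kn IH.
Qed.

Lemma tree_nodeS k : (par k <= k)%N ->
  tree_node k.+1 = f (tree_list k) (tree_node (par k)).
Proof.
by move=> pk; rewrite {1}/tree_node /= nth_rcons size_tree_list ltnn eqxx nth_tree_list.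
Qed.

End tree_recursion.

Section optimal_paths.
Context {R : realType} {V : finType}.
Implicit Types (Y : {set V} -> R).

Lemma path_weight_cat Y o p1 j p2 :
  path_weight Y o (p1 ++ j :: p2) =
  path_weight Y o p1 + Y [set last o p1; j]%SET + path_weight Y j p2.
Proof. by rewrite /path_weight /path_edges pairmap_cat big_cat/= big_cons addrA. Qed.

Lemma path_weight_eq0 Y o p : (forall e, 0 < Y e) -> path_weight Y o p <= 0 -> p = [::].
Proof.
move=> Y0; case: p => // j p; rewrite -[_ :: _]cat0s path_weight_cat.
have := path_weight_ge0 o [::] Y0; have := path_weight_ge0 j p Y0; have /= := Y0 [set o; j]%SET.
by move=> *; exfalso; lra.
Qed.

Lemma first_exit (b : pred V) o p : b o -> ~~ b (last o p) ->
  exists p1 j p2, [/\ p = p1 ++ j :: p2, b (last o p1) & ~~ b j].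
Proof.
elim: p o => [|x p IH] o bo /=; first by rewrite bo.
have [bx /(IH _ bx)[p1 [j [p2 [-> h1 h2]]]]|nbx _] := boolP (b x).
  by exists (x :: p1), j, p2.
by exists [::], x, p.
Qed.

Lemma optimal_path_exists Y o i : (forall e, 0 < Y e) -> exists p, optimal_path Y o i p.
Proof.
move=> Y0.
(* A self-avoiding path has length at most [#|V|], so paths live in a finite type of tuples, where a
   minimum exists. *)
pose W (x : {k : 'I_#|V|.+1 & k.-tuple V}) := path_weight Y o (tagged x).
have tp p : paths o i p -> exists x : {k : 'I_#|V|.+1 & k.-tuple V}, (tagged x : seq V) = p.
  move=> [/= /andP[_ up] _]; have sp : (size p < #|V|.+1)%N.
    by rewrite ltnS -(card_uniqP up) max_card.
  by exists (Tagged (fun k : 'I_#|V|.+1 => k.-tuple V) (in_tuple p : (Ordinal sp).-tuple V)).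
have [p0 hp0] := paths_nonempty o i; have [x0 hx0] := tp p0 hp0.
have px0 : `[< paths o i (tagged x0) >] by apply/asboolP; rewrite hx0.
have [x /asboolP px xmin] := @arg_minP _ R _ x0 (fun x => `[< paths o i (tagged x) >]) W px0.
exists (tagged x); split => //; apply/eqP; rewrite eq_le fp_dist_le// andbT.
by apply/le_fp_dist => // p hp; have [y hy] := tp p hp; rewrite -hy; apply: xmin; apply/asboolP; rewrite hy.
Qed.

End optimal_paths.

Section separated_tree.
Context {R : realType} {V : finType}.
Variables (Y : {set V} -> R) (lab : nat -> V) (par : nat -> nat) (m : nat).
Hypothesis Y0 : forall e, 0 < Y e.
Hypothesis lab_inj : forall s t, (s <= m)%N -> (t <= m)%N -> lab s = lab t -> s = t.
Hypothesis par_le : forall k, (k < m)%N -> (par k <= k)%N.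
Local Notation o := (lab 0).

Definition tree_edge k : {set V} := [set lab (par k); lab k.+1]%SET.

(* The factor [m.+1] makes the discarded edge longer than any path of the tree. *)
Hypothesis separated : forall k s j, (k < m)%N -> (s <= k)%N ->
  (forall i, (i <= k)%N -> j <> lab i) -> (s, j) <> (par k, lab k.+1) ->
  m.+1%:R * Y (tree_edge k) <= Y [set lab s; j]%SET.

Definition tree_path : nat -> seq V :=
  tree_node [::] (fun s p => rcons p (lab (size s))) par.

Definition tree_graph k : subgraph V :=
  Subgraph [set lab i | i in `I_k.+1] [set tree_edge i | i in `I_k].

Local Notation D k := (path_weight Y o (tree_path k)).

Lemma tree_pathS k : (k < m)%N -> tree_path k.+1 = rcons (tree_path (par k)) (lab k.+1).
Proof. by move=> km; rewrite /tree_path tree_nodeS ?par_le// size_tree_list. Qed.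

Lemma tree_path_spec k : (k <= m)%N ->
  [/\ last o (tree_path k) = lab k, uniq (o :: tree_path k) &
      forall x, x \in o :: tree_path k -> exists2 i, (i <= k)%N & x = lab i].
Proof.
elim/ltn_ind: k => [[_ _|k IH km]].
  by split => // x; rewrite inE => /eqP->; exists 0%N.
have pk := par_le km; have [l u h] := IH (par k) pk (leq_trans pk (ltnW km)).
rewrite tree_pathS//; split; first by rewrite last_rcons.
  rewrite -rcons_cons rcons_uniq u andbT; apply/negP => /h[i ik el].
  have e := lab_inj km (leq_trans ik (leq_trans pk (ltnW km))) el.
  by rewrite -e ltnNge pk in ik.
move=> x; rewrite -rcons_cons mem_rcons inE => /predU1P[->|/h[i ik ->]]; first by exists k.+1.
by exists i => //; apply: leq_trans (leq_trans ik pk) _.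
Qed.

Lemma last_tree_path k : (k <= m)%N -> last o (tree_path k) = lab k.
Proof. by case/tree_path_spec. Qed.

Lemma tree_distS k : (k < m)%N -> D k.+1 = D (par k) + Y (tree_edge k).
Proof.
move=> km; rewrite tree_pathS// -cats1 path_weight_cat last_tree_path.
  by rewrite [path_weight _ _ [::]]big_nil addr0.
exact: leq_trans (par_le km) (ltnW km).
Qed.

Lemma lab_neq k i : (k < m)%N -> (i <= k)%N -> lab k.+1 <> lab i.
Proof.
move=> km ik /lab_inj; rewrite km (leq_trans ik (ltnW km)) => /(_ isT isT) e.
by rewrite -e ltnn in ik.
Qed.

(* If the parent of node [k.+1] is node [s] or an earlier one, only the new edge
   matters; otherwise it was found after [s], when the arc to [j] was rejected too. *)
Lemma tree_dist_aux k : (k < m)%N -> D k < D k.+1 /\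
  forall s j, (s <= k)%N -> (forall i, (i <= k)%N -> j <> lab i) ->
    (s, j) <> (par k, lab k.+1) ->
    m.+1%:R * (D k.+1 - D s) <= k.+1%:R * Y [set lab s; j]%SET.
Proof.
elim/ltn_ind: k => k IH km.
have mono s t : (s <= t)%N -> (t <= k)%N -> D s <= D t.
  elim: t => [|t IHt]; first by rewrite leqn0 => /eqP->.
  rewrite leq_eqVlt => /predU1P[->//|st] tk.
  apply: le_trans (IHt st (ltnW tk)) _.
  by have [/ltW] := IH t tk (ltn_trans tk km).
have pk := par_le km; rewrite tree_distS//; split.
  have [->|pneq] := eqVneq (par k) k; first by rewrite ltrDl.
  have {pneq}pk' : (par k < k)%N by rewrite ltn_neqAle pneq.
  case: k => // r in IH km mono pk pk' *.
  (* The parent is older than node [r.+1], so the arc to the new node was already rejected when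
     [r.+1] was found. By induction the distance from the parent to [r.+1] is at most the fraction
     [r.+1 / m.+1] of that arc. *)
  have [//|_ /(_ (par r.+1) (lab r.+2))] := IH r _ (ltnW km).
  have nj i : (i <= r.+1)%N -> lab r.+2 <> lab i by exact: lab_neq.
  rewrite -ltnS => /(_ pk') h.
  have := h (fun i ir => nj i (leqW ir)); case=> //; last by move=> _; exact: nj.
  rewrite -/(tree_edge r.+1) => h1; have y0 := Y0 (tree_edge r.+1).
  have : r.+1%:R * Y (tree_edge r.+1) < m.+1%:R * Y (tree_edge r.+1).
    by rewrite ltr_pM2r// ltr_nat ltnS ltnW.
  move/(le_lt_trans h1); rewrite ltr_pM2l ?ltr0n//; lra.
move=> s j sk nj ne; have hs := separated km sk nj ne.
have y0 := Y0 [set lab s; j]%SET.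
have [ps|sp] := leqP (par k) s.
  have : m.+1%:R * (D (par k) - D s) <= 0.
    by rewrite pmulr_rle0 ?ltr0n// subr_le0 mono.
  have : Y [set lab s; j]%SET <= k.+1%:R * Y [set lab s; j]%SET.
    by apply: ler_peMl; [exact: ltW|rewrite ler1n].
  by move=> h1 h2; lra.
have [r pr] : exists r, par k = r.+1 by case: (par k) sp => // r _; exists r.
rewrite pr in sp pk *.
have [_ /(_ s j) h] := IH r pk (ltn_trans pk km).
have {}h := h sp (fun i ir => nj i (leq_trans ir (ltnW pk))).
have h1 : m.+1%:R * (D r.+1 - D s) <= r.+1%:R * Y [set lab s; j]%SET.
  by apply: h; case=> _; exact: nj.
(* The edge to the new node costs one more share of [Y [set lab s; j] / m.+1], and
   [r.+2 <= k.+1]. *)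
have : r.+2%:R * Y [set lab s; j]%SET <= k.+1%:R * Y [set lab s; j]%SET.
  by rewrite ler_pM2r// ler_nat.
rewrite -[r.+2]addn1 natrD; move=> h2; lra.
Qed.

Lemma tree_dist_lt s t : (s < t)%N -> (t <= m)%N -> D s < D t.
Proof.
elim: t => // t IH; rewrite ltnS leq_eqVlt => /predU1P[->|st] tm.
  by have [] := tree_dist_aux tm.
by apply: lt_trans (IH st (ltnW tm)) _; have [] := tree_dist_aux tm.
Qed.

Lemma tree_dist_le s t : (s <= t)%N -> (t <= m)%N -> D s <= D t.
Proof. by rewrite leq_eqVlt => /predU1P[->//|st] tm; apply/ltW/tree_dist_lt. Qed.

Lemma tree_dist_lt_other k s j : (k < m)%N -> (s <= k)%N ->
  (forall i, (i <= k)%N -> j <> lab i) -> (s, j) <> (par k, lab k.+1) ->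
  D k.+1 < D s + Y [set lab s; j]%SET.
Proof.
move=> km sk nj ne; have [_ /(_ _ _ sk nj ne) h] := tree_dist_aux km.
have y0 := Y0 [set lab s; j]%SET.
have : k.+1%:R * Y [set lab s; j]%SET < m.+1%:R * Y [set lab s; j]%SET.
  by rewrite ltr_pM2r// ltr_nat ltnS.
by move/(le_lt_trans h); rewrite ltr_pM2l ?ltr0n//; lra.
Qed.

(** Valid for arbitrary walks. At the first exit from the labels below [t], the part before is
    bounded by induction, and leaving through any arc other than the tree edge is strictly too long.
    The second conclusion yields uniqueness of optimal paths. *)
Lemma path_weight_ge_tree t p : (t <= m)%N ->
  (forall i, (i < t)%N -> last o p <> lab i) ->
  D t <= path_weight Y o p /\ (path_weight Y o p <= D t -> p = tree_path t).
Proof.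
elim/ltn_ind: t p => [[_ p _ _|t IH p tm np]].
  have D0 : D 0 = 0 by rewrite /path_weight big_nil.
  by rewrite D0; split; [exact: path_weight_ge0|exact: path_weight_eq0].
pose b x := `[< exists2 i, (i <= t)%N & x = lab i >].
have bo : b o by apply/asboolP; exists 0%N.
have nbl : ~~ b (last o p) by apply/asboolPn => -[i it e]; exact: (np i it e).
have [p1 [j [p2 [-> /asboolP[s st ls] /asboolPn nbj]]]] := first_exit bo nbl.
have nj i : (i <= t)%N -> j <> lab i by move=> it e; apply: nbj; exists i.
have sm : (s <= m)%N := leq_trans st (ltnW tm).
have [] := IH s st p1 sm.
  move=> i si; rewrite ls => /lab_inj; rewrite sm (leq_trans (ltnW si) sm) => /(_ isT isT) e.
  by rewrite e ltnn in si.
move=> h1 h2; rewrite path_weight_cat ls; have w2 := path_weight_ge0 j p2 Y0.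
have [e|ne] := pselect ((s, j) = (par t, lab t.+1)); last first.
  by have := tree_dist_lt_other tm st nj ne; move=> hlt; split; [lra|move=> hle; exfalso; clear ls ne nj nbj; lra].
move: e => [es ej]; rewrite tree_distS// /tree_edge -es -ej; split; first by lra.
move=> h3; have p10 : p1 = tree_path s by apply: h2; lra.
have p20 : p2 = [::] by apply: (path_weight_eq0 Y0 (o := j)); lra.
by rewrite tree_pathS// p10 p20 -es -ej cats1.
Qed.

Lemma lab_notin t : (t <= m)%N -> forall i, (i < t)%N -> lab t <> lab i.
Proof. by case: t => // t tm i it; exact: lab_neq. Qed.

Lemma fp_dist_ge_tree t x : (t <= m)%N -> (forall i, (i < t)%N -> x <> lab i) ->
  D t <= fp_dist Y o x.
Proof.
move=> tm nx; apply/le_fp_dist => // p [_ lp].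
by have [|] := @path_weight_ge_tree t p tm; rewrite ?lp.
Qed.

Lemma fp_dist_tree t : (t <= m)%N -> fp_dist Y o (lab t) = D t.
Proof.
move=> tm; have [l u _] := tree_path_spec tm.
apply/eqP; rewrite eq_le fp_dist_le//=; exact/fp_dist_ge_tree/lab_notin.
Qed.

Lemma optimal_tree t p : (t <= m)%N -> optimal_path Y o (lab t) p <-> p = tree_path t.
Proof.
move=> tm; split=> [[[_ lp]] | ->].
  have [|_ h] := @path_weight_ge_tree t p tm; first by rewrite lp; exact: lab_notin.
  by rewrite fp_dist_tree// => e; apply: h; rewrite e.
by have [l u _] := tree_path_spec tm; split; rewrite ?fp_dist_tree.
Qed.

Lemma fp_dist_le_tree t x : (t <= m)%N ->
  fp_dist Y o x <= D t <-> exists2 i, (i <= t)%N & x = lab i.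
Proof.
move=> tm; split => [h|[i it ->]]; last first.
  by rewrite fp_dist_tree ?tree_dist_le// (leq_trans it).
apply: contrapT => nx; have nx' i : (i <= t)%N -> x <> lab i by move=> it e; apply: nx; exists i.
have [p [[up lp] wp]] := optimal_path_exists o x Y0.
have [|_ e] := @path_weight_ge_tree t p tm.
  by move=> i it; rewrite lp; apply: nx'; exact: ltnW.
by move: lp; rewrite e ?wp// last_tree_path// => /esym; exact: nx'.
Qed.

Lemma path_edges_tree k e : (k <= m)%N ->
  e \in path_edges o (tree_path k) -> exists2 i, (i < k)%N & e = tree_edge i.
Proof.
elim/ltn_ind: k => [[_ _ //|k IH km]].
have pk := par_le km.
rewrite tree_pathS// /path_edges -cats1 pairmap_cat mem_cat last_tree_path; last first.
  exact: leq_trans pk (ltnW km).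
move=> /orP[/(IH _ pk (leq_trans pk (ltnW km)))[i ik ->]|].
  by exists i => //; apply: leq_trans ik (leqW pk).
by rewrite inE => /eqP->; exists k.
Qed.

Lemma tree_edge_path k : (k < m)%N -> tree_edge k \in path_edges o (tree_path k.+1).
Proof.
move=> km; rewrite tree_pathS// /path_edges -cats1 pairmap_cat mem_cat last_tree_path.
  by rewrite inE eqxx orbT.
exact: leq_trans (par_le km) (ltnW km).
Qed.

Lemma tree_edge_inj i j : (i < m)%N -> (j < m)%N -> tree_edge i = tree_edge j -> i = j.
Proof.
have lt i' j' : (i' < j')%N -> (j' < m)%N -> tree_edge i' <> tree_edge j'.
  move=> ij jm e; have : lab j'.+1 \in tree_edge i' by rewrite e !inE eqxx orbT.
  have im := ltn_trans ij jm.
  by rewrite !inE => /orP[]/eqP; apply: lab_neq => //; exact: leq_trans (par_le im) (ltnW ij).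
move=> im jm e; case: (ltngtP i j) => // h; first by case: (lt _ _ h jm).
by case: (lt _ _ h im).
Qed.

Lemma SWT_at_tree_dist k : (k <= m)%N -> SWT Y o (D k)%:E = tree_graph k.
Proof.
move=> km; rewrite /SWT /tree_graph; congr Subgraph; apply/seteqP; split.
- by move=> x /=; rewrite lee_fin => /(fp_dist_le_tree _ km)[i ik ->]; exists i.
- by move=> _ [i /= ik <-]; rewrite lee_fin; apply/fp_dist_le_tree => //; exists i.
- move=> e [i [p []]]; rewrite lee_fin => /(fp_dist_le_tree _ km)[j jk ->].
  have jm := leq_trans jk km.
  by move=> /(optimal_tree _ jm)-> /(path_edges_tree jm)[r rj ->]; exists r => //=; exact: leq_trans rj jk.
- move=> _ [i /= ik <-]; have im := leq_trans ik km.
  exists (lab i.+1), (tree_path i.+1); split; last exact: tree_edge_path.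
    by rewrite lee_fin; apply/fp_dist_le_tree => //; exists i.+1.
  exact/optimal_tree.
Qed.

Lemma SWT_time_tree k : (k <= m)%N -> SWT_time Y o k = (D k)%:E.
Proof.
move=> km; apply/eqP; rewrite eq_le; apply/andP; split.
  apply: ereal_inf_lbound; exists (D k) => //; split; first exact: path_weight_ge0.
  rewrite SWT_at_tree_dist//=; apply: card_eq_trans (card_eqxx _).
  apply: inj_card_eq => i j; rewrite !inE/= => ik jk; apply: tree_edge_inj; exact: leq_trans km.
apply: le_ereal_inf_tmp => _ [t [t0 ct] <-]; rewrite lee_fin leNgt; apply/negP => tk.
case: k => [|k] in km ct tk *.
  by move: tk; rewrite /path_weight big_nil ltNge t0.
have sub : edges (SWT Y o t%:E) `<=` tree_edge @` `I_k.
  move=> e [i [p []]]; rewrite lee_fin => it.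
  have [[j jk ->]|nx] := pselect (exists2 j, (j <= k)%N & i = lab j).
    have jm := leq_trans jk (ltnW km).
    by move=> /(optimal_tree _ jm)-> /(path_edges_tree jm)[r rj ->]; exists r => //=; exact: leq_trans rj jk.
  have : D k.+1 <= fp_dist Y o i.
    by apply: fp_dist_ge_tree => // j jk e'; apply: nx; exists j.
  by move=> /le_trans/(_ it); rewrite leNgt tk.
(* Before time [D k.+1] only the first [k] tree edges can be present, against the [k.+1] edges
   required. *)
have : (`I_k.+1 #<= `I_k)%card.
  apply: card_le_trans (card_image_le tree_edge `I_k).
  by apply: card_le_trans (subset_card_le sub); move: ct; rewrite card_eq_le => /andP[].
by rewrite card_le_II ltnn.
Qed.

Lemma SWT_separated_tree k : (k <= m)%N -> SWT Y o (SWT_time Y o k) = tree_graph k.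
Proof. by move=> km; rewrite SWT_time_tree// SWT_at_tree_dist. Qed.

End separated_tree.

(** * Runs of invasion percolation *)

(** Monotonicity makes the pointwise hypothesis uniform: [x] is rounded up to a grid point
    [a i <= x + eta], and then [a i + eta <= x + delta <= y], so only finitely many ratios have to
    be large. *)
Lemma uniform_ratio (R : realType) (g : nat -> R -> R)
  (g_gt0 : forall n : nat, (0 < n)%N -> forall x : R, 0 < x -> 0 < g n x)
  (g_incr : forall n : nat, (0 < n)%N ->
     forall x y : R, 0 < x -> x < y -> g n x < g n y)
  (f_ratio : forall x delta : R, 0 < x -> 0 < delta ->
     (rescaled g n (x + delta) / rescaled g n x) @[n --> \oo] --> +oo)
  (K delta L : R) : 0 < delta -> 0 <= L ->
  \forall n \near \oo, forall x y, 0 < x -> x <= K -> x + delta <= y ->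
    L * rescaled g n x <= rescaled g n y.
Proof.
move=> d0 L0; pose eta := delta / 2; have eta0 : 0 < eta by rewrite divr_gt0.
(* The grid starts at [eta] rather than 0, because the ratios are controlled at positive points
   only. *)
pose a (i : nat) := i.+1%:R * eta.
have a0 i : 0 < a i by rewrite mulr_gt0// ltr0n.
pose J := Num.trunc (K / eta).
have grid : \forall n \near \oo, forall i : 'I_J.+1,
    L <= rescaled g n (a i + eta) / rescaled g n (a i).
  by apply: filter_forall => i; have /cvgryPge := @f_ratio (a i) eta (a0 i) eta0; exact.
near=> n; have n0 : (0 < n)%N by near: n; exact: nbhs_infty_gt.
have f0 x : 0 < x -> 0 < rescaled g n x.
  by move=> x0; apply: g_gt0 => //; rewrite divr_gt0// ltr0n.
have fle x y : 0 < x -> x <= y -> rescaled g n x <= rescaled g n y.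
  move=> x0; rewrite le_eqVlt => /predU1P[->//|xy]; apply/ltW/g_incr => //.
    by rewrite divr_gt0// ltr0n.
  by rewrite ltr_pM2r// invr_gt0 ltr0n.
move=> x y x0 xK xy.
have xe0 : 0 <= x / eta by rewrite divr_ge0// ltW.
have /andP[lo hi] := truncn_itv xe0.
have iJ : (Num.trunc (x / eta) < J.+1)%N.
  by rewrite ltnS; apply: le_truncn; rewrite ler_pM2r ?invr_gt0.
pose i := Ordinal iJ.
have xa : x <= a i by rewrite ltW// /a -ltr_pdivrMr.
have ax : a i <= x + eta.
  by rewrite /a -natr1 mulrDl mul1r lerD2r -ler_pdivlMr.
have : L <= rescaled g n (a i + eta) / rescaled g n (a i) by move: (i); near: n.
rewrite ler_pdivlMr ?f0// => h.
apply: le_trans (ler_wpM2l L0 (fle _ _ x0 xa)) _; apply: le_trans h _.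
apply: fle; first by rewrite addr_gt0.
have ed : delta = eta + eta by rewrite /eta; lra.
by apply: le_trans xy; rewrite ed addrA lerD2r.
Unshelve. all: end_near. Qed.

(** * Shapes of trees and the words of their nodes *)

Section words.
Implicit Types par : nat -> nat.

Definition child_count par k p := count (fun r => par r == p) (iota 0 k).

Lemma child_countS par k p :
  child_count par k.+1 p = (child_count par k p + (par k == p))%N.
Proof. by rewrite /child_count -addn1 iotaD count_cat/= addn0. Qed.

Lemma child_count_lt par r k : (r < k)%N -> (child_count par r (par r) < child_count par k (par r))%N.
Proof.
elim: k => // k IH; rewrite ltnS leq_eqVlt => /predU1P[->|/IH h].
  by rewrite child_countS eqxx addn1.
by rewrite child_countS; apply: leq_trans h _; exact: leq_addr.
Qed.

Lemma child_count_attained par k p i : (i < child_count par k p)%N ->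
  exists r, [/\ (r < k)%N, par r = p & child_count par r p = i].
Proof.
elim: k => // k IH; rewrite child_countS.
have [e|ne] := eqVneq (par k) p; rewrite ?addn1 ?addn0; last first.
  by move=> /IH[r [rk ? ?]]; exists r; split => //; exact: leqW.
rewrite ltnS leq_eqVlt => /predU1P[->|/IH[r [rk ? ?]]]; first by exists k.
by exists r; split => //; exact: leqW.
Qed.

(* Node [k.+1] is the first child of node [par k] not used by nodes [1..k]. *)
Definition word par : nat -> vertex :=
  tree_node [::] (fun ws v => child_count par (size ws).-1 (par (size ws).-1) :: v) par.

Lemma wordS par k : (par k <= k)%N ->
  word par k.+1 = child_count par k (par k) :: word par (par k).
Proof. by move=> pk; rewrite /word tree_nodeS// size_tree_list. Qed.

Lemma tree_list_ext A a0 (f f' : seq A -> A -> A) par par' n :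
  (forall k s v, (k < n)%N -> size s = k.+1 -> f s v = f' s v) ->
  (forall k, (k < n)%N -> par k = par' k) ->
  tree_list a0 f par n = tree_list a0 f' par' n.
Proof.
elim: n => // n IH ef ep /=; rewrite IH.
- by rewrite (ep n)// (ef n)// size_tree_list.
- by move=> k s v kn; apply: ef; exact: leqW.
- by move=> k kn; apply: ep; exact: leqW.
Qed.

Lemma child_count_ext par par' n p : (forall k, (k < n)%N -> par k = par' k) ->
  child_count par n p = child_count par' n p.
Proof. by move=> e; apply: eq_in_count => r; rewrite mem_iota => /andP[_ /e->]. Qed.

Lemma word_ext par par' n : (forall k, (k < n)%N -> par k = par' k) ->
  word par n = word par' n.
Proof.
move=> e; congr nth; apply: tree_list_ext => // k s v kn ->/=.
by rewrite e//; congr cons; apply: child_count_ext => r rk; exact/e/(ltn_trans rk).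
Qed.

Variables (par : nat -> nat) (m : nat).
Hypothesis par_le : forall k, (k < m)%N -> (par k <= k)%N.
Local Notation v := (word par).

(** Equal words have equal tails, hence by induction the same parent; but siblings found at
    different times have different child indices. *)
Lemma word_inj s t : (s <= m)%N -> (t <= m)%N -> v s = v t -> s = t.
Proof.
have lt : forall n s t, (s < t)%N -> (t <= n)%N -> (t <= m)%N -> v s <> v t.
  elim=> [|n IH] i j ij; first by rewrite leqn0 => /eqP jn; rewrite jn in ij.
  case: j => // j in ij *; rewrite ltnS => jn jm; rewrite wordS ?par_le//.
  case: i => // i in ij *; rewrite ltnS in ij; have im := ltn_trans ij jm; rewrite wordS ?par_le//.
  case=> ec ew.
  have ei : (par i <= n)%N := leq_trans (par_le im) (ltnW (leq_trans ij jn)).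
  have ej : (par j <= n)%N := leq_trans (par_le jm) jn.
  have pe : par i = par j.
    have pim := leq_trans (par_le im) (ltnW im); have pjm := leq_trans (par_le jm) (ltnW jm).
    by case: (ltngtP (par i) (par j)) => // h; exfalso;
      [apply: (IH _ _ h)|apply: (IH _ _ h)].
  by have := child_count_lt par ij; rewrite ec -pe ltnn.
move=> sm tm e; case: (ltngtP s t) => // h.
  by case: (lt t s t h (leqnn _) tm).
by case: (lt s t s h (leqnn _) sm).
Qed.

Definition prefix_words k : set vertex := [set v i | i in `I_k.+1].

Lemma boundary_prefix k u : (k <= m)%N -> IP_boundary (prefix_words k) u <->
  exists s j, [/\ (s <= k)%N, u = j :: v s & (child_count par k s <= j)%N].
Proof.
move=> km; split.
  case: u => [[]//|j u] [_ nu [s sk es]]; exists s, j; split => //; first by rewrite es.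
  rewrite leqNgt; apply/negP => /child_count_attained[r [rk ep ec]]; apply: nu.
  exists r.+1 => //; rewrite wordS ?par_le// ?(leq_trans rk)// ep ec; congr cons; exact: es.
move=> [s [j [sk -> cj]]]; split => //=; last by exists s.
move=> [[//|r] /= rk]; rewrite ltnS in rk; have rm : (r < m)%N := leq_trans rk km.
rewrite wordS ?par_le// => -[ec ew].
have es : par r = s.
  by apply: word_inj ew; [exact: leq_trans (par_le rm) (ltnW rm)|exact: leq_trans sk km].
by have := child_count_lt par rk; rewrite ec es ltnNge cj.
Qed.

Lemma word_boundary k : (k < m)%N -> IP_boundary (prefix_words k) (v k.+1).
Proof.
move=> km; apply/(boundary_prefix _ (ltnW km)).
by exists (par k), (child_count par k (par k)); split; [exact: par_le|rewrite wordS ?par_le|].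
Qed.

Lemma prefix_wordsS k : prefix_words k.+1 = prefix_words k `|` [set v k.+1].
Proof.
apply/seteqP; split => [_ [i /= ik <-]|_ [[i /= ik <-]|->]].
- by move: ik; rewrite ltnS leq_eqVlt => /predU1P[->|ik]; [right|left; exists i].
- by exists i => //=; exact: leqW.
- by exists k.+1 => /=.
Qed.

End words.

Section runs.
Context {R : realType}.
Implicit Types (X : vertex -> R) (par : nat -> nat).

(* Invasion percolation visits [word par 0], ..., [word par m] in this order,
   through edges of weight at most [K] beating all competitors by [delta]. *)
Definition invasion_run X par m (K delta : R) :=
  forall k, (k < m)%N -> X (word par k.+1) <= K /\
    forall u, IP_boundary (prefix_words par k) u -> u <> word par k.+1 ->
      X (word par k.+1) + delta <= X u.

Lemma invasion_run_weaken X par m K K' delta delta' : K <= K' -> delta' <= delta ->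
  invasion_run X par m K delta -> invasion_run X par m K' delta'.
Proof.
move=> KK dd h k km; have [h1 h2] := h k km; split; first exact: le_trans KK.
by move=> u bu nu; apply: le_trans (h2 u bu nu); rewrite lerD2l.
Qed.

Lemma invasion_run_IP X par m K delta k : (forall k, (k < m)%N -> (par k <= k)%N) ->
  0 < delta -> invasion_run X par m K delta -> (k <= m)%N ->
  IP X k = prefix_words par k.
Proof.
move=> ple d0 h; elim: k => [_|k IH km].
  apply/seteqP; split => [_ ->|_ [[|//] _ <-]]; last by [].
  by exists 0%N.
rewrite /= IH ?(ltnW km)// prefix_wordsS; congr (_ `|` _).
have [_ hmin] := h k km; have bk := word_boundary ple km.
apply/seteqP; split => [u [bu /(_ _ bk) hu]|_ ->].
  apply: contrapT => ne; have := hmin u bu ne; lra.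
split => // u bu; have [->//|ne] := eqVneq u (word par k.+1).
by have := hmin u bu (elimN eqP ne); lra.
Qed.

(** At the first disagreement both candidates lie on the same boundary, and each would have to beat
    the other by [delta]. *)
Lemma invasion_run_unique X par par' m K delta :
  (forall k, (k < m)%N -> (par k <= k)%N) -> (forall k, (k < m)%N -> (par' k <= k)%N) ->
  0 < delta -> invasion_run X par m K delta -> invasion_run X par' m K delta ->
  forall k, (k < m)%N -> par k = par' k.
Proof.
move=> ple ple' d0 h h'; elim/ltn_ind => k IH km.
have ew i : (i <= k)%N -> word par i = word par' i.
  by move=> ik; apply: word_ext => r ri; apply: IH; [|apply: ltn_trans km]; exact: leq_trans ri ik.
have ep : prefix_words par k = prefix_words par' k.
  by apply/seteqP; split => _ [i ik <-]; exists i => //; rewrite ew.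
have [_ h1] := h k km; have [_ h2] := h' k km.
have e : word par k.+1 = word par' k.+1.
  apply: contrapT => ne.
  have := h1 (word par' k.+1); rewrite ep => /(_ (word_boundary ple' km) (nesym ne)).
  have := h2 (word par k.+1); rewrite -ep => /(_ (word_boundary ple km) ne).
  by move=> ? ?; lra.
move: e; rewrite !wordS ?ple ?ple'// => -[_]; rewrite -(ew (par' k)) ?ple'//.
by apply: (word_inj ple); apply: leq_trans (ltnW km); [exact: ple|exact: ple'].
Qed.

(** As the labels are distinct, no edge of the tree becomes a loop and none is lost in the image. *)
Lemma mark_image_run (V : finType) (M : vertex -> V) lab par m k :
  (forall k, (k < m)%N -> (par k <= k)%N) ->
  (forall s t, (s <= m)%N -> (t <= m)%N -> lab s = lab t -> s = t) ->
  (forall s, (s <= m)%N -> M (word par s) = lab s) -> (k <= m)%N ->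
  mark_image M (prefix_words par k) = tree_graph lab par k.
Proof.
move=> ple linj hM km; rewrite /mark_image /tree_graph; congr Subgraph.
  apply/seteqP; split => [_ [_ [i /= ik <-] <-]|_ [i /= ik <-]].
    by exists i => //; rewrite hM// (leq_trans _ km).
  by exists (word par i); [exists i|rewrite hM// (leq_trans _ km)].
apply/seteqP; split => [e [[u [nu [i /= ik eu] _] <-] _]|_ [i /= ik <-]].
  case: i => [|i] in ik eu; first by case: nu; rewrite -eu.
  rewrite ltnS in ik; have im : (i < m)%N := leq_trans ik km.
  have pm := leq_trans (ple _ im) (ltnW im).
  by exists i => //; rewrite -eu wordS ?ple//= -wordS ?ple// !hM// /tree_edge finset.setUC.
have im : (i < m)%N := leq_trans ik km; have pm := leq_trans (ple _ im) (ltnW im).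
split.
  exists (word par i.+1).
    split; [by rewrite wordS ?ple|by exists i.+1|].
    rewrite wordS ?ple//=; exists (par i) => //=.
    by rewrite ltnS; apply: leq_trans (ple _ im) (ltnW ik).
  by rewrite [behead _](_ : _ = word par (par i)) ?hM// /tree_edge 1?finset.setUC// wordS ?ple.
rewrite /Kedges /= /tree_edge cards2; case: eqVneq => // /linj e.
have := ple _ im; rewrite e ?ltnn//.
Qed.

Lemma uniform_gap (P : nat -> R -> Prop) n :
  (forall s d d', P s d -> d' <= d -> P s d') ->
  (forall s, (s < n)%N -> exists2 d, 0 < d & P s d) ->
  exists2 d, 0 < d & forall s, (s < n)%N -> P s d.
Proof.
move=> Pmono; elim: n => [|n IH] h; first by exists 1.
have [d d0 hd] := IH (fun s sn => h s (leqW sn)); have [d' d'0 hd'] := h n (leqnn _).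
exists (Num.min d d'); first by rewrite lt_min d0.
move=> s; rewrite ltnS leq_eqVlt => /predU1P[->|sn].
  by apply: Pmono hd' _; rewrite ge_min lexx orbT.
by apply: Pmono (hd s sn) _; rewrite ge_min lexx.
Qed.

Lemma invasion_run_exists X m :
  (forall v k, X (k :: v) < X (k.+1 :: v)) ->
  (forall u v, nonroot u -> nonroot v -> X u = X v -> u = v) ->
  exists par, [/\ (forall k, (k < m)%N -> (par k <= k)%N) &
    exists K delta, 0 < delta /\ invasion_run X par m K delta].
Proof.
move=> Xincr Xinj.
have Xmono v i j : (i <= j)%N -> X (i :: v) <= X (j :: v).
  elim: j => [|j IH]; first by rewrite leqn0 => /eqP->.
  rewrite leq_eqVlt => /predU1P[->//|ij]; exact: le_trans (IH ij) (ltW (Xincr _ _)).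
elim: m => [|m [par [ple [K [delta [d0 h]]]]]].
  by exists id; split => //; exists 0, 1; split.
pose c s := X (child_count par m s :: word par s).
pose p : 'I_m.+1 := [arg min_(i < ord0 | true) c i]%O.
have pmin (s : 'I_m.+1) : c p <= c s by rewrite /p; case: arg_minP => // i _; exact.
pose par' k := if k == m then p : nat else par k.
have epar k : (k < m)%N -> par' k = par k by rewrite /par' => km; rewrite ltn_eqF.
have ew s : (s <= m)%N -> word par' s = word par s.
  by move=> sm; apply: word_ext => k ks; apply: epar; exact: leq_trans sm.
have ec k q : (k <= m)%N -> child_count par' k q = child_count par k q.
  by move=> km; apply: child_count_ext => r rk; apply: epar; exact: leq_trans km.
have ple' k : (k < m.+1)%N -> (par' k <= k)%N.
  rewrite ltnS leq_eqVlt => /predU1P[->|km]; last by rewrite epar// ple.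
  by rewrite /par' eqxx -ltnS ltn_ord.
have pm : par' m = p by rewrite /par' eqxx.
have wm : word par' m.+1 = child_count par m p :: word par p.
  by rewrite wordS ?ple'// pm ec// ew// -ltnS ltn_ord.
have [d' d'0 hd'] : exists2 d', 0 < d' & forall s, (s < m.+1)%N -> forall j,
    (child_count par m s <= j)%N -> j :: word par s <> word par' m.+1 ->
    X (word par' m.+1) + d' <= X (j :: word par s).
  apply: (@uniform_gap (fun s d => forall j,
    (child_count par m s <= j)%N -> j :: word par s <> word par' m.+1 ->
    X (word par' m.+1) + d <= X (j :: word par s))).
    by move=> s d d1 hs dd j cj ne; apply: le_trans (hs j cj ne); rewrite lerD2l.
  move=> s sm; have [es|ns] := eqVneq s p.
    exists (X ((child_count par m p).+1 :: word par p) - X (word par' m.+1)).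
      by rewrite subr_gt0 wm.
    rewrite wm es => j; rewrite leq_eqVlt => /predU1P[->//|cj] _.
    by rewrite subrKC; exact: Xmono.
  exists (c s - X (word par' m.+1)).
    rewrite subr_gt0 wm lt_neqAle (pmin (Ordinal sm)) andbT.
    have nr k u : nonroot (k :: u) by [].
    apply/eqP => /(Xinj _ _ (nr _ _) (nr _ _)) [_ e'].
    move/eqP: ns; apply; apply/esym; apply: (word_inj ple) e' => //; rewrite -ltnS// ltn_ord.
  by move=> j cj _; rewrite subrKC; exact: Xmono.
exists par'; split => //; exists (Num.max K (X (word par' m.+1))), (Num.min delta d').
split; first by rewrite lt_min d0.
move=> k; rewrite ltnS leq_eqVlt => /predU1P[->|km].
  split; first by rewrite le_max lexx orbT.
  move=> u /(boundary_prefix ple' _ (leqnSn m)) [s [j [sm -> cj]]]; rewrite ew// => ne.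
  apply: le_trans (hd' s sm j _ ne); last by rewrite -ec.
  by rewrite lerD2l ge_min lexx orbT.
have [h1 h2] := h k km; rewrite (ew k.+1 km); split; first by rewrite le_max h1.
move=> u; rewrite (_ : prefix_words par' k = prefix_words par k) => [bu ne|].
  by apply: le_trans (h2 u bu ne); rewrite lerD2l ge_min lexx.
by apply/seteqP; split => _ [i /= ik <-]; exists i => //; rewrite ew// -ltnS (leq_trans ik)// ltnW.
Qed.

End runs.

(** * Comparison of the weights on K_n and on the marked PWIT *)

Lemma mprop_lt d (T : measurableType d) (R : realType) (f g : T -> R) :
  measurable_fun setT f -> measurable_fun setT g -> measurable [set w | f w < g w].
Proof.
move=> mf mg; rewrite (_ : [set _ | _] = [set w | ~ (g w <= f w)]).
  by apply: mprop_not; exact: mprop_le.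
by apply/seteqP; split => w /=; [move=> h; apply/negP; rewrite -ltNge|move/negP; rewrite -ltNge].
Qed.

Lemma cvg_prode (R : realType) (I : Type) (r : seq I) (f : I -> nat -> \bar R) (a : I -> R) :
  (forall i, f i @ \oo --> (a i)%:E) ->
  (\prod_(i <- r) f i n)%E @[n --> \oo] --> (\prod_(i <- r) a i)%:E.
Proof.
move=> fa; elim: r => [|i r IH].
  by under eq_fun do rewrite big_nil; rewrite big_nil; exact: cvg_cst.
under eq_fun do rewrite big_cons; rewrite big_cons EFinM.
by apply: cvgeM => //; exact: fa.
Qed.

(** * Joint tails of the edge lengths and of the minimal weights per mark *)

Section tails.
Context {R : realType}.
Local Notation U := (@U01 R).
Context {V : finType}.

Lemma tail_edges (E : {set V} -> {RV U >-> R}) (I : finType) (es : I -> {set V})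
    (t : I -> R) (n : R) :
  iid_exp1_edges E -> (forall e s, 0 <= s -> U [set w | s <= E e w] = (expR (- s))%:E) ->
  injective es -> (forall i, Kedges V (es i)) -> (forall i, 0 <= t i) -> 0 < n ->
  U [set w | forall i, t i <= n * E (es i) w] = (expR (- \sum_i t i / n))%:E.
Proof.
move=> [ind _] tail esI esK t0 n0.
pose A i := [set w | t i / n <= E (es i) w].
have := @independent_inj _ _ _ U _ _ es _ _ esI ind (enum I) A (enum_uniq I).
have -> : \bigcap_(i in [set` enum I]) A i = [set w | forall i, t i <= n * E (es i) w].
  apply/seteqP; split => w h i; last by rewrite /A /= ler_pdivrMr// mulrC.
  by have := h i (mem_enum I i); rewrite /A /= ler_pdivrMr// mulrC.
move=> ->.
  under eq_bigr do rewrite tail ?divr_ge0 ?(ltW n0)//.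
  by rewrite prodEFin big_enum /= -expR_sum -sumrN.
move=> i _; split; first exact: esK.
apply: sub_sigma_algebra; exists (es i) => //; exists `[t i / n, +oo[%classic => //.
by rewrite setTI; apply/seteqP; split => w /=; rewrite in_itv/= andbT.
Qed.

(* The marks thin the children of [v] into independent processes of rate [1 / n],
   so [min_weight X M v j] has the law of [n] times an edge weight of K_n. *)
Definition min_weight (X : vertex -> R) (M : vertex -> V) (v : vertex) (j : V) : \bar R :=
  ereal_inf [set (X (k :: v))%:E | k in [set k | M (k :: v) = j /\ 0 < X (k :: v)]].

Lemma le_min_weight X M v j t : (t%:E <= min_weight X M v j)%E <->
  forall k, M (k :: v) = j -> ~~ (0 < X (k :: v) < t).
Proof.
rewrite /min_weight; split=> [/ereal_infP h k Mk|h].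
  apply/negP => /andP[X0]; have : (t%:E <= (X (k :: v))%:E)%E by apply: h; exists k.
  by rewrite lee_fin leNgt => /negP.
apply/ereal_infP => _ [k [Mk Xk] <-]; rewrite lee_fin leNgt.
by have := h k Mk; rewrite Xk.
Qed.

Lemma min_weight_ge0 X M v j : (0 <= min_weight X M v j)%E.
Proof. by apply/le_min_weight => k _; apply/negP => /andP[/lt_trans h /h]; rewrite ltxx. Qed.

Lemma min_weight_le X M v k : 0 < X (k :: v) ->
  (min_weight X M v (M (k :: v)) <= (X (k :: v))%:E)%E.
Proof. by move=> X0; apply: ereal_inf_lbound; exists k. Qed.

Section marks.
Variables (o : V) (M : vertex -> R -> V).
Hypothesis hM : iid_uniform_marks U o M.

Lemma mark_in_law v (S : {set V}) : nonroot v ->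
  U [set w | M v w \in S] = (#|S|%:R / #|V|%:R)%:E.
Proof.
case: hM => _ mM law _ nv.
have -> : [set w | M v w \in S] = [set w | exists2 i, i \in S & (M v @^-1` [set i]) w].
  by apply/seteqP; split => w /= => [h|[i iS ->//]]; exists (M v w).
rewrite measure_fin_partition//; last by move=> i j x /= -> ->.
rewrite (eq_bigr (fun=> (#|V|%:R^-1)%:E)); last by move=> i _; exact: law.
by rewrite sumEFin sumr_const; congr EFin; rewrite [RHS]mulr_natl.
Qed.

Lemma marks_avoid_law (s : seq vertex) (bad : vertex -> {set V}) : uniq s ->
  (forall v, v \in s -> nonroot v) ->
  U [set w | forall v, v \in s -> M v w \notin bad v] =
  (\prod_(v <- s) (1 - #|bad v|%:R / #|V|%:R))%:E.
Proof.
case: (hM) => _ mM _ ind us ns.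
have V0 : (#|V|%:R : R) != 0 by rewrite pnatr_eq0 -lt0n; apply/card_gt0P; exists o.
have := ind s (fun v => [set w | M v w \in (~: bad v)%SET]) us.
rewrite (_ : \bigcap_(v in _) _ = [set w | forall v, v \in s -> M v w \notin bad v]); last first.
  by apply/seteqP; split => w h v vs; have := h v vs; rewrite /= finset.inE.
move=> ->; last first.
  move=> v vs; split; first exact: ns.
  apply: sub_sigma_algebra; exists v => //; exists [set x | x \in (~: bad v)%SET] => //.
  by rewrite setTI.
rewrite -prodEFin; apply: eq_big_seq => v vs; rewrite mark_in_law; last exact: ns.
congr EFin.
have -> : (#|(~: bad v)%SET|%:R : R) = #|V|%:R - #|bad v|%:R.
  by apply/eqP; rewrite eq_sym subr_eq addrC -natrD cardsC.
by rewrite mulrBl divff.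
Qed.

Lemma marks_law (I : finType) (vs : I -> vertex) (js : I -> V) : injective vs ->
  (forall i, nonroot (vs i)) ->
  U [set w | forall i, M (vs i) w = js i] = ((#|V|%:R^-1) ^+ #|I|)%:E.
Proof.
case: (hM) => _ mM law ind vsI nv.
have := @independent_inj _ _ _ U _ _ vs _ _ vsI ind (enum I)
  (fun i => M (vs i) @^-1` [set js i]) (enum_uniq I).
rewrite (_ : \bigcap_(v in _) _ = [set w | forall i, M (vs i) w = js i]); last first.
  apply/seteqP; split => w h i; last by move=> _; exact: h.
  exact: (h i (mem_enum I i)).
move=> ->.
  rewrite (eq_bigr (fun=> (#|V|%:R^-1)%:E)); last by move=> i _; exact: law.
  by rewrite prodEFin big_enum/= prodr_const.
move=> i _; split; first exact: nv.
apply: sub_sigma_algebra; exists (vs i) => //; exists [set js i] => //.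
by rewrite setTI.
Qed.

End marks.

Section min_weight_law.
Variables (o : V) (M : vertex -> R -> V) (X : vertex -> {RV U >-> R}).
Hypothesis hM : iid_uniform_marks U o M.
Hypothesis hX : PWIT_weights X.
Hypothesis Lap : forall v, laplace_poisson U (fun k => X (k :: v)).
Variables (I : finType) (vs : I -> vertex) (js : I -> V) (t : I -> R).
Hypothesis vjI : forall i i', vs i = vs i' -> js i = js i' -> i = i'.
Hypothesis t0 : forall i, 0 <= t i.
Local Notation n := (#|V|%:R : R).

Let n0 : 0 < n.
Proof. by rewrite ltr0n; apply/card_gt0P; exists o. Qed.

(** Constraint [i] concerns the row of [vs i] only, where a point carries the mark [js i] with
    probability [1 / n]. Thus [phi v x] is the probability that a child of [v] of weight [x]
    violates no constraint. *)
Let c v i : R := (vs i == v)%:R / n.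
Let B i : set R := `]0, t i[%classic.
Let phi v x : R := 1 - \sum_i c v i * \1_(B i) x.
Let vset := undup [seq vs i | i <- enum I].
Let us K := [seq k :: v | v <- vset, k <- iota 0 K].
Let bad (x : R) (u : vertex) : {set V} :=
  [set js i | i in [set i | (vs i == behead u) && (0 < X u x < t i)]]%SET.

(** Only the first [K] children of each vertex are tested, so that finitely many marks are involved;
    the tail event is the intersection over [K]. *)
Let avoid K : set (R * R) := [set w | forall k i, (k < K)%N ->
  M (k :: vs i) w.2 = js i -> ~~ (0 < X (k :: vs i) w.1 < t i)].

(** By [vjI] the forbidden marks of one row are distinct, so their number is a sum of indicators
    over the constraints. *)
Let card_bad x k v : 1 - #|bad x (k :: v)|%:R / n = phi v (X (k :: v) x).
Proof.
rewrite /phi /bad card_in_imset; last first.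
  move=> i i'; rewrite !finset.inE => /andP[/eqP e _] /andP[/eqP e' _].
  by apply: vjI; rewrite e e'.
congr (1 - _); rewrite -sum1_card big_mkcond/= natr_sum mulr_suml; apply: eq_bigr => i _.
rewrite finset.inE /c indicE /= /B mem_setE/= in_itv/=.
by case: (vs i == v); case: (0 < _ < _); rewrite /= ?(mul0r, mulr0, mulr1).
Qed.

Let c_ge0 v i : 0 <= c v i.
Proof. by rewrite divr_ge0// ltW. Qed.

Let sum_c_le1 v x : \sum_i c v i * \1_(B i) x <= 1.
Proof.
apply: (@le_trans _ _ (\sum_i c v i)).
  apply: ler_sum => i _; rewrite ler_piMr// indicE; by case: (_ \in _).
rewrite /c -mulr_suml ler_pdivrMr// mul1r -natr_sum ler_nat.
rewrite -big_mkcond/= sum1_card -(card_in_imset (f := js)) ?max_card// => i i'.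
by rewrite !unfold_in => /eqP e /eqP e'; apply: vjI; rewrite e e'.
Qed.

Let us_uniq K : uniq (us K).
Proof.
apply: allpairs_uniq; [exact: undup_uniq|exact: iota_uniq|].
by move=> [v k] [v' k'] _ _ /= [-> ->].
Qed.

(** Once the weights are fixed, the marks of the tested children are still independent and uniform,
    so the probabilities of avoiding the forbidden marks multiply. *)
Let section_law K x : U (xsection (avoid K) x) =
  (\prod_(v <- vset) \prod_(k < K) phi v (X (val k :: v) x))%:E.
Proof.
have -> : xsection (avoid K) x = [set y | forall u, u \in us K -> M u y \notin bad x u].
  apply/seteqP; split => y; rewrite /xsection /= inE /avoid /= => h.
    move=> u /allpairsP[[v k] [/= vv]]; rewrite mem_iota add0n => /= kK {u}->.
    apply/imsetP => -[i]; rewrite finset.inE /= => /andP[/eqP ei hX'] eM.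
    by have := h k i kK; rewrite ei eM => /(_ erefl); rewrite hX'.
  move=> k i kK eM; apply/negP => hX'.
  have : k :: vs i \in us K.
    apply/allpairsP; exists (vs i, k); rewrite mem_iota add0n; split => //.
    by rewrite mem_undup; apply: map_f; rewrite mem_enum.
  by move=> /h/imsetP; apply; exists i => //; rewrite finset.inE /= eqxx.
rewrite (marks_avoid_law hM)//; last by move=> u /allpairsP[[v k] [_ _ ->]].
congr EFin; rewrite /us big_allpairs_dep/=; apply: eq_bigr => v _.
rewrite -{1}[K]subn0 -/(index_iota 0 K) big_mkord; apply: eq_bigr => k _; exact: card_bad.
Qed.

Let mphi v : measurable_fun setT (phi v).
Proof.
apply: measurable_funB => //; apply: measurable_sum => i.
apply: measurable_funM => //; apply: measurable_indic; exact: measurable_itv.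
Qed.

Let phi_ge0 v x : 0 <= phi v x.
Proof. by rewrite subr_ge0. Qed.

Let mX u : measurable_fun setT (fun w : R * R => X u w.1).
Proof. by apply: measurableT_comp (measurable_funPT (X u)) _; exact: measurable_fst. Qed.

Let mM u j : measurable [set w : R * R | M u w.2 = j].
Proof.
case: hM => _ mM _ _.
exact: (measurable_preT measurable_snd (mM u j)).
Qed.

Let mprop_fail u i : measurable [set w : R * R | ~~ (0 < X u w.1 < t i)].
Proof.
rewrite (_ : [set _ | _] = [set w | ~ (0 < X u w.1 /\ X u w.1 < t i)]).
  by apply: mprop_not; apply: mprop_and; apply: mprop_lt.
by apply/seteqP; split => w /=; [move=> /negP h [h1 h2]; apply: h; rewrite h1|
  move=> h; apply/negP => /andP].
Qed.

Let m_avoid K : measurable (avoid K).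
Proof.
apply: mprop_forall => k; apply: mprop_forall => i.
apply: mprop_imply; first exact: mprop_cst.
by apply: mprop_imply.
Qed.

Let avoid_law K : (U \x U)%E (avoid K) =
  (\prod_(v <- vset) \int[U]_x (\prod_(k < K) phi v (X (val k :: v) x))%:E)%E.
Proof.
rewrite [LHS](_ : _ = \int[U]_x (\prod_(v <- vset) (\prod_(k < K) phi v (X (val k :: v) x))%:E)%E)%E; last first.
  by apply: eq_integral => x _; rewrite /= section_law prodEFin.
have [_ ind] := hX.
apply: (@expectation_prod_independent _ _ _ U _ setT
  (fun v => sigma_of measurable (children v) X)) => //.
- pose G v := \bigcup_(u in children v) preimage_set_system setT (X u) measurable.
  move=> v _; split; first exact: sigma_of_measurable.
    by move=> A C; exact: (@measurableI _ (g_sigma_algebraType (G v))).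
  exact: (@measurableT _ (g_sigma_algebraType (G v))).
- exact: undup_uniq.
- move=> v _ C mC.
  have -> : (fun x => (\prod_(k < K) phi v (X (val k :: v) x))%:E) =
      (fun x => \prod_(k <- index_enum 'I_K) (phi v (X (val k :: v) x))%:E)%E.
    by apply/funext => x; rewrite prodEFin.
  apply: measurable_prod_salgebra mC => k _ D mD.
  apply: sub_sigma_algebra; exists (val k :: v); first by exists (val k).
  exists ((fun x => (phi v x)%:E) @^-1` D); last by rewrite setTI.
  by apply: measurable_preT mD; apply/measurable_EFinP.
- by move=> v x; rewrite lee_fin; apply: prodr_ge0.
Qed.

Let row_limit v : (\int[U]_x (\prod_(k < K) phi v (X (val k :: v) x))%:E)%E @[K --> \oo] -->
  (expR (- \sum_i c v i * t i))%:E.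
Proof.
have := @Lap v #|I| (fun i => c v (enum_val i)) (fun i => B (enum_val i)).
have e (F : I -> R) : \sum_(i < #|I|) F (enum_val i) = \sum_i F i.
  by rewrite [RHS](reindex (enum_val (A := I)))//=; exists enum_rank => i _; rewrite ?enum_valK ?enum_rankK.
have l i : lebesgue_measure (B i) = (t i)%:E.
  rewrite lebesgue_measure_itv/= lte_fin; case: ltP => h; first by rewrite oppr0 adde0.
  by congr EFin; apply/eqP; rewrite eq_le h t0.
rewrite (_ : \sum_(i < #|I|) c v (enum_val i) * fine (lebesgue_measure (B (enum_val i))) =
   \sum_i c v i * t i); last first.
  by rewrite -(e (fun i => c v i * t i)); apply: eq_bigr => i _; rewrite l.
move=> h; apply: cvg_trans (h _ _ _ _ _) => //.
- apply: near_eq_cvg; near=> K; apply: eq_integral => x _; congr EFin.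
  by apply: eq_bigr => k _; rewrite (e (fun i => c v i * \1_(B i) (X (val k :: v) x))).
- by move=> i; rewrite /B.
- by move=> i x; rewrite /B/= in_itv/= => /andP[].
- by move=> i; rewrite l ltry.
- by move=> x; rewrite (e (fun i => c v i * \1_(B i) x)).
Unshelve. all: end_near. Qed.

(** Rows are independent and each contributes its Laplace functional; constraint [i] enters the
    exponent once, through the row of [vs i], with weight [1 / n]. *)
Lemma tail_min_weight : (U \x U)%E [set w | forall i,
    ((t i)%:E <= min_weight (fun v => X v w.1) (fun v => M v w.2) (vs i) (js i))%E] =
  (expR (- \sum_i t i / n))%:E.
Proof.
rewrite (_ : [set _ | _] = \bigcap_K avoid K); last first.
  apply/seteqP; split => w h.
    by move=> K _ k i _; have /le_min_weight := h i; exact.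
  by move=> i; apply/le_min_weight => k; exact: (h k.+1 Logic.I k i (leqnn _)).
have lim1 : (U \x U)%E (avoid K) @[K --> \oo] --> (U \x U)%E (\bigcap_K avoid K).
  apply: (@nonincreasing_cvg_mu _ _ _ (U \x U)%E avoid) => //.
  - by rewrite prob_lty.
  - exact: bigcapT_measurable.
  - move=> K K' KK; apply/subsetPset => w h k i kK; apply: h; exact: leq_trans KK.
have lim2 : (U \x U)%E (avoid K) @[K --> \oo] --> (\prod_(v <- vset) expR (- \sum_i c v i * t i))%:E.
  rewrite (_ : (fun K => _) = (fun K => \prod_(v <- vset) \int[U]_x (\prod_(k < K) phi v (X (val k :: v) x))%:E)%E).
    by apply: cvg_prode => v; exact: row_limit.
  by apply/funext => K; exact: avoid_law.
rewrite (cvg_unique _ lim1 lim2)//; congr EFin.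
rewrite -expR_sum; congr expR; rewrite sumrN; congr (- _).
rewrite exchange_big/=; apply: eq_bigr => i _; rewrite (bigD1_seq (vs i)) ?undup_uniq//=; last first.
  by rewrite mem_undup; apply: map_f; rewrite mem_enum.
rewrite /c eqxx big1 ?addr0; first by rewrite mul1r mulrC.
by move=> v /negbTE; rewrite eq_sym => ->; rewrite !mul0r.
Qed.

End min_weight_law.
End tails.

(** * Joint tails determine the law *)

Section law_of_tails.
Context {R : realType} {I : finType}.

(* Finite lists of constraints rather than one per coordinate: coordinates may be
   left free, although the values are allowed to be infinite. *)
Definition ray_boxes : set (set (I -> \bar R)) :=
  [set S | exists s : seq (I * R),
    S = [set x | forall p, p \in s -> ((p.2)%:E <= x p.1)%E]].

Definition coord_space := g_sigma_algebraType ray_boxes.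

Lemma measurable_coord i : measurable_fun setT ((fun x => x i) : coord_space -> \bar R).
Proof.
apply: (measurability _ (ErealGenCInfty.measurableE R)) => _ [_ [r ->] <-].
apply: sub_sigma_algebra; exists [:: (i, r)].
rewrite setTI; apply/seteqP; split => x /=; rewrite in_itv/= andbT.
  by move=> rx p; rewrite inE => /eqP->.
by move=> h; exact: (h (i, r) (mem_head _ _)).
Qed.

Lemma ray_boxesI : setI_closed ray_boxes.
Proof.
move=> _ _ [s ->] [s' ->]; exists (s ++ s'); apply/seteqP; split => x /=.
  by move=> [h h'] p; rewrite mem_cat => /orP[/h|/h'].
by move=> h; split => p ps; apply: h; rewrite mem_cat ps ?orbT.
Qed.

(** On nonnegative points all constraints on one coordinate merge into a single threshold, with 0
    where there is none; so joint tails at nonnegative thresholds suffice. *)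
Lemma ray_box_tail (s : seq (I * R)) : exists t : I -> R, (forall i, 0 <= t i) /\
  forall x : I -> \bar R, (forall i, 0 <= x i)%E ->
    (forall p, p \in s -> ((p.2)%:E <= x p.1)%E) <-> (forall i, ((t i)%:E <= x i)%E).
Proof.
elim: s => [|q s [t [t0 ht]]]; first by exists (fun=> 0).
exists (fun i => if i == q.1 then Num.max (t i) q.2 else t i); split.
  by move=> i; case: eqP => // _; rewrite le_max t0.
move=> x x0; have [h1 h2] := ht x x0; split => [h i|h p].
  have hi : ((t i)%:E <= x i)%E by apply: h1 => p ps; apply: h; rewrite inE ps orbT.
  case: eqP => // ei; rewrite EFin_max ge_max hi /= ei; apply: h; exact: mem_head.
have ht' i : ((t i)%:E <= x i)%E.
  by have := h i; case: eqP => // _; apply: le_trans; rewrite lee_fin le_max lexx.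
rewrite inE => /predU1P[->|ps]; last exact: (h2 ht').
by have := h q.1; rewrite eqxx; apply: le_trans; rewrite lee_fin le_max lexx orbT.
Qed.

Lemma same_law_of_tails d1 d2 (T1 : measurableType d1) (T2 : measurableType d2)
    (P1 : probability T1 R) (P2 : probability T2 R) Z1 Z2 :
  (forall i t, measurable [set w : T1 | (t%:E <= Z1 w i)%E]) ->
  (forall i t, measurable [set w : T2 | (t%:E <= Z2 w i)%E]) ->
  (forall w i, 0 <= Z1 w i)%E -> (forall w i, 0 <= Z2 w i)%E ->
  (forall t : I -> R, (forall i, 0 <= t i) ->
    P1 [set w | forall i, ((t i)%:E <= Z1 w i)%E] =
    P2 [set w | forall i, ((t i)%:E <= Z2 w i)%E]) ->
  forall S : set coord_space, measurable S -> P1 (Z1 @^-1` S) = P2 (Z2 @^-1` S).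
Proof.
move=> m1 m2 Z10 Z20 tails S mS.
have mZ d (T : measurableType d) (Z : T -> coord_space) :
    (forall i t, measurable [set w : T | (t%:E <= Z w i)%E]) -> measurable_fun setT Z.
  move=> mt; apply: (@measurability _ _ T coord_space setT Z ray_boxes erefl).
  move=> _ [_ [s ->] <-]; rewrite setTI.
  exact: (measurable_capl (A := fun p => [set w : T | ((p.2)%:E <= Z w p.1)%E])).
have := @measure_unique_pi R _ coord_space
  (distribution P1 (mkRV P1 (mZ _ _ Z1 m1))) (distribution P2 (mkRV P2 (mZ _ _ Z2 m2))) ray_boxes.
apply => //.
- by move=> A GA; exact: sub_sigma_algebra.
- exact: ray_boxesI.
- exact: prob_lty.
- by transitivity (1%E : \bar R); [|apply/esym]; exact: probability_setT.
- move=> _ [s ->]; have [t [t0 ht]] := ray_box_tail s.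
  have := tails t t0; rewrite /distribution /pushforward /=.
  move=> h; etransitivity; last (etransitivity; first exact: h).
    by congr (P1 _); apply/seteqP; split => w /(ht _ (Z10 w)).
  by congr (P2 _); apply/seteqP; split => w /(ht _ (Z20 w)).
Qed.

End law_of_tails.
Arguments coord_space : clear implicits.

(** * Prim's algorithm on K_n *)

Section prim.
Context {R : realType} {V : finType}.
Implicit Types (x : {set V} -> R) (lab : nat -> V) (par : nat -> nat).

(* Prim's algorithm on K_n discovers [lab 1], ..., [lab m] in this order, through
   edges of length at most [K] beating all other edges leaving the tree by [delta]. *)
Definition prim_run x lab par m (K delta : R) :=
  forall k, (k < m)%N -> x (tree_edge lab par k) <= K /\
    forall s j, (s <= k)%N -> (forall i, (i <= k)%N -> j <> lab i) ->
      (s, j) <> (par k, lab k.+1) ->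
      x (tree_edge lab par k) + delta <= x [set lab s; j]%SET.

(** At the first disagreement each of the two arcs would have to beat the other by [delta]. This
    makes the Prim events of different labelled trees disjoint. *)
Lemma prim_run_unique x lab lab' par par' m K delta : 0 < delta -> lab 0 = lab' 0 ->
  (forall s t, (s <= m)%N -> (t <= m)%N -> lab s = lab t -> s = t) ->
  (forall s t, (s <= m)%N -> (t <= m)%N -> lab' s = lab' t -> s = t) ->
  (forall k, (k < m)%N -> (par k <= k)%N) -> (forall k, (k < m)%N -> (par' k <= k)%N) ->
  prim_run x lab par m K delta -> prim_run x lab' par' m K delta ->
  forall k, (k < m)%N -> par k = par' k /\ lab k.+1 = lab' k.+1.
Proof.
move=> d0 l0 linj linj' ple ple' h h'; elim/ltn_ind => k IH km.
have el i : (i <= k)%N -> lab i = lab' i.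
  by case: i => // i ik; have [] := IH i ik (ltn_trans ik km).
have [_ h1] := h k km; have [_ h2] := h' k km.
have [[ep elk]|ne] := pselect ((par k, lab k.+1) = (par' k, lab' k.+1)); first by [].
have := h1 (par' k) (lab' k.+1) (ple' k km).
have := h2 (par k) (lab k.+1) (ple k km).
rewrite -/(tree_edge _ _ _) (el (par' k)) ?ple'// -(el (par k)) ?ple// -!/(tree_edge _ _ _).
move=> c1 c2; exfalso.
have := c1 _ ne; have := c2 _ (nesym ne).
have n1 i : (i <= k)%N -> lab k.+1 <> lab' i.
  move=> ik; rewrite -el// => /(linj _ _ km (leq_trans ik (ltnW km))) e.
  by rewrite -e ltnn in ik.
have n2 i : (i <= k)%N -> lab' k.+1 <> lab i.
  move=> ik; rewrite el// => /(linj' _ _ km (leq_trans ik (ltnW km))) e.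
  by rewrite -e ltnn in ik.
by move=> /(_ n2) a1 /(_ n1) a2; lra.
Qed.

Lemma SWT_prim_run x (f : R -> R) lab par m K delta : 0 < delta ->
  (forall s t, (s <= m)%N -> (t <= m)%N -> lab s = lab t -> s = t) ->
  (forall k, (k < m)%N -> (par k <= k)%N) ->
  (forall e, 0 < x e) -> (forall y, 0 < y -> 0 < f y) ->
  (forall y z, 0 < y -> y <= K -> y + delta <= z -> m.+1%:R * f y <= f z) ->
  prim_run x lab par m K delta -> forall k, (k <= m)%N ->
  SWT (f \o x) (lab 0) (SWT_time (f \o x) (lab 0) k) = tree_graph lab par k.
Proof.
move=> d0 linj ple x0 f0 fratio h k km.
apply: (SWT_separated_tree _ linj ple _ km); first by move=> e; exact: f0.
move=> i s j im si nj ne; have [h1 h2] := h i im.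
exact: fratio (x0 _) h1 (h2 s j si nj ne).
Qed.

End prim.

(** * A run is at most as likely as the matching Prim event *)

Section domination.
Context {R : realType} {V : finType}.
Local Notation U := (@U01 R).
Variables (o : V) (E : {set V} -> {RV U >-> R}) (X : vertex -> {RV U >-> R}) (M : vertex -> R -> V).
Hypothesis hE : iid_exp1_edges E.
Hypothesis tailE : forall e s, 0 <= s -> U [set w | s <= E e w] = (expR (- s))%:E.
Hypothesis E0 : forall e w, 0 < E e w.
Hypothesis hX : PWIT_weights X.
Hypothesis Lap : forall v, laplace_poisson U (fun k => X (k :: v)).
Hypothesis hM : iid_uniform_marks U o M.
Variables (m : nat) (K delta : R).
Local Notation n := (#|V|%:R : R).

Definition edge_event lab par : set R :=
  [set w | prim_run (fun e => n * E e w) lab par m K delta].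

(** Positivity of the weights of the run is recorded because [min_weight] looks at positive weights
    only, and weights are positive only almost surely. *)
Definition weight_event par : set R :=
  [set w | invasion_run (fun v => X v w) par m K delta /\
           forall k, (k < m)%N -> 0 < X (word par k.+1) w].

Definition mark_event lab par : set R :=
  [set w | forall s, (s <= m)%N -> M (word par s) w = lab s].

Let mE e : measurable_fun setT (fun w => n * E e w).
Proof. by apply: measurable_funM => //; exact: measurable_funPT. Qed.

Let mXv v : measurable_fun setT (fun w => X v w).
Proof. exact: measurable_funPT. Qed.

Lemma measurable_edge_event lab par : measurable (edge_event lab par).
Proof.
apply: mprop_forall => k; apply: mprop_imply; first exact: mprop_cst.
apply: mprop_and; first by apply: mprop_le.
apply: mprop_forall => s; apply: mprop_forall => j; do 3 (apply: mprop_imply; first exact: mprop_cst).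
by apply: mprop_le => //; apply: measurable_funD.
Qed.

Lemma measurable_weight_event par : measurable (weight_event par).
Proof.
apply: mprop_and; last first.
  by apply: mprop_forall => k; apply: mprop_imply; [exact: mprop_cst|exact: mprop_lt].
apply: mprop_forall => k; apply: mprop_imply; first exact: mprop_cst.
apply: mprop_and; first by apply: mprop_le.
apply: mprop_forall => u; do 2 (apply: mprop_imply; first exact: mprop_cst).
by apply: mprop_le => //; apply: measurable_funD.
Qed.

Lemma measurable_mark_event lab par : measurable (mark_event lab par).
Proof.
case: hM => _ mM _ _.
by apply: mprop_forall => s; apply: mprop_imply; [exact: mprop_cst|exact: mM].
Qed.

Lemma mark_event_law lab par : lab 0 = o -> (forall k, (k < m)%N -> (par k <= k)%N) ->
  U (mark_event lab par) = ((n^-1) ^+ m)%:E.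
Proof.
move=> l0 ple.
have inj : injective (fun i : 'I_m => word par i.+1).
  by move=> i j /(word_inj ple (ltn_ord i) (ltn_ord j))[] /val_inj.
rewrite -{1}(card_ord m) -(marks_law hM (fun i : 'I_m => lab i.+1) inj); last first.
  by move=> i; rewrite wordS// ple.
congr (U _); apply/seteqP; split => w h; first by move=> i; exact: h.
case=> [|s] sm; first by rewrite l0; case: hM => M0 _ _ _; exact: M0.
exact: (h (Ordinal sm)).
Qed.

Section fixed_tree.
Variables (lab : nat -> V) (par : nat -> nat).
Hypothesis lab_inj : forall s t, (s <= m)%N -> (t <= m)%N -> lab s = lab t -> s = t.
Hypothesis par_le : forall k, (k < m)%N -> (par k <= k)%N.

(* Exit arcs [(s, j)]: edges from node [s] to a vertex [j] outside [lab 0], ..., [lab s]. *)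
Let exits := {p : 'I_m * V | [forall i : 'I_m, (i <= p.1)%N ==> (p.2 != lab i)]}.
Let es (p : exits) : {set V} := [set lab (val p).1; (val p).2]%SET.
Let vs (p : exits) : vertex := word par (val p).1.
Let js (p : exits) : V := (val p).2.

Let exitsP (p : exits) i : (i <= (val p).1)%N -> (val p).2 <> lab i.
Proof.
move=> ip; have im : (i < m)%N := leq_ltn_trans ip (ltn_ord _).
by have /forallP/(_ (Ordinal im)) := valP p; rewrite /= ip => /eqP.
Qed.

Let mk_exit s j : (s < m)%N -> (forall i, (i <= s)%N -> j <> lab i) ->
  exists p : exits, (val p).1 = s :> nat /\ (val p).2 = j.
Proof.
move=> sm nj.
have h : [forall i : 'I_m, (i <= (Ordinal sm, j).1)%N ==> ((Ordinal sm, j).2 != lab i)].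
  by apply/forallP => i; apply/implyP => /= /nj/eqP.
by exists (exist _ (Ordinal sm, j) h).
Qed.

Let exit_eq (p q : exits) : (val p).1 = (val q).1 :> nat -> (val p).2 = (val q).2 -> p = q.
Proof.
by case: p q => [[a b] h] [[a' b'] h'] /= /val_inj ea eb; apply: val_inj; rewrite /= ea eb.
Qed.

(** An exit never leads to the label of an earlier node, so an edge of K_n is counted from its
    earlier end only. Thus the lengths attached to exits are independent, as the corresponding
    minimal weights are. *)
Let es_inj : injective es.
Proof.
suff lt p q : es p = es q -> ~ ((val p).1 < (val q).1)%N.
  move=> p q e; have e1 : (val p).1 = (val q).1 :> nat.
    by case: (ltngtP (val p).1 (val q).1) => // /lt []//.
  apply: exit_eq => //; have : (val p).2 \in es q by rewrite -e !finset.inE eqxx orbT.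
  rewrite !finset.inE => /orP[/eqP h|/eqP//].
  by case: (@exitsP p (val q).1) => //; rewrite e1.
move=> e pq; have : lab (val q).1 \in es p by rewrite e !finset.inE eqxx.
rewrite !finset.inE => /orP[/eqP/lab_inj h|/eqP h].
  by move: pq; rewrite h ?ltnn// ltnW// ltn_ord.
have : lab (val p).1 \in es q by rewrite -e !finset.inE eqxx.
rewrite !finset.inE => /orP[/eqP/lab_inj h'|/eqP h'].
  by move: pq; rewrite h' ?ltnn// ltnW// ltn_ord.
by apply: (@exitsP q (val p).1); rewrite 1?ltnW.
Qed.

Let es_K p : Kedges V (es p).
Proof.
by rewrite /Kedges /= /es cards2; case: eqVneq => // e; case: (@exitsP p (val p).1).
Qed.

Let vjI p q : vs p = vs q -> js p = js q -> p = q.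
Proof.
move=> /(word_inj par_le) h; apply: exit_eq; apply: h; exact/ltnW/ltn_ord.
Qed.

(** Prim's event written in the coordinates indexed by exits, so that it can be evaluated both on
    [Z1] and on [Z2]. *)
Let separated : set (coord_space R exits) :=
  [set x : exits -> \bar R | forall (k : nat) (p : exits), (k < m)%N ->
    (val p).1 = par k :> nat -> (val p).2 = lab k.+1 ->
    (x p <= K%:E)%E /\ forall q : exits, ((val q).1 <= k)%N ->
      (forall i, (i <= k)%N -> (val q).2 <> lab i) -> q <> p ->
      (x p + delta%:E <= x q)%E].

Let measurable_separated : measurable separated.
Proof.
have mle (f g : coord_space R exits -> \bar R) : measurable_fun setT f ->
    measurable_fun setT g -> measurable [set x | (f x <= g x)%E].
  by move=> mf mg; rewrite -[X in measurable X]setTI; exact: measurable_lee.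
have mc p := @measurable_coord R exits p.
apply: mprop_forall => k; apply: mprop_forall => p.
do 3 (apply: mprop_imply; first exact: mprop_cst).
apply: mprop_and; first exact: (mle _ (cst K%:E)).
apply: mprop_forall => q; do 3 (apply: mprop_imply; first exact: mprop_cst).
by apply: mle => //; apply: emeasurable_funD.
Qed.

Let Z1 w p : \bar R := (n * E (es p) w)%:E.
Let Z2 (w : R * R) p : \bar R := min_weight (fun v => X v w.1) (fun v => M v w.2) (vs p) (js p).

Let edge_eventE : edge_event lab par = Z1 @^-1` separated.
Proof.
apply/seteqP; split => w /= h.
  move=> k p km e1 e2; have [h1 h2] := h k km; rewrite /Z1 lee_fin.
  have ep : es p = tree_edge lab par k by rewrite /es e1 e2.
  rewrite ep; split => // q qk nq ne; rewrite -EFinD lee_fin; apply: h2 => // -[e3 e4].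
  by apply: ne; apply: exit_eq; rewrite ?e1 ?e2.
move=> k km; have pm : (par k < m)%N := leq_ltn_trans (par_le km) km.
have nl i : (i <= par k)%N -> lab k.+1 <> lab i.
  move=> ip /(lab_inj km (leq_trans ip (leq_trans (par_le km) (ltnW km)))) e.
  by move: ip; rewrite -e ltnNge par_le.
have [p [e1 e2]] := mk_exit pm nl.
have [] := h k p km e1 e2; rewrite /Z1 lee_fin /es e1 e2 -/(tree_edge _ _ _) => h1 h2.
split=> // s j sk nj ne.
have [q [e3 e4]] := mk_exit (leq_ltn_trans sk km) (fun i is_ => nj i (leq_trans is_ sk)).
have := h2 q; rewrite e3 e4 -EFinD lee_fin; apply => // eq.
by apply: ne; rewrite -e3 -e4 eq e1 e2.
Qed.

(** Only an inclusion: the run also beats children whose mark is already a label of the tree, about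
    which [separated] says nothing. *)
Let weight_mark_sub : weight_event par `*` mark_event lab par `<=` Z2 @^-1` separated.
Proof.
move=> w [[run X0] hMk] k p km e1 e2.
have [h1 h2] := run k km.
have pm := leq_trans (par_le km) (ltnW km).
have le_p : (Z2 w p <= (X (word par k.+1) w.1)%:E)%E.
  rewrite /Z2 /js e2 -(hMk k.+1 km) /vs e1 wordS ?par_le//.
  by apply: min_weight_le; rewrite -wordS ?par_le// X0.
split; first by apply: le_trans le_p _; rewrite lee_fin.
move=> q qk nq ne; apply: (@le_trans _ _ ((X (word par k.+1) w.1 + delta)%:E)%E).
  by rewrite EFinD leeD2r.
(* Any child with the mark of [q] lies on the boundary, as that mark is not yet used, and it is not
   the winner, as [q <> p]. *)
apply/le_min_weight => j Mj; apply/negP => /andP[_]; apply/negP; rewrite -leNgt.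
apply: h2.
  split => //=; last by exists (val q).1.
  move=> [i /= ik ei]; rewrite ltnS in ik; apply: (nq i ik).
  by rewrite -(hMk i (leq_trans ik (ltnW km))) ei Mj.
move=> e; apply: ne; move: (e); rewrite wordS ?par_le// => -[_] /(word_inj par_le) ev.
apply: exit_eq; first by rewrite e1; apply: ev => //; exact/ltnW/ltn_ord.
by rewrite e2 -(hMk k.+1 km) -e Mj.
Qed.

(** [Z1] and [Z2] have equal joint tails, hence equal laws. The edge event is the preimage of
    [separated] under [Z1], while the run with its marks lies in the preimage under [Z2]. *)
Lemma run_domination :
  ((U \x U) (weight_event par `*` mark_event lab par) <= U (edge_event lab par))%E.
Proof.
have n0 : 0 < n by rewrite ltr0n; apply/card_gt0P; exists o.
have mZ2 p t : measurable [set w : R * R | (t%:E <= Z2 w p)%E].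
  rewrite (_ : [set _ | _] = [set w | forall k, M (k :: vs p) w.2 = js p ->
     ~ (0 < X (k :: vs p) w.1 /\ X (k :: vs p) w.1 < t)]).
    apply: mprop_forall => k; apply: mprop_imply.
      by case: hM => _ mM _ _; exact: (measurable_preT measurable_snd (mM _ _)).
    have mXk : measurable_fun setT (fun w : R * R => X (k :: vs p) w.1).
      by apply: measurableT_comp (mXv _) _; exact: measurable_fst.
    by apply: mprop_not; apply: mprop_and; exact: mprop_lt.
  apply/seteqP; split => w /=.
    by move=> /le_min_weight h k /h /negP + [h1 h2]; apply; rewrite h1.
  by move=> h; apply/le_min_weight => k /h h'; apply/negP => /andP.
have mZ1 p t : measurable [set w : R | (t%:E <= Z1 w p)%E].
  by rewrite (_ : [set _ | _] = [set w | t <= n * E (es p) w]) //; exact: mprop_le.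
rewrite edge_eventE.
rewrite (@same_law_of_tails R exits _ _ _ _ U (U \x U)%E Z1 Z2)//.
- apply: prob_le => //.
    by apply: measurableX; [exact: measurable_weight_event|exact: measurable_mark_event].
  rewrite -[X in measurable X]setTI.
  apply: (@measurability _ _ _ (coord_space R exits) setT Z2 (ray_boxes (R := R) (I := exits)) erefl) measurable_separated => //.
  move=> _ [_ [s ->] <-]; rewrite setTI.
  exact: (measurable_capl (A := fun p => [set w : R * R | ((p.2)%:E <= Z2 w p.1)%E])).
- by move=> w p; rewrite lee_fin mulr_ge0 ?ltW.
- by move=> w p; exact: min_weight_ge0.
- move=> t t0; etransitivity; last exact: esym (tail_min_weight hM hX Lap vjI t0).
  rewrite -(tail_edges hE tailE es_inj es_K t0 n0).
  by congr (U _); apply/seteqP; split => w h p; have := h p; rewrite lee_fin.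
Qed.

End fixed_tree.
End domination.

(** * Probability of a run *)

Lemma prob_null (R : realType) d (T : measurableType d) (P : probability T R) A :
  measurable A -> {ae P, forall w, ~ A w} -> P A = 0%E.
Proof.
move=> mA [N [mN N0 sub]]; apply/eqP; rewrite -measure_le0.
have AN : A `<=` N by move=> w Aw; apply: sub => /(_ Aw).
by have := @prob_le _ _ _ P _ _ mA mN AN; rewrite [X in (_ <= X)%E -> _]N0.
Qed.

Section PWIT_generic.
Context {R : realType} {d : measure_display} {T : measurableType d}.
Variables (P : probability T R) (X : vertex -> {RV P >-> R}).
Hypothesis hX : PWIT_weights X.

Lemma ae_forall_count (J : countType) (Q : J -> T -> Prop) :
  (forall j, {ae P, forall w, Q j w}) -> {ae P, forall w, forall j, Q j w}.
Proof.
move=> h; have : {ae P, forall w, forall k, if unpickle k is Some j then Q j w else True}.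
  by apply: ae_foralln => k; case: (unpickle k) => [j|]; [exact: h|exact: aeW].
by apply: filterS => w hw j; have := hw (pickle j); rewrite pickleK.
Qed.

Lemma row_ae v : {ae P, forall w, 0 < X (0%N :: v) w /\ forall k, X (k :: v) w < X (k.+1 :: v) w}.
Proof. by have [/(_ v)[]] := hX. Qed.

Lemma weight_gt0_ae v : nonroot v -> {ae P, forall w, 0 < X v w}.
Proof.
case: v => // k v _; apply: filterS (row_ae v) => w [x0 xS].
by elim: k => // k; move=> /lt_trans; apply.
Qed.

(** For [x > 0] the singleton has Lebesgue measure 0, so its Poisson count vanishes almost surely;
    other values are excluded by positivity. *)
Lemma weight_point_null v x : nonroot v -> P (X v @^-1` [set x]) = 0%E.
Proof.
move=> nv; have mx : measurable (X v @^-1` [set x]).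
  by apply: measurable_preT => //; exact: measurable_funPT.
have [x0|x0] := leP x 0.
  apply: (prob_null mx); apply: filterS (weight_gt0_ae nv) => w + Xw.
  by rewrite Xw ltNge x0.
case: v => // k v in nv mx *.
have [/(_ v)[_ /(_ 1%N (fun=> [set x]) (fun=> 0%N)) cnt] _] := hX.
have mC : measurable (iscnt (fun k => X (k :: v)) [set x] 0).
  by apply: measurable_iscnt => // k'; exact: measurable_funPT.
have C1 : P (iscnt (fun k => X (k :: v)) [set x] 0) = 1%E.
  have -> : iscnt (fun k => X (k :: v)) [set x] 0 = \bigcap_(i in [set: 'I_1])
      [set w | ([set k | [set x] (X (k :: v) w)] #= `I_0)%card].
    by apply/seteqP; split => w; [move=> h i _|move/(_ ord0); exact].
  rewrite cnt.
  - by rewrite big_ord1 lebesgue_measure_set1 /= poisson_prob_set1// /pois oppr0 expR0 expr0 fact0 divr1 mulr1.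
  - by move=> i; split => //; [move=> y /= ->|rewrite lebesgue_measure_set1].
  - by move=> i j _ _ _; rewrite !ord1.
apply: (prob_null mx); exists (~` iscnt (fun k => X (k :: v)) [set x] 0); split.
- exact: measurableC.
- by rewrite [LHS]probability_setC// [X in (_ - X)%E]C1 -EFinB subrr.
- move=> w /= /contrapT Xw; rewrite /iscnt /= II0 card_eq0 => /eqP/seteqP[/(_ k Xw)].
  by [].
Qed.

(** Within a row the weights increase strictly; across rows they are independent and have no
    atoms. *)
Lemma weight_tie_ae u v : nonroot u -> nonroot v -> u <> v -> {ae P, forall w, X u w <> X v w}.
Proof.
case: u v => // i u [//|j v] _ nv ne.
have [e|nuv] := eqVneq u v.
  rewrite e in ne *; apply: filterS (row_ae v) => w [_ xS].
  have mono a b : (a < b)%N -> X (a :: v) w < X (b :: v) w.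
    elim: b => // b IH; rewrite ltnS leq_eqVlt => /predU1P[->//|/IH h].
    exact: lt_trans h (xS b).
  case: (ltngtP i j) => [h|h|h]; last by rewrite h in ne.
    by have := mono _ _ h => /[swap] ->; rewrite ltxx.
  by have := mono _ _ h => /[swap] ->; rewrite ltxx.
have [|] := @tie_null _ _ _ P (X (i :: u)) (X (j :: v)) _ (fun x => weight_point_null x nv).
  move=> A B mA mB; have [_ ind] := hX.
  have := ind [:: u; v] (fun a => if a == u then X (i :: u) @^-1` A else X (j :: v) @^-1` B).
  rewrite /= inE andbT nuv => /(_ isT).
  rewrite !bigcap_cons_seq bigcap_nil_seq setIT !big_cons big_nil mule1.
  rewrite eqxx eq_sym (negbTE nuv); apply => a; rewrite !inE => /orP[/eqP->|/eqP->].
    rewrite eqxx; split => //; apply: sub_sigma_algebra; exists (i :: u); first by exists i.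
    by exists A => //; rewrite setTI.
  rewrite eq_sym (negbTE nuv); split => //; apply: sub_sigma_algebra; exists (j :: v); first by exists j.
  by exists B => //; rewrite setTI.
by move=> mt t0; exists [set w | X (i :: u) w = X (j :: v) w]; split => // w /= /contrapT.
Qed.

Lemma weights_generic_ae : {ae P, forall w,
  (forall v k, X (k :: v) w < X (k.+1 :: v) w) /\
  (forall u v, nonroot u -> nonroot v -> X u w = X v w -> u = v) /\
  forall v, nonroot v -> 0 < X v w}.
Proof.
have h1 : {ae P, forall w, forall v k, X (k :: v) w < X (k.+1 :: v) w}.
  by apply: (ae_forall_count (J := vertex)) => v; apply: filterS (row_ae v) => w [].
have h2 : {ae P, forall w, forall u v, nonroot u -> nonroot v -> X u w = X v w -> u = v}.
  apply: (ae_forall_count (J := vertex)) => u; apply: (ae_forall_count (J := vertex)) => v.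
  have [nu|] := pselect (nonroot u); last by move=> nu; apply: aeW => w /nu.
  have [nv|] := pselect (nonroot v); last by move=> nv; apply: aeW => w _ /nv.
  have [->|ne] := pselect (u = v); first exact: aeW.
  by apply: filterS (weight_tie_ae nu nv ne) => w h _ _ /h.
have h3 : {ae P, forall w, forall v, nonroot v -> 0 < X v w}.
  apply: (ae_forall_count (J := vertex)) => v.
  have [nv|] := pselect (nonroot v); last by move=> nv; apply: aeW => w /nv.
  by apply: filterS (weight_gt0_ae nv).
by apply: filterS3 h1 h2 h3.
Qed.

End PWIT_generic.

Section run_probability.
Context {R : realType}.
Local Notation U := (@U01 R).
Variables (X : vertex -> {RV U >-> R}) (m : nat).
Hypothesis hX : PWIT_weights X.

(** Shapes as a finite type, so that the events of the different shapes can be summed and glued. *)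
Definition parents := {ffun 'I_m -> 'I_m}.
Definition par_of (f : parents) (k : nat) : nat :=
  if insub k is Some i then (f i : nat) else 0%N.
Definition valid_parents : pred parents := fun f => [forall i, (f i <= i)%N].

Lemma par_ofE (f : parents) (i : 'I_m) : par_of f i = f i.
Proof. by rewrite /par_of valK. Qed.

Lemma par_of_le f k : valid_parents f -> (k < m)%N -> (par_of f k <= k)%N.
Proof. by move=> /forallP h km; rewrite (par_ofE f (Ordinal km)); exact: h. Qed.

Lemma weight_event_disjoint K delta f g w : 0 < delta -> valid_parents f -> valid_parents g ->
  weight_event X m K delta (par_of f) w -> weight_event X m K delta (par_of g) w -> f = g.
Proof.
move=> d0 vf vg [hf _] [hg _]; apply/ffunP => i; apply: val_inj; rewrite /= -!par_ofE.
by apply: (invasion_run_unique _ _ d0 hf hg) => // k; exact: par_of_le.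
Qed.

(** Both bounds relax as [i] grows, so the events increase; their union is almost sure. *)
Let F (i : nat) : set R :=
  [set w | exists2 f, valid_parents f & weight_event X m i%:R i.+1%:R^-1 (par_of f) w].

Let mF i : measurable (F i).
Proof.
rewrite (_ : F i = [set w | exists f, valid_parents f /\ weight_event X m i%:R i.+1%:R^-1 (par_of f) w]).
  apply: mprop_exists => f; apply: mprop_and; first exact: mprop_cst.
  exact: measurable_weight_event.
by apply/seteqP; split => w [f]; [move=> h1 h2; exists f|move=> [h1 h2]; exists f].
Qed.

Let F_nd i j : (i <= j)%N -> F i `<=` F j.
Proof.
move=> ij w [f vf [h h']]; exists f => //; split => //; apply: invasion_run_weaken h.
  by rewrite ler_nat.
by rewrite lef_pV2 ?posrE ?ltr0n// ler_nat.
Qed.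

Let F_full : {ae U, forall w, (\bigcup_i F i) w}.
Proof.
apply: filterS (weights_generic_ae hX) => w [incr [inj pos]].
have [par [ple [K [delta [d0 run]]]]] := invasion_run_exists m incr inj.
pose f : parents := [ffun i : 'I_m => insubd i (par i)].
have fE k : (k < m)%N -> par_of f k = par k.
  move=> km; rewrite (par_ofE f (Ordinal km)) ffunE val_insubd.
  by rewrite (leq_ltn_trans (ple _ km) km).
have ew k : (k <= m)%N -> word (par_of f) k = word par k.
  by move=> km; apply: word_ext => r rk; apply: fE; exact: leq_trans rk km.
have vf : valid_parents f.
  by apply/forallP => i; rewrite -par_ofE fE// ple.
have d0' : 0 <= delta^-1 by rewrite invr_ge0 ltW.
exists (maxn (Num.truncn K).+1 (Num.truncn delta^-1)) => //; exists f => //; split; last first.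
  by move=> k km; apply: pos; rewrite wordS// par_of_le.
have run' : invasion_run (fun v => X v w) (par_of f) m K delta.
  move=> k km; rewrite ew//; have [h1 h2] := run k km; split => // u.
  rewrite (_ : prefix_words (par_of f) k = prefix_words par k); first exact: h2.
  by apply/seteqP; split => _ [i /= ik <-]; exists i => //; rewrite ew// (leq_trans _ km)// ltnW.
apply: invasion_run_weaken run'.
  apply: (@le_trans _ _ (Num.truncn K).+1%:R); first by apply/ltW/truncnS_gt.
  by rewrite ler_nat leq_maxl.
rewrite -[leRHS]invrK lef_pV2 ?posrE ?ltr0n ?invr_gt0//.
apply: (@le_trans _ _ (Num.truncn delta^-1).+1%:R); first by apply/ltW/truncnS_gt.
by rewrite ler_nat ltnS leq_maxr.
Qed.

Lemma run_probability e : 0 < e -> exists K delta, 0 < delta /\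
  1 - e <= \sum_(f | valid_parents f) fine (U (weight_event X m K delta (par_of f))).
Proof.
move=> e0.
have mFU : measurable (\bigcup_i F i) by exact: bigcup_measurable.
have FU1 : U (\bigcup_i F i) = 1%E.
  have : U (~` \bigcup_i F i) = 0%E.
    by apply: (prob_null (measurableC mFU)); apply: filterS F_full => w Fw; apply.
  rewrite probability_setC// -(fineK (prob_fin (P := U) mFU)) -EFinB => -[] h; congr EFin; lra.
have lim : U (F i) @[i --> \oo] --> 1%E.
  rewrite -FU1; apply: (@nondecreasing_cvg_mu _ _ _ U F) => // i j ij.
  by apply/subsetPset; exact: F_nd.
have [i _ hi] : \forall i \near \oo, 1 - e <= fine (U (F i)).
  by apply: (cvgr_ge _ (fine_cvg lim)); rewrite ltrBlDr ltrDl.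
exists i%:R, i.+1%:R^-1; split; first by rewrite invr_gt0 ltr0n.
apply: le_trans (hi i (leqnn i)) _.
pose G f := [set w | valid_parents f /\ weight_event X m i%:R i.+1%:R^-1 (par_of f) w].
have GE f : valid_parents f -> G f = weight_event X m i%:R i.+1%:R^-1 (par_of f).
  by move=> vf; apply/seteqP; split => w; [case|split].
rewrite (_ : F i = [set w | exists2 f, valid_parents f & G f w]); last first.
  by apply/seteqP; split => w [f vf]; [move=> h; exists f|move=> [_ h]; exists f].
rewrite measure_fin_partition.
- rewrite (eq_bigr (fun f => (fine (U (weight_event X m i%:R i.+1%:R^-1 (par_of f))))%:E)).
    by rewrite sumEFin.
  by move=> f vf; rewrite GE// fineK// prob_fin//; exact: measurable_weight_event.
- by move=> f vf; rewrite GE//; exact: measurable_weight_event.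
- move=> f g w [vf hf] [vg]; apply: weight_event_disjoint vf vg hf.
  by rewrite invr_gt0 ltr0n.
Qed.

End run_probability.

(** * The coupling *)

(** Monotonicity is known on the positive reals only, where [f] takes its values; sublevel sets of
    [h] there are intervals. *)
Lemma measurable_incr_comp (R : realType) d (T : measurableType d) (h : R -> R) (f : T -> R) :
  (forall x y, 0 < x -> x < y -> h x < h y) -> (forall w, 0 < f w) ->
  measurable_fun setT f -> measurable_fun setT (h \o f).
Proof.
move=> hincr f0 mf; apply: measurable_fun_ray => t.
have -> : [set w | (h \o f) w <= t] = f @^-1` [set x | 0 < x /\ h x <= t].
  by apply/seteqP; split => w /=; [|case].
apply: measurable_preT => //; apply: is_interval_measurable => x y [x0 hx] [y0 hy] z /andP[xz zy].
split; first exact: lt_le_trans xz.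
by move: zy; rewrite le_eqVlt => /predU1P[->//|/hincr h1]; apply/ltW/(lt_le_trans _ hy)/h1/(lt_le_trans x0).
Qed.

Section gluing.
Context {R : realType} {N : nat}.
Local Notation U := (@U01 R).
Local Notation V := 'I_N.+1.
Local Notation n := (N.+1%:R : R).
Variables (E : {set V} -> {RV U >-> R}) (X : vertex -> {RV U >-> R}) (M : vertex -> R -> V).
Hypothesis hE : iid_exp1_edges E.
Hypothesis tailE : forall e s, 0 <= s -> U [set w | s <= E e w] = (expR (- s))%:E.
Hypothesis E0 : forall e w, 0 < E e w.
Hypothesis hX : PWIT_weights X.
Hypothesis Lap : forall v, laplace_poisson U (fun k => X (k :: v)).
Hypothesis hM : iid_uniform_marks U (ord0 : V) M.
Variable h : R -> R.
Hypothesis h_gt0 : forall x, 0 < x -> 0 < h x.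
Hypothesis h_incr : forall x y, 0 < x -> x < y -> h x < h y.

Lemma measurable_glued_event (Q : probability (R * (R * R))%type R)
    (Q1 : forall S, measurable S -> Q (S `*` setT) = U S)
    (Q2 : forall S, measurable S -> Q (setT `*` S) = (U \x U)%E S) m :
  measurable (SWT_eq_IP_upto (glued hE hX hM (Q := Q) Q1 Q2) h m).
Proof.
pose C := glued hE hX hM Q1 Q2.
have mM v i : measurable (cM C v @^-1` [set i]) by case: (cM_law C) => _ mM _ _; exact: mM.
apply: (@measurable_SWT_eq_mark_image R _ (cspace C) V ord0 (fun e w => h (cE C e w)) _ _
  (fun v => cX C v) (cM C) _ mM m).
- move=> e; apply: (measurable_incr_comp (h := h) (f := cE C e)) => //.
  by move=> w; exact: E0.
- by move=> e w; apply: h_gt0; exact: E0.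
- by move=> v; exact: (measurable_funPT (cX C v)).
Qed.

Section upto.
Variables (m : nat) (K delta : R).
Hypothesis d0 : 0 < delta.
Hypothesis ratio : forall y z, 0 < y -> y <= K -> y + delta <= z ->
  m.+1%:R * h (y / n) <= h (z / n).

Let labels := {ffun 'I_m -> V}.
Let lab_of (l : labels) (k : nat) : V :=
  if k is k'.+1 then if insub k' is Some i then l i else ord0 else ord0.
Let valid_labels := [set l in ffun_on (predC1 (ord0 : V)) | injectiveb (l : labels)]%SET.

Let lab_ofE (l : labels) (i : 'I_m) : lab_of l i.+1 = l i.
Proof. by rewrite /lab_of valK. Qed.

Let lab_of_inj l : l \in valid_labels ->
  forall s t, (s <= m)%N -> (t <= m)%N -> lab_of l s = lab_of l t -> s = t.
Proof.
rewrite finset.inE => /andP[/ffun_onP l0 /injectiveP linj].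
have ne s : (s < m)%N -> lab_of l s.+1 <> ord0.
  by move=> sm; rewrite (lab_ofE l (Ordinal sm)); apply/eqP; exact: l0.
case=> [|s] [|t] // sm tm; first by move=> /esym/ne -/(_ tm).
  by move=> /ne -/(_ sm).
by rewrite (lab_ofE l (Ordinal sm)) (lab_ofE l (Ordinal tm)) => /linj[->].
Qed.

Let card_valid_labels : #|valid_labels| = (N ^_ m)%N.
Proof. by rewrite card_inj_ffuns_on cardC1 !card_ord. Qed.

Let index := (parents m * labels)%type.
(** All pairs serve as indices; the invalid ones get empty events, for which domination is
    trivial. *)
Let valid (a : index) : bool := valid_parents a.1 && (a.2 \in valid_labels).

Let A (a : index) : set R := [set w | valid a /\
  edge_event E m K delta (lab_of a.2) (par_of a.1) w].
Let Btree (a : index) : set (R * R) := weight_event X m K delta (par_of a.1) `*`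
  mark_event M m (lab_of a.2) (par_of a.1).
Let B (a : index) : set (R * R) := [set w | valid a /\ Btree a w].

Let valid_le a : valid a -> forall k, (k < m)%N -> (par_of a.1 k <= k)%N.
Proof. by move=> /andP[vp _] k; exact: par_of_le. Qed.

Let valid_inj a : valid a -> forall s t, (s <= m)%N -> (t <= m)%N ->
  lab_of a.2 s = lab_of a.2 t -> s = t.
Proof. by move=> /andP[_ vl]; exact: lab_of_inj. Qed.

Let mA a : measurable (A a).
Proof. by apply: mprop_and; [exact: mprop_cst|exact: measurable_edge_event]. Qed.

Let mBtree a : measurable (Btree a).
Proof.
apply: measurableX; first exact: measurable_weight_event.
exact: (measurable_mark_event hM).
Qed.

Let mB a : measurable (B a).
Proof. by apply: mprop_and; [exact: mprop_cst|exact: mBtree]. Qed.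

Let tA a b w : A a w -> A b w -> a = b.
Proof.
move=> [va ha] [vb hb].
have ab := prim_run_unique d0 (erefl : lab_of a.2 0 = lab_of b.2 0) (valid_inj va) (valid_inj vb) (valid_le va) (valid_le vb) ha hb.
case: a b va vb ha hb ab => [f l] [f' l'] va vb ha hb /= ab.
congr pair; apply/ffunP => i; have [e1 e2] := ab i (ltn_ord i).
  by apply: val_inj; rewrite /= -!par_ofE.
by rewrite -!lab_ofE.
Qed.

Let tB a b w : B a w -> B b w -> a = b.
Proof.
move=> [va [wa ma]] [vb [wb mb]].
have /andP[pa _] := va; have /andP[pb _] := vb.
have e := weight_event_disjoint d0 pa pb wa wb.
case: a b va vb wa ma wb mb pa pb e => [f l] [f' l'] /= va vb wa ma wb mb pa pb e.
rewrite -e in mb *; congr pair; apply/ffunP => i.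
by rewrite -!lab_ofE -(ma i.+1)// -(mb i.+1).
Qed.

Let dom a : ((U \x U) (B a) <= U (A a))%E.
Proof.
have [va|nva] := pselect (valid a); last first.
  have -> : B a = set0 by apply/seteqP; split => // w [].
  by rewrite [leLHS]measure0; exact: measure_ge0.
rewrite (_ : B a = Btree a); last by apply/seteqP; split => w; [case|split].
rewrite (_ : A a = edge_event E m K delta (lab_of a.2) (par_of a.1)); last first.
  by apply/seteqP; split => w; [case|split].
exact: (run_domination hE tailE E0 hX Lap hM _ _ (valid_inj va) (valid_le va)).
Qed.

Let B_law a : valid a -> (U \x U)%E (B a) =
  (fine (U (weight_event X m K delta (par_of a.1))) * n^-1 ^+ m)%:E.
Proof.
move=> va; rewrite (_ : B a = Btree a); last by apply/seteqP; split => w; [case|split].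
have mW := measurable_weight_event X m K delta (par_of a.1).
rewrite [LHS]product_measure1E//; last exact: (measurable_mark_event hM).
rewrite [X in (_ * X)%E](_ : _ = (n^-1 ^+ m)%:E).
  by rewrite EFinM fineK// prob_fin.
etransitivity; first exact: (mark_event_law hM (erefl : lab_of a.2 0 = ord0) (valid_le va)).
by rewrite card_ord.
Qed.

(** The glued law makes every [B a] occur together with [A a]. For a given shape, each of the
    [N ^_ m] admissible labellings has probability [n^-1 ^+ m], whence the second factor. *)
Lemma coupling_upto : exists C : coupling R (ord0 : V),
  (forall m', measurable (SWT_eq_IP_upto C h m')) /\
  (((\sum_(f : parents m | valid_parents f) fine (U (weight_event X m K delta (par_of f)))) *
     ((N ^_ m)%:R / n ^+ m))%:E <= cprob C (SWT_eq_IP_upto C h m))%E.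
Proof.
have [Q [Q1 Q2 QAB]] := glue_dominated mA mB tA tB dom.
exists (glued hE hX hM Q1 Q2); split; first by move=> m'; exact: measurable_glued_event.
have mAB a : measurable (A a `*` B a) by exact: measurableX.
(* When [A a] and [B a] both occur, the two sides are the same labelled tree: [SWT] by the Prim run,
   the image of [IP] by the invasion run. *)
have sub : [set w | exists2 a, valid a & (A a `*` B a) w] `<=`
    SWT_eq_IP_upto (glued hE hX hM Q1 Q2) h m.
  move=> w [a va [[_ wA] [_ [wW wM]]]] k km /=.
  have n0 : n != 0 by rewrite pnatr_eq0.
  rewrite (_ : (fun e => _) = (fun y => h (y / n)) \o (fun e => n * E e w.1)); last first.
    by apply/funext => e /=; rewrite mulrAC divff// mul1r.
  rewrite -[ord0]/(lab_of a.2 0).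
  rewrite (SWT_prim_run (K := K) (delta := delta) (m := m) (par := par_of a.1))//.
  - rewrite (invasion_run_IP (valid_le va) d0 wW.1 km).
    by rewrite (mark_image_run (valid_le va) (valid_inj va) wM km).
  - exact: valid_inj.
  - exact: valid_le.
  - by move=> e; rewrite mulr_gt0 ?ltr0n.
  - by move=> y y0; apply: h_gt0; rewrite divr_gt0 ?ltr0n.
  - by move: wA; rewrite /edge_event /= card_ord.
apply: (@le_trans _ _ (Q [set w | exists2 a, valid a & (A a `*` B a) w])); last first.
  apply: (@prob_le _ _ _ Q) => //; last exact: measurable_glued_event.
  rewrite (_ : [set _ | _] = [set w | exists a, valid a /\ (A a `*` B a) w]).
    apply: mprop_exists => a; apply: mprop_and; first exact: mprop_cst.
    exact: mAB.
  by apply/seteqP; split => w [a]; [move=> ? ?; exists a|move=> [? ?]; exists a].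
rewrite measure_fin_partition//; last first.
  by move=> a b w [wa _] [wb _]; exact: tA wa wb.
rewrite (eq_bigr (fun a => (fine (U (weight_event X m K delta (par_of a.1))) * n^-1 ^+ m)%:E)); last first.
  by move=> a va; etransitivity; [exact: QAB|exact: B_law].
rewrite sumEFin lee_fin.
rewrite -(pair_big (@valid_parents m) (fun l => l \in valid_labels)
  (fun f _ => fine (U (weight_event X m K delta (par_of f))) * n^-1 ^+ m))/=.
rewrite mulr_suml le_eqVlt; apply/orP; left; apply/eqP; apply: eq_bigr => f _.
rewrite sumr_const card_valid_labels -mulrnAr; congr (_ * _).
by rewrite exprVn [LHS]mulr_natl.
Qed.

End upto.
End gluing.

(** The ratio is the probability that [m] uniform marks among [N.+1] are distinct and differ from
    the mark of the root. *)
Lemma falling_ratio_cvg (R : realType) m :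
  ((N ^_ m)%:R / N.+1%:R ^+ m : R) @[N --> \oo] --> (1 : R).
Proof.
have h i : ((N - i)%:R / N.+1%:R : R) @[N --> \oo] --> (1 : R).
  have inv : (i.+1%:R * N.+1%:R^-1 : R) @[N --> \oo] --> (i.+1%:R * 0 : R).
    by apply: cvgM; [exact: cvg_cst|exact: (@cvg_harmonic R)].
  rewrite mulr0 in inv.
  have c : (1 - i.+1%:R * N.+1%:R^-1 : R) @[N --> \oo] --> (1 : R).
    by rewrite -[X in _ --> X]subr0; apply: cvgB => //; exact: cvg_cst.
  apply: cvg_trans c; apply: near_eq_cvg; near=> N; rewrite /=.
  have iN : (i <= N)%N by near: N; exact: nbhs_infty_ge.
  rewrite -subSS natrB// mulrBl divff ?pnatr_eq0//.
have := @cvg_prodR R 'I_m (index_enum 'I_m) (fun i N => (N - i)%:R / N.+1%:R) (fun=> 1) (fun i => h i).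
rewrite big1// => c; apply: cvg_trans c; apply: near_eq_cvg; near=> N.
rewrite big_split/= prodr_const card_ord exprVn; congr (_ * _).
by rewrite ffact_prod natr_prod.
Unshelve. all: end_near. Qed.

Lemma coupling_eventually (R : realType) (g : nat -> R -> R)
  (g_gt0 : forall n : nat, (0 < n)%N -> forall x : R, 0 < x -> 0 < g n x)
  (g_incr : forall n : nat, (0 < n)%N ->
     forall x y : R, 0 < x -> x < y -> g n x < g n y)
  (f_ratio : forall x delta : R, 0 < x -> 0 < delta ->
     (rescaled g n (x + delta) / rescaled g n x) @[n --> \oo] --> +oo) m (e : R) :
  0 < e -> \forall N \near \oo, exists C : coupling R (ord0 : 'I_N.+1),
    (forall m', measurable (SWT_eq_IP_upto C (g N.+1) m')) /\
    ((1 - e)%:E <= cprob C (SWT_eq_IP_upto C (g N.+1) m))%E.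
Proof.
move=> e0; have [X [hX Lap]] := @pwit_exists R.
have e20 : 0 < e / 2 by rewrite divr_gt0.
have [K [delta [d0 hsum]]] := run_probability m hX e20.
have [n0 _ hn0] := uniform_ratio g_gt0 g_incr f_ratio K d0 (ler0n R m.+1).
near=> N.
have [E [hE E0 tailE]] := @exp_edges_exist R 'I_N.+1.
have [M hM] := @uniform_marks_exist R N.
have ratio y z : 0 < y -> y <= K -> y + delta <= z ->
    m.+1%:R * g N.+1 (y / N.+1%:R) <= g N.+1 (z / N.+1%:R).
  apply: hn0 => /=; apply: leqW; near: N; exact: nbhs_infty_ge.
have [C [mC hC]] := coupling_upto hE tailE E0 hX Lap hM (g_gt0 _ (ltn0Sn N)) (g_incr _ (ltn0Sn N)) d0 ratio.
exists C; split => //; apply: le_trans hC; rewrite lee_fin.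
have : 1 - e / 2 <= (N ^_ m)%:R / N.+1%:R ^+ m :> R.
  near: N; apply: (cvgr_ge _ (@falling_ratio_cvg R m)); lra.
move: (hsum); set s := \sum_(f | _) _; set r := _ / _ => hs hr.
have s0 : 0 <= s by apply: sumr_ge0 => f _; rewrite fine_ge0.
have r0 : 0 <= r by rewrite divr_ge0// exprn_ge0.
(* For [e > 2] the lower bounds [1 - e / 2] are negative and cannot be multiplied, but then [1 - e]
   is negative too. *)
have [e2|e2] := leP e 2; last by apply: (@le_trans _ _ 0); [lra|exact: mulr_ge0].
apply: (@le_trans _ _ ((1 - e / 2) * (1 - e / 2))); last by apply: ler_pM => //; lra.
by nra.
Unshelve. all: end_near. Qed.

Unset Implicit Arguments.

Theorem theorem2p7 (R : realType) (g : nat -> R -> R)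
  (g_gt0 : forall n : nat, (0 < n)%N -> forall x : R, 0 < x -> 0 < g n x)
  (g_incr : forall n : nat, (0 < n)%N ->
     forall x y : R, 0 < x -> x < y -> g n x < g n y)
  (f_ratio : forall x delta : R, 0 < x -> 0 < delta ->
     (rescaled g n (x + delta) / rescaled g n x) @[n --> \oo] --> +oo) :
  exists C : forall N : nat, coupling R (ord0 : 'I_N.+1),
    forall m : nat,
      (forall N : nat, measurable (SWT_eq_IP_upto (C N) (g N.+1) m)) /\
      cprob (C N) (SWT_eq_IP_upto (C N) (g N.+1) m) @[N --> \oo] --> 1%E.
Proof.
pose good N (C : coupling R (ord0 : 'I_N.+1)) := forall m, measurable (SWT_eq_IP_upto C (g N.+1) m).
pose close m N (C : coupling R (ord0 : 'I_N.+1)) :=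
  ((1 - m.+1%:R^-1)%:E <= cprob C (SWT_eq_IP_upto C (g N.+1) m))%E.
(* Diagonal choice: for each [N] the coupling serves the largest [m <= N] for which a [close] one
   exists. It then serves all smaller levels, because the event decreases in [m] while the required
   bound increases. *)
have pick N : exists C, good N C /\ forall m, (m <= N)%N ->
    (exists C', good N C' /\ close m N C') -> close m N C.
  have [[m [mN hm]]|none] := pselect (exists m, (m <= N)%N /\ exists C', good N C' /\ close m N C').
    pose P m := `[< exists C', good N C' /\ close m N C' >] && (m <= N)%N.
    have exP : exists m, P m by exists m; rewrite /P mN andbT; apply/asboolP.
    have ubP i : P i -> (i <= N)%N by move=> /andP[].
    case: (ex_maxnP exP ubP) => i /andP[/asboolP[C [gC cC]] iN] imax.
    exists C; split => // j jN hj.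
    have ji : (j <= i)%N by apply: imax; rewrite /P jN andbT; apply/asboolP.
    apply: (@le_trans _ _ (1 - i.+1%:R^-1)%:E).
      by rewrite lee_fin lerD2l lerN2 lef_pV2 ?posrE ?ltr0n// ler_nat.
    apply: le_trans cC _; apply: (@prob_le _ _ _ (cprob C)) => //.
    by move=> w hw k kj; apply: hw; exact: leq_trans ji.
  suff [C gC] : exists C, good N C.
    by exists C; split => // m mN hm; case: none; exists m.
  have [X [hX Lap]] := @pwit_exists R.
  have [E [hE E0 tailE]] := @exp_edges_exist R 'I_N.+1.
  have [M hM] := @uniform_marks_exist R N.
  (* Any coupling with measurable events will do here; with [m = 0] and [K = 0] the ratio condition
     is vacuous. *)
  have no_ratio y z : 0 < y -> y <= 0 -> y + 1 <= z ->
      1%:R * g N.+1 (y / N.+1%:R) <= g N.+1 (z / N.+1%:R).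
    by move=> y0; rewrite leNgt y0.
  have [C [mC _]] := coupling_upto hE tailE E0 hX Lap hM (g_gt0 _ (ltn0Sn N))
    (g_incr _ (ltn0Sn N)) (m := 0) ltr01 no_ratio.
  by exists C.
exists (fun N => projT1 (cid (pick N))) => m; split.
  by move=> N; case: (cid (pick N)) => C /= [gC _]; exact: gC.
have cprob_lb e : 0 < e -> \forall N \near \oo,
    ((1 - e)%:E <= cprob (projT1 (cid (pick N)))
      (SWT_eq_IP_upto (projT1 (cid (pick N))) (g N.+1) m))%E.
  (* The level [i] must be at least [m], so that its event is contained in that of [m], and large
     enough that [1 / (i + 1) <= e]. *)
  move=> e0; pose i := maxn m (Num.truncn e^-1).
  have ie : i.+1%:R^-1 <= e.
    rewrite -[leRHS]invrK lef_pV2 ?posrE ?ltr0n ?invr_gt0//.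
    apply: (@le_trans _ _ (Num.truncn e^-1).+1%:R); first by apply/ltW/truncnS_gt.
    by rewrite ler_nat ltnS leq_maxr.
  have i0 : 0 < i.+1%:R^-1 :> R by rewrite invr_gt0 ltr0n.
  near=> N; case: (cid (pick N)) => C /= [gC hC].
  have cC : close i N C.
    apply: hC; first by near: N; exact: nbhs_infty_ge.
    by near: N; exact: (coupling_eventually g_gt0 g_incr f_ratio i i0).
  apply: (@le_trans _ _ (1 - i.+1%:R^-1)%:E); first by rewrite lee_fin lerD2l lerN2.
  apply: le_trans cC _; apply: (@prob_le _ _ _ (cprob C)) => //.
  by move=> w hw k km; apply: hw; exact: leq_trans km (leq_maxl _ _).
apply/fine_cvgP; split.
  by near=> N; apply: prob_fin; case: (cid (pick N)) => C /= [gC _]; exact: gC.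
apply/cvgrPdist_le => e e0; near=> N.
have lb : ((1 - e)%:E <= cprob (projT1 (cid (pick N)))
      (SWT_eq_IP_upto (projT1 (cid (pick N))) (g N.+1) m))%E.
  by near: N; exact: cprob_lb.
have mE : measurable (SWT_eq_IP_upto (projT1 (cid (pick N))) (g N.+1) m).
  by case: (cid (pick N)) => C /= [gC _]; exact: gC.
have := probability_le1 (cprob (projT1 (cid (pick N)))) mE.
move: lb; rewrite /= -[cprob _ _]fineK ?prob_fin// !lee_fin => lb ub.
by rewrite ger0_norm ?subr_ge0//; lra.
Unshelve. all: end_near. Qed.
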